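(* For each natural number $k$, the (covariant) functor $\circ_{\mathcal G}[k]:GB_k\to FGWCB_k$, defined as the composition of the contravariant functor $F\mapsto F^{\ast[k]}_{\mathcal G}$ with the graded duality functor, i.e. sending $F$ to the graded dual $(F^{\ast[k]}_{\mathcal G})^\ast$, establishes an equivalence between the category $GB_k$ of graded bundles of degree $k$ and the category $FGWCB_k$ of free graded Weil coalgebra bundles of order $k$.
   Context: Algebras are real, commutative, associative, with unit; $\mathbb N=\{0,1,2,\dots\}$. **Graded bundles.** Let $\mathcal G=(\mathbb R,\cdot)$ be the multiplicative monoid of reals. A graded bundle is a smooth manifold $F$ with a smooth action $h:\mathbb R\times F\to F$ of $\mathcal G$ ($h_t\circ h_s=h_{ts}$, $h_1=\mathrm{id}$). Its base is $M=h_0(F)$, its projection is $h_0:F\to M$. It is locally trivial with one typical fibre: there is $\mathbf d=(d_1,\dots,d_r)$, $d_i\in\mathbb N$, such that locally over $M$ it is isomorphic to $U\times\mathbb R^{\mathbf d}$, $\mathbb R^{\mathbf d}=\mathbb R^{d_1}\times\dots\times\mathbb R^{d_r}$, with $h_t(x,y_1,\dots,y_r)=(x,ty_1,\dots,t^ry_r)$. It is of degree $k$ (meaning at most $k$) if one can take $r=k$. Morphisms are smooth maps intertwining the actions; such a map $f:F\to E$ covers a smooth map $\underline f$ of the bases. $GB_k$ is the category of graded bundles of degree (at most) $k$. **Algebras and coalgebras.** $\mathcal A(\mathbb R^{\mathbf d})=\mathbb R[y_i^a]$ ($1\le a\le d_i$) is the polynomial algebra with $y_i^a$ of weight $i$,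 and $\mathcal A^{>k}(\mathbb R^{\mathbf d})$ is the ideal spanned by elements of weight $>k$. A free graded Weil algebra of order $k$ is a graded algebra isomorphic to $\mathcal A(\mathbb R^{\mathbf d})/\mathcal A^{>k}(\mathbb R^{\mathbf d})$ for some $\mathbf d=(d_1,\dots,d_k)$ (equivalently, a finite-dimensional graded local algebra concentrated in weights $0,\dots,k$ with homogeneous generators such that a nonzero weighted-homogeneous polynomial in them vanishes iff its weight is $>k$). A free graded Weil coalgebra of order $k$ is the graded dual $A^\ast=\bigoplus_i(A^i)^\ast$ of a free graded Weil algebra $A$ of order $k$, with comultiplication and counit dual to the multiplication and unit of $A$. Let $\mathbb A^{[k]}=\mathbb R[\varepsilon]/\langle\varepsilon^{k+1}\rangle$, graded by $\deg\varepsilon^i=i$, with $\mathcal G$-action $h_t(\varepsilon^i)=t^i\varepsilon^i$. **Bundles.** Objects of $FGWCB_k$ are graded vector bundles $\mathbf C=\bigoplus_{i=0}^k\mathbf C^i$ over manifolds, locally trivialized as $U\times C$ with $C$ a free graded Weil coalgebra of order $k$ and smooth transition cocycles valued in graded coalgebra automorphisms of $C$. Morphisms of $FGWCB_k$ are degree-preserving smooth vector bundle morphisms (over smooth base maps, in the same direction) which are fibrewise graded coalgebra homomorphisms. **Functor.** For $F\to M$ in $GB_k$, $F^{\ast[k]}_{\mathcal G}\to M$ has fibres $\mathrm{Hom}_{\mathcal G}(F_x,\mathbb A^{[k]})$, the algebra (pointwise operations) of smooth maps intertwining the actions; its degree-$i$ part ($0\le i\le k$) consists of maps valued in $\mathbb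 R\varepsilon^i$ and its smooth sections correspond to smooth functions $g$ on $F$ with $g\circ h_t=t^ig$. Its graded dual is a coalgebra bundle by dualizing multiplication and unit. For a morphism $f:F\to E$ over $\underline f:M\to N$, the morphism $(F^{\ast[k]}_{\mathcal G})^\ast\to(E^{\ast[k]}_{\mathcal G})^\ast$ over $\underline f$ is, fibrewise, the dual of $\alpha\mapsto\alpha\circ f_x$, where $f_x:F_x\to E_{\underline f(x)}$. *)

(* Defs.v *)
From HB Require Import structures.
From mathcomp Require Import all_boot all_order all_algebra.
From mathcomp Require Import all_classical all_reals all_analysis.
From mathcomp Require Import -(notations) mpoly.
Import Order.TTheory GRing.Theory Num.Theory numFieldNormedType.Exports.

Set Implicit Arguments.
Unset Strict Implicit.
Unset Printing Implicit Defensive.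

Local Open Scope classical_set_scope.
Local Open Scope ring_scope.

(* A smooth structure on a topological space is given by its sheaf of smooth
   real functions (a "functional structure", Bredon, Topology and Geometry,
   II.2), presented by germs: [sm_at x f] means that [f] is smooth on some
   neighbourhood of [x], the values of [f] elsewhere being irrelevant. *)
Record smooth_space (R : realType) := SmoothSpace {
  pts :> topologicalType;
  sm_at : pts -> (pts -> R) -> Prop }.
Arguments sm_at {R s} x f.

Section SmoothSpaces.
Variable R : realType.
Implicit Types X Y : smooth_space R.

Definition smooth_map X Y (f : X -> Y) : Prop :=
  continuous f /\
  forall (x : X) (g : Y -> R), sm_at (f x) g -> sm_at x (g \o f).

Definition pderive n (i : 'I_n) (f : 'rV[R]_n -> R) : 'rV[R]_n -> R :=
  fun x => 'D_(delta_mx 0 i) f x.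

(* C^oo near x: all iterated partial derivatives exist and are continuous. *)
Definition euclid_sm_at n (x : 'rV[R]_n) (f : 'rV[R]_n -> R) : Prop :=
  \forall y \near x, forall s : seq 'I_n,
    {for y, continuous (foldr (@pderive n) f s)} /\
    forall i, derivable (foldr (@pderive n) f s) y (delta_mx 0 i).

Definition euclid n : smooth_space R :=
  @SmoothSpace R 'rV[R]_n (@euclid_sm_at n).

(* Induced structure on a subset: locally restrictions of smooth functions. *)
Definition sub_space X (S : set X) : smooth_space R :=
  @SmoothSpace R (set_type S) (fun x g =>
    exists2 G : X -> R, sm_at (val x) G & \forall y \near x, g y = G (val y)).

(* Product structure: locally, smooth functions of finitely many functions,
   each of which is smooth on one of the two factors. *)
Definition prod_space X Y : smooth_space R :=
  @SmoothSpace R (X * Y)%type (fun z f =>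
    exists m p (a : X -> 'rV[R]_m) (b : Y -> 'rV[R]_p) (G : 'rV[R]_(m + p) -> R),
    [/\ forall i, sm_at z.1 (fun x => a x 0 i),
        forall j, sm_at z.2 (fun y => b y 0 j),
        euclid_sm_at (row_mx (a z.1) (b z.2)) G &
        \forall u \near z, f u = G (row_mx (a u.1) (b u.2))]).

(* phi restricts to a diffeomorphism of the open set U onto the open set V,
   with inverse psi; the values of phi and psi outside U and V are junk. *)
Definition local_diffeo X Y (U : set X) (V : set Y)
    (phi : X -> Y) (psi : Y -> X) : Prop :=
  [/\ open U, open V,
      (forall x, U x -> V (phi x) /\ psi (phi x) = x),
      (forall y, V y -> U (psi y) /\ phi (psi y) = y) &
      [/\ (forall x, U x -> {for x, continuous phi}),
          (forall y, V y -> {for y, continuous psi}) &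
          forall x, U x -> forall f, sm_at x f <-> sm_at (phi x) (f \o psi)]].

Definition is_manifold X : Prop :=
  [/\ hausdorff_space X, @second_countable X &
      exists n, forall x : X, exists (U : set X) (V : set (euclid n)) phi psi,
        U x /\ local_diffeo U V phi psi].

Lemma near_open (T : topologicalType) (x : T) (P : T -> Prop) :
  (\forall y \near x, P y) -> exists U : set T, [/\ open U, U x & U `<=` P].
Proof.
move=> xP; have : nbhs x P by [].
by rewrite nbhsE => -[U [oU Ux] UP]; exists U.
Qed.

Section Euclid.
Variable n : nat.
Notation E := 'rV[R]_n.
Notation D f s := (foldr (@pderive n) f s).

Let good (U : set E) (f : E -> R) := forall y, U y -> forall s : seq 'I_n,
  {for y, continuous (D f s)} /\ forall i, derivable (D f s) y (delta_mx 0 i).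

Let open_near (U : set E) (f g : E -> R) y : open U -> U y ->
  (forall z, U z -> f z = g z) -> \forall z \near y, f z = g z.
Proof.
move=> oU Uy fg; have : nbhs y U by apply: open_nbhs_nbhs.
by apply: filterS => z; exact: fg.
Qed.

Let good_coind (U : set E) (Q : (E -> R) -> Prop) : open U ->
  (forall f, Q f -> forall y, U y ->
     {for y, continuous f} /\ forall i, derivable f y (delta_mx 0 i)) ->
  (forall f i, Q f -> exists2 g, Q g & forall y, U y -> pderive i f y = g y) ->
  forall f g, Q g -> (forall y, U y -> f y = g y) -> good U f.
Proof.
move=> oU Q1 Q2 f g Qg fg y Uy s.
have [g' Qg' fg'] : exists2 g', Q g' & forall y, U y -> D f s y = g' y.
  elim: s => [|i s [g' Qg' IH]]; first by exists g.
  have [g2 Qg2 e] := Q2 _ i Qg'; exists g2 => // z Uz; rewrite -(e _ Uz) /=.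
  by apply: near_eq_derive; exact: open_near oU Uz IH.
have fgn := open_near oU Uy fg'.
have gfn : \near y, g' y = D f s y by apply: filterS fgn => z ->.
have [c d] := Q1 _ Qg' _ Uy; split=> [|i]; last first.
  by apply: (near_eq_derivable _ (d i)); exact: gfn.
rewrite /prop_for /continuous_at (fg' _ Uy).
by apply: (cvg_trans _ c); exact: near_eq_cvg gfn.
Qed.

Let good_pderive U f i : good U f -> good U (pderive i f).
Proof.
by move=> gf y Uy s; have := gf y Uy (rcons s i); rewrite foldr_rcons.
Qed.

Inductive gen (U : set E) : (E -> R) -> Prop :=
| gen_good f : good U f -> gen U f
| gen_cst c : gen U (cst c)
| gen_add f g : gen U f -> gen U g -> gen U (f \+ g)
| gen_mul f g : gen U f -> gen U g -> gen U (f \* g).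

Let gen_good_sub U f : open U -> gen U f -> good U f.
Proof.
move=> oU gf.
have Q1 : forall f, gen U f -> forall y, U y ->
     {for y, continuous f} /\ forall i, derivable f y (delta_mx 0 i).
  move=> h; elim=> {h} [h gh y Uy|c y Uy|h g _ IHf _ IHg y Uy
                      |h g _ IHf _ IHg y Uy].
  - exact: (gh y Uy [::]).
  - by split=> [|i]; [exact: cst_continuous|exact: derivable_cst].
  - have [cf df] := IHf y Uy; have [cg dg] := IHg y Uy.
    by split=> [|i]; [exact: continuousD|exact: derivableD].
  - have [cf df] := IHf y Uy; have [cg dg] := IHg y Uy.
    by split=> [|i]; [exact: continuousM|exact: derivableM].
apply: (good_coind oU Q1 _ gf) => // h i.
elim=> {h} [h gh|c|h g Gf [f' Gf' ef] Gg [g' Gg' eg]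
           |h g Gf [f' Gf' ef] Gg [g' Gg' eg]].
- by exists (pderive i h) => //; apply: gen_good; exact: good_pderive.
- by exists (cst 0); [exact: gen_cst|move=> y _; rewrite /pderive derive_cst].
- exists (f' \+ g'); first exact: gen_add.
  move=> y Uy; have [_ df] := Q1 _ Gf y Uy; have [_ dg] := Q1 _ Gg y Uy.
  by rewrite /pderive deriveD //= -ef // -eg.
- exists ((h \* g') \+ (g \* f')); first by apply: gen_add; exact: gen_mul.
  move=> y Uy; have [_ df] := Q1 _ Gf y Uy; have [_ dg] := Q1 _ Gg y Uy.
  by rewrite /pderive deriveM //= -ef // -eg.
Qed.

Lemma euclid_smD (x : euclid n) f g :
  sm_at x f -> sm_at x g -> sm_at x (f \+ g).
Proof.
move=> /near_open[U [oU Ux gf]] /near_open[V [oV Vx gg]].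
have oUV : open (U `&` V) by exact: openI.
have : nbhs x (U `&` V) by apply: open_nbhs_nbhs; split.
apply: filterS => y UVy; apply: (gen_good_sub oUV) UVy.
by apply: gen_add; apply: gen_good => z [Uz Vz]; [exact: gf|exact: gg].
Qed.

Lemma euclid_smM (x : euclid n) f g :
  sm_at x f -> sm_at x g -> sm_at x (f \* g).
Proof.
move=> /near_open[U [oU Ux gf]] /near_open[V [oV Vx gg]].
have oUV : open (U `&` V) by exact: openI.
have : nbhs x (U `&` V) by apply: open_nbhs_nbhs; split.
apply: filterS => y UVy; apply: (gen_good_sub oUV) UVy.
by apply: gen_mul; apply: gen_good => z [Uz Vz]; [exact: gf|exact: gg].
Qed.

Lemma euclid_sm_cst (x : euclid n) c : sm_at x (cst c).
Proof.
apply: (@filterS _ _ _ setT); last exact: filterT.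
by move=> y _; apply: (gen_good_sub openT); [exact: gen_cst|].
Qed.

Lemma euclid_sm_near (x : euclid n) f g :
  (\forall y \near x, g y = f y) -> sm_at x f -> sm_at x g.
Proof.
move=> /near_open[U [oU Ux gf]] /near_open[V [oV Vx gg]].
have oUV : open (U `&` V) by exact: openI.
have : nbhs x (U `&` V) by apply: open_nbhs_nbhs; split.
apply: filterS => y UVy.
apply: (@good_coind _ (good (U `&` V)) oUV _ _ _ f) UVy.
- by move=> h gh z UVz; exact: (gh z UVz [::]).
- by move=> h i gh; exists (pderive i h) => //; exact: good_pderive.
- by move=> z [_ Vz]; exact: gg.
- by move=> z [Uz _]; exact: gf.
Qed.

End Euclid.

Section Manifold.
Variables (X : smooth_space R) (mX : is_manifold X).

Lemma sm_atD (x : X) f g : sm_at x f -> sm_at x g -> sm_at x (f \+ g).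
Proof.
have [_ _ [n /(_ x)[U [V [phi [psi [Ux [_ _ _ _ [_ _ sm]]]]]]]]] := mX.
by rewrite !(sm _ Ux); exact: euclid_smD.
Qed.

Lemma sm_atM (x : X) f g : sm_at x f -> sm_at x g -> sm_at x (f \* g).
Proof.
have [_ _ [n /(_ x)[U [V [phi [psi [Ux [_ _ _ _ [_ _ sm]]]]]]]]] := mX.
by rewrite !(sm _ Ux); exact: euclid_smM.
Qed.

Lemma sm_at_cst (x : X) c : sm_at x (cst c).
Proof.
have [_ _ [n /(_ x)[U [V [phi [psi [Ux [_ _ _ _ [_ _ sm]]]]]]]]] := mX.
by rewrite !(sm _ Ux); exact: euclid_sm_cst.
Qed.

Lemma sm_at_near (x : X) f g :
  (\forall y \near x, g y = f y) -> sm_at x f -> sm_at x g.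
Proof.
have [_ _ [n /(_ x)[U [V [phi [psi [Ux [_ _ UV VU [_ c sm]]]]]]]]] := mX.
move=> fg; rewrite !(sm _ Ux); apply: euclid_sm_near => /=.
have [Vx xE] := UV _ Ux; have := c _ Vx.
by rewrite /prop_for /continuous_at xE => /(_ _ fg).
Qed.

Lemma sm_at_sum (x : X) (I : Type) (r : seq I) (f : I -> X -> R) :
  (forall i, sm_at x (f i)) -> sm_at x (fun y => \sum_(i <- r) f i y).
Proof.
move=> sf; elim: r => [|i r IH].
  by under eq_fun do rewrite big_nil; exact: sm_at_cst.
by under eq_fun do rewrite big_cons; exact: sm_atD.
Qed.

Variable S : set X.

Lemma sub_smD (x : sub_space S) f g :
  sm_at x f -> sm_at x g -> sm_at x (f \+ g).
Proof.
move=> [F sF eF] [G sG eG]; exists (F \+ G); first exact: sm_atD.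
by near=> y; rewrite /= (near eF y) ?(near eG y).
Unshelve. all: by end_near. Qed.

Lemma sub_smM (x : sub_space S) f g :
  sm_at x f -> sm_at x g -> sm_at x (f \* g).
Proof.
move=> [F sF eF] [G sG eG]; exists (F \* G); first exact: sm_atM.
by near=> y; rewrite /= (near eF y) ?(near eG y).
Unshelve. all: by end_near. Qed.

Lemma sub_sm_cst (x : sub_space S) c : sm_at x (cst c).
Proof.
exists (cst c); first exact: sm_at_cst.
by near=> y.
Unshelve. all: by end_near. Qed.

Lemma sub_sm_sum (x : sub_space S) (I : Type) (r : seq I)
    (f : I -> sub_space S -> R) :
  (forall i, sm_at x (f i)) -> sm_at x (fun y => \sum_(i <- r) f i y).
Proof.
move=> sf; elim: r => [|i r IH].
  by under eq_fun do rewrite big_nil; exact: sub_sm_cst.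
by under eq_fun do rewrite big_cons; exact: sub_smD.
Qed.

End Manifold.
End SmoothSpaces.

Section GradedBundles.
Variable R : realType.

Record gspace := GSpace { gpts :> smooth_space R; gact : R -> gpts -> gpts }.

Implicit Types (F : gspace) (k : nat).

(* The base h_0(F). *)
Definition base F : smooth_space R := sub_space (range (@gact F 0)).

Definition proj F (y : F) : base F :=
  exist _ (gact 0 y) (mem_set (imageT (@gact F 0) y)).

Definition fiber F (x : base F) : smooth_space R :=
  sub_space [set y : F | proj y = x].

(* R^d is given by one weight per coordinate: w j = i for d_i values of j. *)
Definition weight_act n (w : 'I_n -> nat) (t : R) (v : 'rV[R]_n) : 'rV[R]_n :=
  \row_j (t ^+ w j * v 0 j).

Definition weights_upto k n (w : 'I_n -> nat) : Prop :=
  forall j, (0 < w j <= k)%N.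

Definition is_gbundle k F : Prop :=
  [/\ is_manifold F,
      [/\ forall y : F, gact 1 y = y,
          forall s t (y : F), gact t (gact s y) = gact (t * s) y &
          @smooth_map R (prod_space (euclid R 1) F) F
            (fun z => gact (z.1 0 0) z.2)],
      is_manifold (base F) &
      exists n (w : 'I_n -> nat), weights_upto k w /\
        forall x : base F, exists (U : set (base F))
          (phi : F -> prod_space (base F) (euclid R n)) psi,
        [/\ U x,
            @local_diffeo R F (prod_space (base F) (euclid R n))
              (@proj F @^-1` U) (U `*` setT) phi psi,
            forall y, U (proj y) -> (phi y).1 = proj y &
            forall t y, U (proj y) ->
              phi (gact t y) = (proj y, weight_act w t (phi y).2)]].

Record gbundle k := GBundle {
  gb_space :> gspace;
  gb_axioms : is_gbundle k gb_space }.

Record gb_hom k (F E : gbundle k) := GbHom {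
  gb_fun :> F -> E;
  gb_smooth : smooth_map gb_fun;
  gb_equiv : forall t y, gb_fun (gact t y) = gact t (gb_fun y) }.

Lemma gb_hom_eq k (F E : gbundle k) (f g : gb_hom F E) :
  (f : F -> E) = g -> f = g.
Proof.
case: f g => [f sf ef] [g sg eg] /= fg; case: _ / fg sg eg => sg eg.
by rewrite (Prop_irrelevance sf sg) (Prop_irrelevance ef eg).
Qed.

Lemma smooth_map_id (X : smooth_space R) : smooth_map (@id X).
Proof. by split=> // x; exact: cvg_id. Qed.

Lemma smooth_map_comp (X Y Z : smooth_space R) (g : Y -> Z) (f : X -> Y) :
  smooth_map g -> smooth_map f -> smooth_map (g \o f).
Proof.
move=> [cg sg] [cf sf]; split=> [x|x u su]; last first.
  exact: (sf x (u \o g) (sg (f x) u su)).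
by apply: continuous_comp; [exact: cf|exact: cg].
Qed.

Definition gb_id k (F : gbundle k) : gb_hom F F :=
  @GbHom k F F id (@smooth_map_id F) (fun t y => erefl).

Lemma gb_comp_equiv k (F E D : gbundle k) (g : gb_hom E D) (f : gb_hom F E) t y :
  (g \o f) (gact t y) = gact t ((g \o f) y).
Proof. by rewrite /= !gb_equiv. Qed.

Definition gb_comp k (F E D : gbundle k) (g : gb_hom E D) (f : gb_hom F E) :
    gb_hom F D :=
  @GbHom k F D (g \o f) (smooth_map_comp (gb_smooth g) (gb_smooth f))
    (gb_comp_equiv g f).

(* The algebra A^[k] = R[eps]/(eps^(k+1)) and the action eps^i |-> t^i eps^i. *)
Definition eps_alg k : comAlgType R := {poly %/ ('X^(k.+1) : {poly R})}.

Definition eps_coef k (a : eps_alg k) (i : nat) : R := (a : {poly R})`_i.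

Definition eps_act k (t : R) (a : eps_alg k) : eps_alg k :=
  in_qpoly _ (\poly_(i < k.+1) (t ^+ i * eps_coef a i)).

Definition eps_pow k (i : nat) : eps_alg k := in_qpoly _ 'X^i.

Lemma eps_coef_in k (p : {poly R}) i :
  eps_coef (in_qpoly _ p : eps_alg k) i = if (i < k.+1)%N then p`_i else 0.
Proof.
by rewrite /eps_coef /= mk_monic_Xn -Pdiv.RingMonic.take_poly_rmodp coef_take_poly.
Qed.

Lemma eps_coef_big k (a : eps_alg k) i : (k < i)%N -> eps_coef a i = 0.
Proof.
move=> ki; have -> : a = in_qpoly _ (a : {poly R}).
  by apply: val_inj; rewrite /= Pdiv.CommonRing.rmodp_small ?size_mk_monic.
by rewrite eps_coef_in ltnS leqNgt ki.
Qed.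

Lemma eps_eq k (a b : eps_alg k) : eps_coef a =1 eps_coef b -> a = b.
Proof. by move=> ab; apply: val_inj; apply/polyP. Qed.

Lemma eps_coefD k (a b : eps_alg k) i :
  eps_coef (a + b) i = eps_coef a i + eps_coef b i.
Proof. by rewrite /eps_coef poly_of_qpolyD coefD. Qed.

Lemma eps_coefZ k c (a : eps_alg k) i : eps_coef (c *: a) i = c * eps_coef a i.
Proof. by rewrite /eps_coef poly_of_qpolyZ coefZ. Qed.

Lemma eps_coefM k (a b : eps_alg k) i : (i < k.+1)%N ->
  eps_coef (a * b) i = \sum_(j < i.+1) eps_coef a j * eps_coef b (i - j)%N.
Proof.
move=> ik; have -> : a * b = in_qpoly _ ((a : {poly R}) * b) by [].
by rewrite eps_coef_in ik coefM.
Qed.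

Lemma eps_coef1 k i : eps_coef (1 : eps_alg k) i = (i == 0)%N%:R.
Proof. by rewrite /eps_coef -coef1. Qed.

Lemma eps_coef_act k t (a : eps_alg k) i :
  eps_coef (eps_act t a) i = t ^+ i * eps_coef a i.
Proof.
rewrite eps_coef_in coef_poly; case: ltnP => // ki.
by rewrite eps_coef_big ?mulr0.
Qed.

(* Elements of Hom_G(F_x, A^[k]).  The second condition is equivariance: z and
   y both lie in the fibre F_x. *)
Definition is_hom_G k F (x : base F) (alpha : fiber x -> eps_alg k) : Prop :=
  (forall i y, sm_at y (fun z => eps_coef (alpha z) i)) /\
  (forall t y z, val z = gact t (val y) -> alpha z = eps_act t (alpha y)).

Record hom_G k (F : gbundle k) (x : base F) := HomG {
  hom_G_fun :> fiber x -> eps_alg k;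
  _ : `[< is_hom_G hom_G_fun >] }.

HB.instance Definition _ k (F : gbundle k) (x : base F) :=
  [isSub for @hom_G_fun k F x].
HB.instance Definition _ k (F : gbundle k) (x : base F) :=
  [Choice of hom_G x by <:].

Section HomG.
Variables (k : nat) (F : gbundle k) (x : base F).

Lemma hom_GP (a : hom_G x) : is_hom_G a.
Proof. by case: a => a /= /asboolP. Qed.

Let mF : is_manifold F. Proof. by case: (gb_axioms F). Qed.

Lemma hom_G_cstP c : is_hom_G (fun=> c *: 1 : eps_alg k) (x := x).
Proof.
split=> [i y|t y z _]; first exact: (sub_sm_cst mF).
apply: eps_eq => i; rewrite eps_coef_act !eps_coefZ eps_coef1.
by case: i => [|i]; rewrite ?expr0 ?mul1r ?mulr0.
Qed.

Lemma hom_G_addP (a b : hom_G x) : is_hom_G (fun y => a y + b y).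
Proof.
have [sa ea] := hom_GP a; have [sb eb] := hom_GP b; split=> [i y|t y z yz].
  by under eq_fun do rewrite eps_coefD; exact: (sub_smD mF).
apply: eps_eq => i; rewrite eps_coef_act !eps_coefD (ea _ _ _ yz) (eb _ _ _ yz).
by rewrite !eps_coef_act mulrDr.
Qed.

Lemma hom_G_scaleP c (a : hom_G x) : is_hom_G (fun y => c *: a y).
Proof.
have [sa ea] := hom_GP a; split=> [i y|t y z yz].
  under eq_fun do rewrite eps_coefZ.
  by apply: (sub_smM mF); [exact: (sub_sm_cst mF)|exact: sa].
apply: eps_eq => i; rewrite eps_coef_act !eps_coefZ (ea _ _ _ yz).
by rewrite !eps_coef_act mulrCA.
Qed.

Lemma hom_G_mulP (a b : hom_G x) : is_hom_G (fun y => a y * b y).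
Proof.
have [sa ea] := hom_GP a; have [sb eb] := hom_GP b; split=> [i y|t y z yz].
  have [ki|ki] := ltnP k i.
    by under eq_fun do rewrite eps_coef_big //; exact: (sub_sm_cst mF).
  under eq_fun do rewrite eps_coefM //.
  by apply: (sub_sm_sum mF) => j; exact: (sub_smM mF).
apply: eps_eq => i; rewrite eps_coef_act (ea _ _ _ yz) (eb _ _ _ yz).
have [ki|ki] := ltnP k i; first by rewrite !eps_coef_big ?mulr0.
rewrite !eps_coefM // mulr_sumr; apply: eq_bigr => j _.
by rewrite !eps_coef_act mulrACA -exprD subnKC // -ltnS.
Qed.

Let mk (a : fiber x -> eps_alg k) (aP : is_hom_G a) : hom_G x :=
  HomG (asboolT aP).
Let zero := mk (hom_G_cstP 0).
Let one := mk (hom_G_cstP 1).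
Let add a b := mk (hom_G_addP a b).
Let opp a := mk (hom_G_scaleP (-1) a).
Let mul a b := mk (hom_G_mulP a b).
Let scale c a := mk (hom_G_scaleP c a).

Let ext (a b : hom_G x) : (forall y, a y = b y) -> a = b.
Proof. by move=> ab; apply: val_inj; apply: funext. Qed.

Let addA : associative add.
Proof. by move=> a b c; apply: ext => y /=; rewrite addrA. Qed.
Let addC : commutative add.
Proof. by move=> a b; apply: ext => y /=; rewrite addrC. Qed.
Let add0 : left_id zero add.
Proof. by move=> a; apply: ext => y /=; rewrite scale0r add0r. Qed.
Let addN : left_inverse zero opp add.
Proof. by move=> a; apply: ext => y /=; rewrite scaleN1r addNr scale0r. Qed.
Let mulA : associative mul.
Proof. by move=> a b c; apply: ext => y /=; rewrite mulrA. Qed.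
Let mulC : commutative mul.
Proof. by move=> a b; apply: ext => y /=; rewrite mulrC. Qed.
Let mul1 : left_id one mul.
Proof. by move=> a; apply: ext => y /=; rewrite scale1r mul1r. Qed.
Let mulD : left_distributive mul add.
Proof. by move=> a b c; apply: ext => y /=; rewrite mulrDl. Qed.
Let one_neq0 : one != zero.
Proof.
apply/eqP => /(congr1 (@hom_G_fun k F x)) /= e.
have [_ [act1 actM _] _ _] := gb_axioms F.
have xP : proj (val x : F) = x.
  apply: val_inj => /=; case: x => /= y /set_mem[z _ <-].
  by rewrite actM mul0r.
have /eqP := congr1 (fun a => a (exist _ (val x) (mem_set xP))) e.
by rewrite scale1r scale0r oner_eq0.
Qed.
Let scaleA a b v : scale a (scale b v) = scale (a * b) v.
Proof. by apply: ext => y /=; rewrite scalerA. Qed.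
Let scale1 : left_id 1 scale.
Proof. by move=> a; apply: ext => y /=; rewrite scale1r. Qed.
Let scaleDr : right_distributive scale add.
Proof. by move=> c a b; apply: ext => y /=; rewrite scalerDr. Qed.
Let scaleDl v : {morph scale^~ v : a b / a + b >-> add a b}.
Proof. by move=> a b; apply: ext => y /=; rewrite scalerDl. Qed.
Let scaleAl c u v : scale c (mul u v) = mul (scale c u) v.
Proof. by apply: ext => y /=; rewrite scalerAl. Qed.

HB.instance Definition _ := GRing.isZmodule.Build (hom_G x) addA addC add0 addN.
HB.instance Definition _ :=
  GRing.Zmodule_isComNzRing.Build (hom_G x) mulA mulC mul1 mulD one_neq0.
HB.instance Definition _ := GRing.Zmodule_isLmodule.Build R (hom_G x)
  scaleA scale1 scaleDr scaleDl.
HB.instance Definition _ := GRing.Lmodule_isLalgebra.Build R (hom_G x) scaleAl.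
HB.instance Definition _ := GRing.Lalgebra_isComAlgebra.Build R (hom_G x).

End HomG.

Lemma hom_G_mulE k (F : gbundle k) (x : base F) (a b : hom_G x) y :
  (a * b) y = a y * b y.
Proof. by []. Qed.

Lemma hom_G_1E k (F : gbundle k) (x : base F) y : (1 : hom_G x) y = 1.
Proof. by rewrite -[RHS]scale1r. Qed.

Record dual (V : lmodType R) := Dual {
  dual_fun :> V -> R;
  _ : `[< forall a u v, dual_fun (a *: u + v) = a * dual_fun u + dual_fun v >] }.

HB.instance Definition _ (V : lmodType R) := [isSub for @dual_fun V].
HB.instance Definition _ (V : lmodType R) := [Choice of dual V by <:].

Section Dual.
Variable V : lmodType R.
Implicit Types c d : dual V.

Lemma dualP c a u v : c (a *: u + v) = a * c u + c v.
Proof. by case: c => c /= /asboolP. Qed.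

Definition mk_dual (c : V -> R)
  (cP : forall a u v, c (a *: u + v) = a * c u + c v) : dual V :=
  Dual (asboolT cP).

Lemma dual0P (a : R) (u v : V) : (0 : R) = a * 0 + 0.
Proof. by rewrite mulr0 addr0. Qed.
Lemma dualDP c d a u v : (c \+ d) (a *: u + v) = a * (c \+ d) u + (c \+ d) v.
Proof. by rewrite /= !dualP mulrDr addrACA. Qed.
Lemma dualZP b c a u v :
  (b \*o c) (a *: u + v) = a * (b \*o c) u + (b \*o c) v.
Proof. by rewrite /= !dualP mulrDr mulrCA. Qed.

Let zero := @mk_dual (fun=> 0) dual0P.
Let add c d := mk_dual (dualDP c d).
Let opp c := mk_dual (dualZP (-1) c).
Let scale b c := mk_dual (dualZP b c).

Let ext c d : (forall v, c v = d v) -> c = d.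
Proof. by move=> cd; apply: val_inj; apply: funext. Qed.
Let addA : associative add.
Proof. by move=> a b c; apply: ext => y /=; rewrite addrA. Qed.
Let addC : commutative add.
Proof. by move=> a b; apply: ext => y /=; rewrite addrC. Qed.
Let add0 : left_id zero add.
Proof. by move=> a; apply: ext => y /=; rewrite add0r. Qed.
Let addN : left_inverse zero opp add.
Proof. by move=> a; apply: ext => y /=; rewrite mulN1r addNr. Qed.
Let scaleA a b c : scale a (scale b c) = scale (a * b) c.
Proof. by apply: ext => y /=; rewrite mulrA. Qed.
Let scale1 : left_id 1 scale.
Proof. by move=> a; apply: ext => y /=; rewrite mul1r. Qed.
Let scaleDr : right_distributive scale add.
Proof. by move=> c a b; apply: ext => y /=; rewrite mulrDr. Qed.
Let scaleDl c : {morph scale^~ c : a b / a + b >-> add a b}.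
Proof. by move=> a b; apply: ext => y /=; rewrite mulrDl. Qed.

HB.instance Definition _ := GRing.isZmodule.Build (dual V) addA addC add0 addN.
HB.instance Definition _ := GRing.Zmodule_isLmodule.Build R (dual V)
  scaleA scale1 scaleDr scaleDl.

Lemma dual_sumE (I : Type) (r : seq I) (f : I -> dual V) v :
  (\sum_(i <- r) f i) v = \sum_(i <- r) f i v.
Proof. by elim: r => [|i r IH]; rewrite ?big_nil // !big_cons /= IH. Qed.

Lemma dual0 c : c 0 = 0.
Proof. by have := dualP c (-1) 0 0; rewrite scaler0 add0r mulN1r addNr. Qed.

Lemma dual_linear_sum c (I : Type) (r : seq I) (a : I -> R) (v : I -> V) :
  c (\sum_(i <- r) a i *: v i) = \sum_(i <- r) a i * c (v i).
Proof.
by elim: r => [|i r IH]; rewrite ?big_nil ?dual0 // !big_cons dualP IH.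
Qed.

End Dual.

(* A real algebra (resp. coalgebra) together with its homogeneous parts.  The
   compatibility of the grading with the structure is not recorded: for Weil
   algebras and coalgebras it follows from the isomorphism with a model. *)
Record galg := GAlg {
  ga_alg :> comAlgType R;
  ga_deg : nat -> set ga_alg }.

(* The comultiplication C -> C (x) C is given by its graph: [gc_comul c s] means
   that Delta c is the sum of the p.1 (x) p.2 for p in the list s.  For the
   graded duals of finite-dimensional algebras below, such a list exists for
   every c and its class in C (x) C is unique. *)
Record gcoalg := GCoalg {
  gc_space :> lmodType R;
  gc_deg : nat -> set gc_space;
  gc_counit : gc_space -> R;
  gc_comul : gc_space -> seq (gc_space * gc_space) -> Prop }.

Definition coalg_hom (C D : gcoalg) (f : C -> D) : Prop :=
  [/\ forall a u v, f (a *: u + v) = a *: f u + f v,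
      forall i c, gc_deg i c -> gc_deg i (f c),
      forall c, gc_counit (f c) = gc_counit c &
      forall c s, gc_comul c s ->
        gc_comul (f c) [seq (f p.1, f p.2) | p <- s]].

Definition coalg_iso (C D : gcoalg) (f : C -> D) : Prop :=
  exists g : D -> C, [/\ cancel f g, cancel g f, coalg_hom f & coalg_hom g].

(* Graded dual of a graded algebra with finitely many nonzero homogeneous parts:
   (A^i)^* is the space of functionals on A vanishing on A^j for j <> i. *)
Definition gdual (A : galg) : gcoalg :=
  @GCoalg (dual A)
    (fun i c => forall j a, j != i -> ga_deg j a -> c a = 0)
    (fun c => c 1)
    (fun c s => forall a b, \sum_(p <- s) p.1 a * p.2 b = c (a * b)).

Definition mweight n (w : 'I_n -> nat) (m : multinom n) : nat :=
  (\sum_(j < n) m j * w j)%N.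

(* A is isomorphic to A(R^d)/A^{>k}(R^d): there is a surjective homomorphism
   from the weighted polynomial algebra, with kernel A^{>k}(R^d), and A^i is the
   image of the polynomials of weight i. *)
Definition free_weil_alg k (A : galg) : Prop :=
  exists n (w : 'I_n -> nat), weights_upto k w /\
  exists pi : {lrmorphism mpoly n R -> A},
    [/\ forall a, exists p, pi p = a,
        forall p, pi p = 0 <->
          (forall m, m \in msupp p -> (k < mweight w m)%N) &
        forall i a, ga_deg i a <->
          exists2 p, (forall m, m \in msupp p -> mweight w m = i) & pi p = a].

(* Fibres over a base space and a set of local trivializations; in
   [cb_atlas U phi] only the maps [phi x] with x in U are relevant. *)
Record cbundle := CBundle {
  cb_base :> smooth_space R;
  cb_fib : cb_base -> gcoalg;
  cb_atlas : forall C : gcoalg,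
    set cb_base -> (forall x, cb_fib x -> C) -> Prop }.

Record cb_map (B B' : cbundle) := CBMap {
  cm_base :> B -> B';
  cm_fib : forall x, cb_fib x -> cb_fib (cm_base x) }.

(* In trivializations, the matrix coefficients <l, Phi_y c> depend smoothly on
   the base point y; here s is the constant local section with value c. *)
Definition cb_map_smooth (B B' : cbundle) (Phi : cb_map B B') : Prop :=
  forall (C : gcoalg) U phi (C' : gcoalg) U' phi',
    @cb_atlas B C U phi -> @cb_atlas B' C' U' phi' ->
  forall (c : C) (l : dual C') (s : forall y : B, cb_fib y),
    (forall y, U y -> phi y (s y) = c) ->
  forall x, U x -> U' (Phi x) ->
    sm_at x (fun y => l (phi' (Phi y) (cm_fib Phi (s y)))).

Definition cb_idmap (B : cbundle) : cb_map B B :=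
  @CBMap B B id (fun x c => c).

Definition cb_compmap (B B' B'' : cbundle) (Psi : cb_map B' B'')
    (Phi : cb_map B B') : cb_map B B'' :=
  @CBMap B B'' (Psi \o Phi) (fun x c => cm_fib Psi (cm_fib Phi c)).

Definition is_fgwcb k (B : cbundle) : Prop :=
  [/\ is_manifold B,
      forall C U phi, @cb_atlas B C U phi ->
        open U /\ forall x, U x -> coalg_iso (phi x),
      (* smoothness of the transition cocycles *)
      cb_map_smooth (cb_idmap B) &
      exists A, free_weil_alg k A /\
        forall x : B, exists U phi, U x /\ @cb_atlas B (gdual A) U phi].

Record fgwcb k := FGWCB {
  cb_bundle :> cbundle;
  cb_axioms : is_fgwcb k cb_bundle }.

Definition is_cb_hom (B B' : cbundle) (Phi : cb_map B B') : Prop :=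
  [/\ smooth_map Phi,
      forall x, coalg_hom (@cm_fib _ _ Phi x) &
      cb_map_smooth Phi].

Record cb_hom k (B B' : fgwcb k) := CBHom {
  ch_map :> cb_map B B';
  ch_axioms : is_cb_hom ch_map }.

Lemma cb_hom_eq k (B B' : fgwcb k) (f g : cb_hom B B') :
  (f : cb_map B B') = g -> f = g.
Proof.
case: f g => [f fP] [g gP] /= fg; case: _ / fg gP => gP.
by rewrite (Prop_irrelevance fP gP).
Qed.

Lemma cb_idP k (B : fgwcb k) : is_cb_hom (cb_idmap B).
Proof.
split=> [|x|]; first exact: smooth_map_id; last by case: (cb_axioms B).
split=> //= c s; under [map _ _]eq_map do rewrite -surjective_pairing.
by rewrite map_id.
Qed.

Definition cb_id k (B : fgwcb k) : cb_hom B B := CBHom (cb_idP B).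

(* A free graded Weil algebra has a finite spanning family with linear
   coordinates; hence so has its dual. *)
Lemma free_weil_frame k (A : galg) : free_weil_alg k A ->
  exists (I : finType) (e : I -> gdual A) (e' : I -> dual (gdual A)),
    forall c, c = \sum_i e' i c *: e i.
Proof.
move=> [n [w [wP [pi [surj ker _]]]]].
pose lift a := projT1 (cid (surj a)).
have liftK a : pi (lift a) = a by rewrite /lift; case: cid.
pose I : finType := bmultinom n k.+1.
pose co (m : I) (a : A) : R :=
  if (mweight w m <= k)%N then mcoeff m (lift a) else 0.
have coP m a u v : co m (a *: u + v) = a * co m u + co m v.
  rewrite /co; case: leqP => [mk|_]; last by rewrite mulr0 addr0.
  have /ker p0 : pi (lift (a *: u + v) - (a *: lift u + lift v)) = 0.
    rewrite raddfB raddfD /= linearZ_LR !liftK.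
    apply/eqP; rewrite subr_eq0; apply/eqP.
    by congr (_ *: _ + _); exact/esym/liftK.
  apply/eqP; rewrite -subr_eq0 -mcoeffZ -mcoeffD -mcoeffB mcoeff_eq0.
  by apply/negP => /p0; rewrite ltnNge mk.
pose b (m : I) : A := pi (mpolyX R m).
have aE a : a = \sum_m co m a *: b m.
  rewrite -[LHS]liftK; apply/eqP; rewrite -subr_eq0.
  have -> : \sum_m co m a *: b m = pi (\sum_m co m a *: mpolyX R m).
    by rewrite linear_sum; apply: eq_bigr => m _; rewrite linearZ.
  rewrite -raddfB; apply/eqP/ker => m; apply: contraLR; rewrite -leqNgt => mk.
  have mI : (mdeg m < k.+1)%N.
    rewrite ltnS (leq_trans _ mk) // mdegE leq_sum // => j _.
    by rewrite leq_pmulr //; case/andP: (wP j).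
  rewrite -mcoeff_eq0 mcoeffB linear_sum /= (bigD1 (BMultinom mI)) //=.
  rewrite big1 => [|m' /negP m'N].
    by rewrite mcoeffZ mcoeffX eqxx mulr1 addr0 /co /= mk subrr.
  rewrite mcoeffZ mcoeffX; case: eqP => [mE|_]; last by rewrite mulr0.
  by case: m'N; rewrite -val_eqE /=; apply/eqP.
exists I, (fun m => mk_dual (coP m)).
have evP m a (c d : dual A) : (a *: c + d) (b m) = a * c (b m) + d (b m) by [].
exists (fun m => mk_dual (evP m)) => c; apply: val_inj; apply: funext => a.
rewrite [in LHS](aE a) /= dual_linear_sum dual_sumE; apply: eq_bigr => m _ /=.
by rewrite mulrC.
Qed.

Lemma cb_compP k (B B' B'' : fgwcb k) (Psi : cb_hom B' B'') (Phi : cb_hom B B') :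
  is_cb_hom (cb_compmap Psi Phi).
Proof.
have [sPhi hPhi cPhi] := ch_axioms Phi; have [sPsi hPsi cPsi] := ch_axioms Psi.
split=> [|x|]; first exact: smooth_map_comp.
  have [l1 d1 u1 m1] := hPhi x; have [l2 d2 u2 m2] := hPsi (Phi x).
  split=> [a u v|i c /d1/d2|c|c s /m1/m2] //=; first by rewrite l1 l2.
    by rewrite u2 u1.
  by rewrite -map_comp.
move=> C U phi C'' W chi aphi achi c l s sc x Ux Wx.
have [mB isoB _ _] := cb_axioms B.
have [_ isoB' _ [A [/free_weil_frame[I [e [e' eE]]] trivB']]] := cb_axioms B'.
move: (trivB' (Phi x)) => [V [psi [Vx apsi]]].
have [_ isoB'' _ _] := cb_axioms B''.
have [oV isoV] := isoB' _ _ _ apsi; have [oW isoW] := isoB'' _ _ _ achi.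
have exs i (z : B') : exists v : cb_fib z, V z -> psi z v = e i.
  have [Vz|nVz] := pselect (V z); last by exists 0.
  by have [g [_ gK _ _]] := isoV z Vz; exists (g (e i)).
pose t i z : cb_fib z := projT1 (cid (exs i z)).
have tE i z : V z -> psi z (t i z) = e i by rewrite /t; case: cid.
apply: (@sm_at_near _ _ mB _ (fun y =>
  \sum_i (e' i (psi (Phi y) (cm_fib Phi (s y))) *
          l (chi (Psi (Phi y)) (cm_fib Psi (t i (Phi y))))))); last first.
  apply: (sm_at_sum mB) => i; apply: (sm_atM mB); first exact: cPhi sc _ Ux Vx.
  have := cPsi _ _ _ _ _ _ apsi achi (e i) l (t i) (tE i) _ Vx Wx.
  by have [_ /(_ x _)] := sPhi; apply.
have nV : \forall y \near x, V (Phi y).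
  by have [/(_ x) cf _] := sPhi; apply: cf; exact: open_nbhs_nbhs.
have nW : \forall y \near x, W (Psi (Phi y)).
  have [/(_ x) cf _] := smooth_map_comp sPsi sPhi.
  by apply: cf; exact: open_nbhs_nbhs.
near=> y.
have Vy : V (Phi y) by near: y.
have Wy : W (Psi (Phi y)) by near: y.
have [g [psiK _ [psiL _ _ _] _]] := isoV _ Vy.
have [h [_ _ [chiL _ _ _] _]] := isoW _ Wy.
have [PsiL _ _ _] := hPsi (Phi y).
set v := cm_fib Phi (s y).
pose L (u : cb_fib (Phi y)) := l (chi (Psi (Phi y)) (cm_fib Psi u)).
have LP a u u' : L (a *: u + u') = a * L u + L u'.
  by rewrite /L PsiL chiL dualP.
have psi0 : psi (Phi y) 0 = 0.
  by have := psiL (-1) 0 0; rewrite scaler0 add0r scaleN1r addNr.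
have psi_sum (r : seq I) (a : I -> R) (u : I -> cb_fib (Phi y)) :
    psi (Phi y) (\sum_(i <- r) a i *: u i) = \sum_(i <- r) a i *: psi (Phi y) (u i).
  by elim: r => [|i r IH]; rewrite ?big_nil // !big_cons psiL IH.
have vE : v = \sum_i e' i (psi (Phi y) v) *: t i (Phi y).
  apply: (can_inj psiK); rewrite psi_sum {1}[LHS]eE.
  by apply: eq_bigr => i _; rewrite tE.
have := congr1 L vE; rewrite -[L (\sum_i _)]/(mk_dual LP _) dual_linear_sum.
exact.
Unshelve. all: by end_near. Qed.

Definition cb_comp k (B B' B'' : fgwcb k) (Psi : cb_hom B' B'')
    (Phi : cb_hom B B') : cb_hom B B'' := CBHom (cb_compP Psi Phi).

(* The fibre Hom_G(F_x, A^[k]); its degree-i part consists of the maps valued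
   in R eps^i. *)
Definition hom_G_galg k (F : gbundle k) (x : base F) : galg :=
  @GAlg (hom_G x) (fun i a => forall y, exists r : R, a y = r *: eps_pow k i).

Definition in_fiber F (z : F) : fiber (proj z) := exist _ z (mem_set erefl).

(* Sections of F^{*[k]} smooth over V, viewed as A^[k]-valued functions on F. *)
Definition smooth_section k (F : gbundle k) (V : set (base F))
    (a : forall x : base F, hom_G x) : Prop :=
  forall z : F, V (proj z) -> forall i,
    sm_at z (fun z => eps_coef (a (proj z) (in_fiber z)) i).

Definition smooth_dual_section k (F : gbundle k) (U : set (base F))
    (s : forall x : base F, gdual (hom_G_galg x)) : Prop :=
  forall V a, open V -> smooth_section V a ->
  forall x, U x -> V x -> sm_at x (fun x => s x (a x)).

(* The graded dual of F^{*[k]}: its local trivializations are the fibrewise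
   isomorphisms under which constant sections are smooth sections of the dual. *)
Definition circ_ob k (F : gbundle k) : cbundle :=
  @CBundle (base F) (fun x => gdual (hom_G_galg x))
    (fun C U phi =>
      [/\ open U,
          forall x, U x -> coalg_iso (phi x) &
          forall (c : C) s, (forall x, U x -> phi x (s x) = c) ->
            smooth_dual_section U s]).

Section CircMap.
Variables (k : nat) (F E : gbundle k) (f : gb_hom F E).

Lemma base_mapP (x : base F) : f (val x) \in range (@gact E 0).
Proof.
case: x => x /= /set_mem[y _ <-]; apply: mem_set.
by exists (f y) => //; rewrite gb_equiv.
Qed.

(* The map of bases covered by f. *)
Definition base_map (x : base F) : base E := exist _ (f (val x)) (base_mapP x).

Variables (b : base F -> base E) (bE : forall x, val (b x) = f (val x)).

Lemma fiber_mapP x (y : fiber x) :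
  (f (val y) : E) \in [set z : E | proj z = b x].
Proof.
apply: mem_set; apply: val_inj; rewrite bE /= -gb_equiv.
by case: y => y /= /set_mem <-.
Qed.

Definition fiber_map x (y : fiber x) : fiber (b x) :=
  exist _ (f (val y)) (fiber_mapP y).

Lemma hom_G_pullP x (a : hom_G (b x)) :
  is_hom_G (fun y : fiber x => a (fiber_map y)).
Proof.
have [sa ea] := hom_GP a; split=> [i y|t y z yz]; last first.
  by apply: ea; rewrite /= yz gb_equiv.
have [G sG aG] := sa i (fiber_map y); have [cf sf] := gb_smooth f.
exists (G \o f); first exact: sf.
have cfib : {for y, continuous (@fiber_map x)}.
  move=> A [_ [[B oB <-] /= By BA]].
  have cv : {for y, continuous (val : fiber x -> F)}.
    exact: (@initial_continuous (set_type [set y | proj y = x]) F val).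
  have : nbhs y (val @^-1` (f @^-1` B)).
    by apply: cv; apply: cf; exact: open_nbhs_nbhs.
  by apply: filterS => z Bz; exact: BA.
exact: cfib aG.
Qed.

Definition hom_G_pull x (a : hom_G (b x)) : hom_G x :=
  HomG (asboolT (hom_G_pullP a)).

Lemma dual_pullP x (c : dual (hom_G x)) r (u v : hom_G (b x)) :
  c (hom_G_pull (r *: u + v)) = r * c (hom_G_pull u) + c (hom_G_pull v).
Proof. by rewrite -dualP; congr (c _); apply: val_inj. Qed.

Definition dual_pull x (c : dual (hom_G x)) : dual (hom_G (b x)) :=
  mk_dual (dual_pullP c).

Definition circ_map : cb_map (circ_ob F) (circ_ob E) :=
  @CBMap (circ_ob F) (circ_ob E) b dual_pull.

End CircMap.

Definition circ_mor k (F E : gbundle k) (f : gb_hom F E) :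
    cb_map (circ_ob F) (circ_ob E) :=
  circ_map (f := f) (b := base_map f) (fun x => erefl).

Lemma circ_map_irr k (F E : gbundle k) (f : gb_hom F E) b b' bE b'E :
  @circ_map k F E f b bE = @circ_map k F E f b' b'E.
Proof.
have bb' : b = b' by apply: funext => x; apply: val_inj; rewrite bE b'E.
by case: _ / bb' b'E => b'E; rewrite (Prop_irrelevance bE b'E).
Qed.

Lemma circ_mor_id k (F : gbundle k) : circ_mor (gb_id F) = cb_idmap (circ_ob F).
Proof.
rewrite /circ_mor (@circ_map_irr k F F (gb_id F) _ id _ (fun=> erefl)) /circ_map.
congr CBMap; apply: functional_extensionality_dep => x; apply: funext => c.
apply: val_inj; apply: funext => a /=; congr (c _); apply: val_inj.
by apply: funext => y /=; congr (a _); apply: val_inj.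
Qed.

Lemma circ_mor_comp k (F E D : gbundle k) (g : gb_hom E D) (f : gb_hom F E) :
  circ_mor (gb_comp g f) = cb_compmap (circ_mor g) (circ_mor f).
Proof.
rewrite /circ_mor.
rewrite (@circ_map_irr k F D (gb_comp g f) _ (base_map g \o base_map f) _ (fun=> erefl)).
rewrite /circ_map /cb_compmap; congr CBMap.
apply: functional_extensionality_dep => x; apply: funext => c.
apply: val_inj; apply: funext => a /=; congr (c _); apply: val_inj.
by apply: funext => y /=; congr (a _); apply: val_inj.
Qed.

End GradedBundles.

Record category := Category {
  c_ob :> Type;
  c_hom : c_ob -> c_ob -> Type;
  c_id : forall a, c_hom a a;
  c_comp : forall a b c, c_hom b c -> c_hom a b -> c_hom a c;
  c_idl : forall a b (f : c_hom a b), c_comp (c_id b) f = f;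
  c_idr : forall a b (f : c_hom a b), c_comp f (c_id a) = f;
  c_assoc : forall a b c d (h : c_hom c d) (g : c_hom b c) (f : c_hom a b),
    c_comp h (c_comp g f) = c_comp (c_comp h g) f }.

Record functor (C D : category) := Functor {
  f_ob :> C -> D;
  f_mor : forall a b, c_hom a b -> c_hom (f_ob a) (f_ob b);
  f_id : forall a, f_mor (c_id a) = c_id (f_ob a);
  f_comp : forall a b c (g : c_hom b c) (f : c_hom a b),
    f_mor (c_comp g f) = c_comp (f_mor g) (f_mor f) }.

Definition functor_id (C : category) : functor C C :=
  @Functor C C id (fun a b f => f) (fun=> erefl) (fun _ _ _ _ _ => erefl).

Lemma functor_comp_id C D E (G : functor D E) (F : functor C D) a :
  f_mor G (f_mor F (c_id a)) = c_id (G (F a)).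
Proof. by rewrite !f_id. Qed.

Lemma functor_comp_comp C D E (G : functor D E) (F : functor C D) a b c
    (g : c_hom b c) (f : c_hom a b) :
  f_mor G (f_mor F (c_comp g f)) =
  c_comp (f_mor G (f_mor F g)) (f_mor G (f_mor F f)).
Proof. by rewrite !f_comp. Qed.

Definition functor_comp C D E (G : functor D E) (F : functor C D) :
    functor C E :=
  @Functor C E (G \o F) (fun a b f => f_mor G (f_mor F f))
    (functor_comp_id G F) (functor_comp_comp G F).

Definition is_iso (C : category) (a b : C) (f : c_hom a b) : Prop :=
  exists g : c_hom b a, c_comp g f = c_id a /\ c_comp f g = c_id b.

Definition nat_isomorphic C D (F G : functor C D) : Prop :=
  exists eta : forall a, c_hom (F a) (G a),
    (forall a, is_iso (eta a)) /\
    forall a b (f : c_hom a b),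
      c_comp (eta b) (f_mor F f) = c_comp (f_mor G f) (eta a).

Definition is_equivalence C D (F : functor C D) : Prop :=
  exists G : functor D C,
    nat_isomorphic (functor_comp G F) (functor_id C) /\
    nat_isomorphic (functor_comp F G) (functor_id D).

Section Equivalence.
Variables (R : realType) (k : nat).

Lemma gb_idl (F E : gbundle R k) (f : gb_hom F E) : gb_comp (gb_id E) f = f.
Proof. exact: gb_hom_eq. Qed.
Lemma gb_idr (F E : gbundle R k) (f : gb_hom F E) : gb_comp f (gb_id F) = f.
Proof. exact: gb_hom_eq. Qed.
Lemma gb_assoc (F E D H : gbundle R k) (h : gb_hom D H) (g : gb_hom E D)
    (f : gb_hom F E) : gb_comp h (gb_comp g f) = gb_comp (gb_comp h g) f.
Proof. exact: gb_hom_eq. Qed.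

Definition GB : category := Category gb_idl gb_idr gb_assoc.

Lemma cb_idl (B C : fgwcb R k) (f : cb_hom B C) : cb_comp (cb_id C) f = f.
Proof. by apply: cb_hom_eq; case: f => -[]. Qed.
Lemma cb_idr (B C : fgwcb R k) (f : cb_hom B C) : cb_comp f (cb_id B) = f.
Proof. by apply: cb_hom_eq; case: f => -[]. Qed.
Lemma cb_assoc (B C D H : fgwcb R k) (h : cb_hom D H) (g : cb_hom C D)
    (f : cb_hom B C) : cb_comp h (cb_comp g f) = cb_comp (cb_comp h g) f.
Proof. exact: cb_hom_eq. Qed.

Definition FGWCBcat : category := Category cb_idl cb_idr cb_assoc.

Section Circ.
Variables (obP : forall F : gbundle R k, is_fgwcb k (circ_ob F))
  (morP : forall (F E : gbundle R k) (f : gb_hom F E), is_cb_hom (circ_mor f)).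

Let ob (F : GB) : FGWCBcat := FGWCB (obP F).
Let mor (F E : GB) (f : c_hom F E) : c_hom (ob F) (ob E) :=
  @CBHom R k (ob F) (ob E) (circ_mor f) (morP f).

Lemma circ_id (F : GB) : mor (c_id F) = c_id (ob F).
Proof. by apply: cb_hom_eq; exact: circ_mor_id. Qed.

Lemma circ_comp (F E D : GB) (g : c_hom E D) (f : c_hom F E) :
  mor (c_comp g f) = c_comp (mor g) (mor f).
Proof. by apply: cb_hom_eq; exact: circ_mor_comp. Qed.

(* The functor F |-> (F^{*[k]})^*, given that it takes values in FGWCB_k. *)
Definition circ_functor : functor GB FGWCBcat := Functor circ_id circ_comp.

End Circ.
End Equivalence.

(* Main.v *)
From HB Require Import structures.
From mathcomp Require Import all_boot all_order all_algebra.
From mathcomp Require Import all_classical all_reals all_analysis.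
From mathcomp Require Import -(notations) mpoly.
From mathcomp Require Import ring lra.
Require Import Defs.
Import Order.TTheory GRing.Theory Num.Theory numFieldNormedType.Exports.

Set Implicit Arguments.
Unset Strict Implicit.
Unset Printing Implicit Defensive.

Local Open Scope classical_set_scope.
Local Open Scope ring_scope.

                                             

(** Consider one fibre R^d. A smooth function on it that is homogeneous of weight i is a polynomial
    ([homog_poly]): its partial derivatives have smaller weight, and Euler's identity recovers the
    function from them. Hence the algebra of equivariant maps from the fibre to R[eps]/(eps^(k+1))
    is a weighted polynomial algebra truncated above weight k ([fib_presP]), and its dual is a free
    graded Weil coalgebra.

    The points of the fibre can be read off from this coalgebra: they are its curves ([is_curve]),
    the sequences g_0, g_1, ... with g_i of degree i, with g_0 of counit 1, and with the
    comultiplication of g_i equal to the sum of the g_j (x) g_(i-j) for i <= k. A curve amounts to a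
    graded algebra morphism to R[eps]/(eps^(k+1)), and such a morphism is freely determined by the
    numbers v_j in y_j -> v_j eps^(w_j) ([curve_pcrv], [pcrv_inj]). Acting by t on v multiplies g_i
    by t^i, and the members of curves span the coalgebra ([pco], [dual_expand]).

    A coalgebra morphism maps curves to curves, so it induces a map of fibres, equivariant by
    linearity. This yields faithfulness and fullness ([circ_faithful], [full_homE]). Smoothness
    follows from finite expansions: the coordinates of a curve are monomials in v ([pcrv_expand]),
    and matrix coefficients depend smoothly on the base point. That the functor lands in coalgebra
    bundles rests on [atlas_repr]: a functional read through any chart is locally the pairing with a
    smooth section.

    For essential surjectivity, the coalgebra transitions of a given bundle act on curves, hence on
    R^d, by equivariant maps that are polynomial in v. They form a cocycle; a graded bundle is glued
    from it ([glue_gbundle]), and its image under the functor is isomorphic to the given bundle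
    ([circ_ess_surj]). A choice argument then produces the inverse functor
    ([ff_ess_surj_equivalence]). *)

(** * Chain rule and smooth functions on Euclidean space *)

Section Calculus.
Variable R : realType.

Lemma derive_line_shift (V W : normedModType R) (G : V -> W) (p v : V) (t : R) :
  derivable G (p + t *: v) v ->
  is_derive t 1 (fun s => G (p + s *: v)) ('D_v G (p + t *: v)).
Proof.
move=> dG.
have E : (fun h : R => h^-1 *: (((fun s => G (p + s *: v)) \o shift t) (h *: 1)
            - G (p + t *: v))) =
         (fun h => h^-1 *: ((G \o shift (p + t *: v)) (h *: v) - G (p + t *: v))).
  apply: funext => h /=; congr (_ *: (G _ - _)).
  by rewrite [h *: 1]mulr1 scalerDl addrCA.
by split; [rewrite /derivable E|rewrite /derive E].
Qed.

Variable n : nat.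
Implicit Types (G : 'rV[R]_n -> R) (p y z : 'rV[R]_n).
Local Notation e_ j := (delta_mx 0 j : 'rV[R]_n).

(** The one-variable mean value theorem along a coordinate line, on [0, d] or on [d, 0]; bounding
    |t| by |d| treats both signs of d at once. *)
Lemma MVT_coord G p (j : 'I_n) (d : R) :
  (forall t : R, `|t| <= `|d| -> derivable G (p + t *: e_ j) (e_ j)) ->
  exists2 t : R, `|t| <= `|d| &
    G (p + d *: e_ j) - G p = pderive j G (p + t *: e_ j) * d.
Proof.
move=> dG; pose f (t : R) := G (p + t *: e_ j).
have fd (t : R) : `|t| <= `|d| -> is_derive t 1 f (pderive j G (p + t *: e_ j)).
  by move=> /dG; exact: derive_line_shift.
have f0 : f 0 = G p by rewrite /f scale0r addr0.
rewrite -[G p]f0 -[G (p + d *: _)]/(f d).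
have [d0|d0] := leP 0 d.
- have inn (t : R) : t \in `[0, d] -> `|t| <= `|d|.
    by rewrite in_itv /= => /andP[t0 td]; rewrite !ger0_norm.
  have [||t /inn td E] := @MVT_segment _ f (fun t => pderive j G (p + t *: e_ j)) 0 d d0.
  + by move=> t /subset_itv_oo_cc /inn; exact: fd.
  + by apply: derivable_within_continuous => t /inn /fd.
  by exists t => //; rewrite E subr0.
- have inn (t : R) : t \in `[d, 0] -> `|t| <= `|d|.
    by rewrite in_itv /= => /andP[dt t0]; rewrite (ler0_norm t0) (ler0_norm (ltW d0)) lerN2.
  have [||t /inn td E] := @MVT_segment _ f (fun t => pderive j G (p + t *: e_ j)) d 0 (ltW d0).
  + by move=> t /subset_itv_oo_cc /inn; exact: fd.
  + by apply: derivable_within_continuous => t /inn /fd.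
  by exists t => //; rewrite -opprB E -mulrN sub0r opprK.
Qed.

(** The vertices of a staircase path from y to z that changes one coordinate at a time; increments
    along it telescope. *)
Definition splice (k : nat) y z : 'rV[R]_n :=
  \row_i (if (i < k)%N then z 0 i else y 0 i).

Lemma splice0 y z : splice 0 y z = y.
Proof. by apply/rowP => i; rewrite mxE. Qed.

Lemma splicen y z : splice n y z = z.
Proof. by apply/rowP => i; rewrite mxE ltn_ord. Qed.

Lemma spliceS y z (j : 'I_n) :
  splice j.+1 y z = splice j y z + (z 0 j - y 0 j) *: e_ j.
Proof.
apply/rowP => i; rewrite !mxE /= ltnS leq_eqVlt.
have [->|ij] := eqVneq i j; first by rewrite ltnn eqxx mulr1 addrC subrK.
by rewrite (_ : (i == j :> nat) = false) ?mulr0 ?addr0//; apply/eqP => /val_inj /eqP; rewrite (negPf ij).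
Qed.

Lemma norm_row_le p (r : R) : 0 <= r -> (forall i, `|p 0 i| <= r) -> `|p| <= r.
Proof.
move=> r0 pr; rewrite /Num.Def.normr/= mx_normrE (bigmax_le _ r0)// => -[i j] _.
by rewrite ord1.
Qed.

Lemma row_norm_le p i : `|p 0 i| <= `|p|.
Proof.
by rewrite [leRHS]/Num.Def.normr/= mx_normrE; exact: (le_bigmax _ _ (0, i)).
Qed.

Lemma splice_between y z (j : 'I_n) (t : R) : `|t| <= `|z 0 j - y 0 j| ->
  `|splice j y z + t *: e_ j - y| <= `|z - y|.
Proof.
move=> tzy; apply: norm_row_le => // i; rewrite !mxE eqxx /=.
have [->|ij] := eqVneq i j.
  rewrite ltnn mulr1 addrC addKr (le_trans tzy)//.
  by have := row_norm_le (z - y) j; rewrite !mxE.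
rewrite mulr0 addr0; case: ifP => _; last by rewrite subrr normr0.
by have := row_norm_le (z - y) i; rewrite !mxE.
Qed.

                                                                              
                                  
(** On each step of the staircase from y to z the mean value theorem supplies a slope [rho j z]. The
    intermediate points stay within |z - y| of y, so continuity of the partial derivatives at y
    gives the limits of the slopes. *)
Lemma caratheodory G y :
  (\forall z \near y, forall j, derivable G z (e_ j)) ->
  (forall j, {for y, continuous (pderive j G)}) ->
  exists rho : 'I_n -> 'rV[R]_n -> R,
    (forall j, rho j z @[z --> y] --> pderive j G y) /\
    \forall z \near y, G z - G y = \sum_j rho j z * (z 0 j - y 0 j).
Proof.
move=> dG cG; have [r /= r0 dr] := (nbhs_ballP y _).1 dG.
(* The pair is the slope and the parameter of the mean value point; outside the ball where the
   partial derivatives exist it is the dummy (0, 0). *)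
have ex j z : exists q : R * R, `|z - y| < r ->
    `|q.2| <= `|z 0 j - y 0 j| /\
    q.1 = pderive j G (splice j y z + q.2 *: e_ j) /\
    G (splice j.+1 y z) - G (splice j y z) = q.1 * (z 0 j - y 0 j).
  have [zr|] := ltP `|z - y| r; last by exists (0, 0).
  have [t tzy|t tzy E] := @MVT_coord G (splice j y z) j (z 0 j - y 0 j).
    apply: dr; rewrite -ball_normE /= distrC.
    exact: le_lt_trans (splice_between tzy) zr.
  by exists (pderive j G (splice j y z + t *: e_ j), t); rewrite spliceS.
pose q j z := projT1 (cid (ex j z)).
have qP j z (zr : `|z - y| < r) := projT2 (cid (ex j z)) zr.
have nr : \forall z \near y, `|z - y| < r.
  by apply/nbhs_ballP; exists r => //= z; rewrite -ball_normE /= distrC.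
exists (fun j z => (q j z).1); split=> [j|]; last first.
  apply: filterS nr => z zr.
  have := telescope_sumr (fun k => G (splice k y z)) (leq0n n).
  rewrite splicen splice0 big_mkord => <-.
  by apply: eq_bigr => j _; have [_ []] := qP j z zr.
apply/(@cvgrPdist_lt _ _ _ (nbhs y)) => e e0; have := cG j.
move=> /cvgrPdist_lt /(_ e e0) /nbhs_ballP[d /= d0 dG'].
near=> z; have zr : `|z - y| < r by near: z.
have [q2 [q1 _]] := qP j z zr.
rewrite -/(q j z) in q1 q2 *; rewrite q1; apply: dG'.
rewrite -ball_normE /= distrC; apply: le_lt_trans (splice_between q2) _.
by near: z; apply/nbhs_ballP; exists d => //= z; rewrite -ball_normE /= distrC.
Unshelve. all: by end_near. Qed.

(** The chain rule: substitute [a] into the expansion of [caratheodory] at [a x], divide by h and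
    let h tend to 0. *)
Lemma is_derive_comp_row (V : normedModType R) (a : V -> 'rV[R]_n) G (x v : V) :
  (forall j, derivable (fun u => a u 0 j) x v) ->
  (\forall z \near a x, forall j, derivable G z (e_ j)) ->
  (forall j, {for a x, continuous (pderive j G)}) ->
  is_derive x v (G \o a)
    (\sum_j pderive j G (a x) * 'D_v (fun u => a u 0 j) x).
Proof.
move=> da dG cG; have [rho [rhoc rhoE]] := caratheodory dG cG.
(* Continuity of [a] along the line through x in direction v, which is all that the limits of the
   [rho j] require. *)
have ca : (fun h : R => a (h *: v + x)) @ 0 --> a x.
  have : derivable a x v by apply/derivable_mxP => i j; rewrite ord1.
  move=> /derivable1P/derivable1_diffP/differentiable_continuous.
  by rewrite /prop_for /continuous_at scale0r add0r.
suff L : (fun h : R => h^-1 *: (((G \o a) \o shift x) (h *: v) - (G \o a) x)) @ 0^'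
    --> \sum_j pderive j G (a x) * 'D_v (fun u => a u 0 j) x.
  by split; [apply/cvg_ex; eexists; exact: L|apply: cvg_lim L].
have nE : \forall h \near 0^', \sum_j rho j (a (h *: v + x)) *
      (h^-1 *: (((fun u => a u 0 j) \o shift x) (h *: v) - a x 0 j)) =
    h^-1 *: (((G \o a) \o shift x) (h *: v) - (G \o a) x).
  have nE : \forall h \near (0 : R), G (a (h *: v + x)) - G (a x) = \sum_j rho j (a (h *: v + x)) * (a (h *: v + x) 0 j - a x 0 j) := ca _ rhoE.
  apply: cvg_within; move: nE.
  apply: filterS => h /= ->; rewrite scaler_sumr; apply: eq_bigr => j _.
  by rewrite /GRing.scale /= mulrCA.
apply: cvg_trans (near_eq_cvg nE) _.
apply: cvg_big => [|j _]; first exact: add_continuous.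
apply: cvgM; last exact: da.
by apply: cvg_comp (rhoc j); apply: cvg_trans ca; apply: cvg_app; exact: cvg_within.
Qed.


End Calculus.

Lemma cvg_rowP (R : realType) n (T : Type) (F : set_system T)
    (a : T -> 'rV[R]_n) (l : 'rV[R]_n) : Filter F ->
  (forall j, a x 0 j @[x --> F] --> l 0 j) -> a x @[x --> F] --> l.
Proof.
move=> FF al A [P lP PA].
have : \forall x \near F, forall j, P 0 j (a x 0 j).
  by apply: filter_forall => j; exact: (al j _ (lP 0 j)).
by apply: filterS => x Px; apply: PA => i j; rewrite ord1.
Qed.

Lemma continuous_row (R : realType) n (T : topologicalType) (a : T -> 'rV[R]_n) x :
  (forall j, {for x, continuous (fun y => a y 0 j)}) -> {for x, continuous a}.
Proof. by move=> ca; apply: (@cvg_rowP _ _ _ (nbhs x)). Qed.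

Section SmoothOn.
Variable R : realType.
Local Notation D f s := (foldr (@pderive R _) f s).

Definition smooth_on n (U : set 'rV[R]_n) (f : 'rV[R]_n -> R) : Prop :=
  forall y, U y -> forall s : seq 'I_n,
    {for y, continuous (D f s)} /\
    forall i, derivable (D f s) y (delta_mx 0 i).

Lemma euclid_sm_atP n (x : 'rV[R]_n) f :
  euclid_sm_at x f <-> exists U : set 'rV[R]_n, [/\ open U, U x & smooth_on U f].
Proof.
split=> [/near_open[U [oU Ux gf]]|[U [oU Ux gf]]]; first by exists U; split.
have : nbhs x U by exact: open_nbhs_nbhs.
by apply: filterS => y Uy; exact: gf.
Qed.

Lemma open_nearW (T : topologicalType) (U : set T) (P : T -> Prop) y :
  open U -> U y -> (forall z, U z -> P z) -> \forall z \near y, P z.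
Proof.
move=> oU Uy UP; have : nbhs y U by exact: open_nbhs_nbhs.
by apply: filterS => z; exact: UP.
Qed.

                                                                              
                                               
(** Smoothness concerns all iterated derivatives, so it is proved by an invariant: if [Q] gives
    continuity and partial derivatives on [U] and is stable under partial derivatives up to equality
    on [U], then every iterated derivative agrees on [U] with a member of [Q]. *)
Lemma smooth_coind n (U : set 'rV[R]_n) (Q : ('rV[R]_n -> R) -> Prop) : open U ->
  (forall f, Q f -> forall y, U y ->
     {for y, continuous f} /\ forall i, derivable f y (delta_mx 0 i)) ->
  (forall f i, Q f -> exists2 g, Q g & forall y, U y -> pderive i f y = g y) ->
  forall f g, Q g -> (forall y, U y -> f y = g y) -> smooth_on U f.
Proof.
move=> oU Q1 Q2 f g Qg fg y Uy s.
have [g' Qg' fg'] : exists2 g', Q g' & forall y, U y -> D f s y = g' y.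
  elim: s => [|i s [g' Qg' IH]]; first by exists g.
  have [g2 Qg2 e] := Q2 _ i Qg'; exists g2 => // z Uz; rewrite -(e _ Uz) /=.
  by apply: near_eq_derive; exact: open_nearW IH.
have fgn := open_nearW oU Uy fg'.
have gfn : \near y, g' y = D f s y by apply: filterS fgn => z ->.
have [c d] := Q1 _ Qg' _ Uy; split=> [|i]; last first.
  by apply: (near_eq_derivable _ (d i)); exact: gfn.
rewrite /prop_for /continuous_at (fg' _ Uy).
by apply: (cvg_trans _ c); exact: near_eq_cvg gfn.
Qed.

Lemma smooth_on_C1 n (U : set 'rV[R]_n) f : smooth_on U f ->
  forall y, U y -> {for y, continuous f} /\ forall i, derivable f y (delta_mx 0 i).
Proof. by move=> sf y Uy; exact: (sf y Uy [::]). Qed.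

Lemma smooth_on_pderive n (U : set 'rV[R]_n) f i :
  smooth_on U f -> smooth_on U (pderive i f).
Proof. by move=> sf y Uy s; have := sf y Uy (rcons s i); rewrite foldr_rcons. Qed.

Lemma smooth_on_is_derive n (U : set 'rV[R]_n) G (V : normedModType R)
    (a : V -> 'rV[R]_n) (x v : V) : open U -> smooth_on U G -> U (a x) ->
  (forall j, derivable (fun u => a u 0 j) x v) ->
  is_derive x v (G \o a) (\sum_j pderive j G (a x) * 'D_v (fun u => a u 0 j) x).
Proof.
move=> oU sG Ua da; apply: is_derive_comp_row => // [|j].
  by apply: open_nearW Ua _ => // z Uz j; have [_] := smooth_on_C1 sG Uz.
by have [] := smooth_on_C1 (smooth_on_pderive j sG) Ua.
Qed.

Lemma derive_coord n (x v : 'rV[R]_n) j :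
  is_derive x v (fun y : 'rV[R]_n => y 0 j) (v 0 j).
Proof.
have did : derivable (@id 'rV[R]_n) x v by exact: derivable_id.
split; first by have /derivable_mxP := did; exact.
by have := derive_mx did; rewrite derive_id => /matrixP/(_ 0 j); rewrite mxE.
Qed.

Lemma smooth_on_coord n (U : set 'rV[R]_n) j : open U -> smooth_on U (fun x => x 0 j).
Proof.
move=> oU.
pose Q (f : 'rV[R]_n -> R) := f = (fun x => x 0 j) \/ exists c, f = cst c.
apply: (@smooth_coind _ U Q oU _ _ _ (fun x => x 0 j)) => //; last by left.
- move=> f [->|[c ->]] y Uy; split=> [|i].
  + exact: coord_continuous.
  + by have [] := derive_coord y (delta_mx 0 i) j.
  + exact: cst_continuous.
  + exact: derivable_cst.
- move=> f i [->|[c ->]].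
    exists (cst ((delta_mx 0 i : 'rV[R]_n) 0 j)); first by right; eexists.
    by move=> y _; have [_] := derive_coord y (delta_mx 0 i) j.
  by exists (cst 0); [right; exists 0|move=> y _; rewrite /pderive derive_cst].
Qed.

Lemma euclid_sm_coord n (x : 'rV[R]_n) j : euclid_sm_at x (fun y => y 0 j).
Proof.
by apply/euclid_sm_atP; exists setT; split=> //; [exact: openT|apply: smooth_on_coord; exact: openT].
Qed.

Section Comp.
Variables (m n : nat) (U : set 'rV[R]_m) (V : set 'rV[R]_n).
Variable a : 'rV[R]_m -> 'rV[R]_n.
Hypotheses (oU : open U) (oV : open V) (aUV : forall x, U x -> V (a x)).
Hypothesis sa : forall j, smooth_on U (fun x => a x 0 j).

(** The invariant for [smooth_coind]: it is closed under all that the chain, product and quotient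
    rules produce from composites [G \o a] and from reciprocals. *)
Inductive comp_class : ('rV[R]_m -> R) -> Prop :=
| comp_class_base f : smooth_on U f -> comp_class f
| comp_class_cst c : comp_class (cst c)
| comp_class_comp G : smooth_on V G -> comp_class (G \o a)
| comp_class_add f g : comp_class f -> comp_class g -> comp_class (f \+ g)
| comp_class_mul f g : comp_class f -> comp_class g -> comp_class (f \* g)
| comp_class_inv f : comp_class f -> (forall x, U x -> f x != 0) ->
    comp_class (fun x => (f x)^-1).

Let da j x i : U x -> derivable (fun x => a x 0 j) x (delta_mx 0 i).
Proof. by move=> Ux; have [_] := smooth_on_C1 (sa j) Ux. Qed.

Lemma comp_class_sum (I : Type) (r : seq I) (f : I -> 'rV[R]_m -> R) :
  (forall i, comp_class (f i)) -> comp_class (fun x => \sum_(i <- r) f i x).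
Proof.
move=> cf; elim: r => [|i r IH].
  by under eq_fun do rewrite big_nil; exact: comp_class_cst.
by under eq_fun do rewrite big_cons; exact: comp_class_add.
Qed.

Let ca x : U x -> {for x, continuous a}.
Proof.
by move=> Ux; apply: continuous_row => j; have [] := smooth_on_C1 (sa j) Ux.
Qed.

Lemma comp_class_C1 f : comp_class f -> forall y, U y ->
  {for y, continuous f} /\ forall i, derivable f y (delta_mx 0 i).
Proof.
elim=> {f} [f sf y Uy|c y Uy|G sG y Uy|f g _ IHf _ IHg y Uy|f g _ IHf _ IHg y Uy
           |f _ IHf f0 y Uy].
- exact: smooth_on_C1 sf _ Uy.
- by split=> [|i]; [exact: cst_continuous|exact: derivable_cst].
- split=> [|i].
    apply: continuous_comp; first exact: ca.
    by have [] := smooth_on_C1 sG (aUV Uy).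
  by have [] := smooth_on_is_derive oV sG (aUV Uy) (fun j => @da j y i Uy).
- have [cf df] := IHf y Uy; have [cg dg] := IHg y Uy.
  by split=> [|i]; [exact: continuousD|exact: derivableD].
- have [cf df] := IHf y Uy; have [cg dg] := IHg y Uy.
  by split=> [|i]; [exact: continuousM|exact: derivableM].
- have [cf df] := IHf y Uy.
  by split=> [|i]; [exact: cvgV (f0 y Uy) cf|apply: derivableV => //; exact: f0].
Qed.

Lemma comp_class_smooth f : comp_class f -> smooth_on U f.
Proof.
move=> cf; apply: (smooth_coind oU comp_class_C1 _ cf) => // {cf}f i.
elim=> {f} [f sf|c|G sG|f g Cf [f' Cf' ef] Cg [g' Cg' eg]
           |f g Cf [f' Cf' ef] Cg [g' Cg' eg]|f Cf [f' Cf' ef] f0].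
- by exists (pderive i f) => //; apply: comp_class_base; exact: smooth_on_pderive.
- by exists (cst 0); [exact: comp_class_cst|move=> y _; rewrite /pderive derive_cst].
- exists (fun x => \sum_j (pderive j G \o a) x * pderive i (fun u => a u 0 j) x).
    apply: comp_class_sum => j; apply: comp_class_mul.
      by apply: comp_class_comp; exact: smooth_on_pderive.
    by apply: comp_class_base; exact: smooth_on_pderive.
  move=> y Uy.
  have [_ dE] := smooth_on_is_derive oV sG (aUV Uy) (fun j => @da j y i Uy).
  by rewrite /pderive dE.
- exists (f' \+ g'); first exact: comp_class_add.
  move=> y Uy; have [_ df] := comp_class_C1 Cf Uy.
  have [_ dg] := comp_class_C1 Cg Uy.
  by rewrite /pderive deriveD //= -ef // -eg.
- exists ((f \* g') \+ (g \* f')).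
    by apply: comp_class_add; exact: comp_class_mul.
  move=> y Uy; have [_ df] := comp_class_C1 Cf Uy.
  have [_ dg] := comp_class_C1 Cg Uy.
  by rewrite /pderive deriveM //= -ef // -eg.
- exists (fun x => (-1) * f' x * ((f x)^-1 * (f x)^-1)).
    apply: comp_class_mul; first by apply: comp_class_mul => //; exact: comp_class_cst.
    by apply: comp_class_mul; exact: comp_class_inv.
  move=> y Uy; have [_ df] := comp_class_C1 Cf Uy.
  rewrite /pderive deriveV ?f0// -/(pderive i f y) ef// /GRing.scale /=.
  by rewrite expr2 invfM; ring.
Qed.

End Comp.

Lemma smooth_on_sub n (U V : set 'rV[R]_n) f : U `<=` V ->
  smooth_on V f -> smooth_on U f.
Proof. by move=> UV sf y /UV; exact: sf. Qed.

Lemma euclid_sm_comp m n (x : 'rV[R]_m) (a : 'rV[R]_m -> 'rV[R]_n) G :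
  (forall j, euclid_sm_at x (fun y => a y 0 j)) -> euclid_sm_at (a x) G ->
  euclid_sm_at x (G \o a).
Proof.
move=> sa /euclid_sm_atP[V [oV Vax sG]].
have ca : {for x, continuous a}.
  apply: continuous_row => j; have /euclid_sm_atP[U [_ Ux sU]] := sa j.
  by have [] := smooth_on_C1 sU Ux.
have : \forall y \near x, V (a y) /\
    forall j (s : seq 'I_m), {for y, continuous (D (fun y => a y 0 j) s)} /\
    forall i, derivable (D (fun y => a y 0 j) s) y (delta_mx 0 i).
  have nV : \forall y \near x, V (a y) by apply: ca; exact: open_nbhs_nbhs.
  by apply: filterS2 nV (@filter_forall _ _ _ _ _ sa) => y Vy sy; split.
move=> /near_open[U [oU Ux UP]]; apply/euclid_sm_atP; exists U; split=> //.
apply: (@comp_class_smooth _ _ U V a) => //.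
- by move=> y /UP[].
- by move=> j y /UP[_]; exact.
- exact: comp_class_comp.
Qed.

Lemma euclid_sm_inv n (x : 'rV[R]_n) f : euclid_sm_at x f -> f x != 0 ->
  euclid_sm_at x (fun y => (f y)^-1).
Proof.
move=> /euclid_sm_atP[V [oV Vx sf]] fx0.
have [cf _] := smooth_on_C1 sf Vx.
have : \forall y \near x, V y /\ f y != 0.
  have nV : \forall y \near x, V y by exact: open_nbhs_nbhs.
  have n0 : \forall y \near x, f y != 0.
    by apply: (cf [set r | r != 0]); apply: open_nbhs_nbhs; split=> //; exact: open_neq.
  by apply: filterS2 nV n0 => y Vy fy; split.
move=> /near_open[U [oU Ux UP]]; apply/euclid_sm_atP; exists U; split=> //.
have sU : smooth_on U f by apply: smooth_on_sub sf => y /UP[].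
apply: (@comp_class_smooth _ _ U U id) => //; first by move=> j; exact: smooth_on_coord.
by apply: comp_class_inv; [exact: comp_class_base|move=> y /UP[]].
Qed.

End SmoothOn.

                                     

(** * Homogeneous smooth functions are polynomials *)

Section HomogeneousFunctions.
Variables (R : realType) (n : nat) (w : 'I_n -> nat).
Hypothesis w0 : forall j, (0 < w j)%N.
Implicit Types (p q : mpoly n R) (v : 'rV[R]_n) (g : 'rV[R]_n -> R).

Definition whomog i p : Prop := forall m, m \in msupp p -> mweight w m = i.

Lemma mweightD (m1 m2 : multinom n) :
  mweight w (mnm_add m1 m2) = (mweight w m1 + mweight w m2)%N.
Proof.
by rewrite /mweight -big_split; apply: eq_bigr => j _; rewrite mnmDE mulnDl.
Qed.

Lemma mweight1 j : mweight w (mnm1 j) = w j.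
Proof.
rewrite /mweight (bigD1 j)//= mnm1E eqxx mul1n big1 ?addn0// => l lj.
by rewrite mnm1E eq_sym (negPf lj).
Qed.

Lemma whomog0 i : whomog i 0.
Proof. by move=> m; rewrite msupp0. Qed.

Lemma whomogD i p q : whomog i p -> whomog i q -> whomog i (p + q).
Proof.
by move=> hp hq m /msuppD_le; rewrite mem_cat => /orP[/hp|/hq].
Qed.

Lemma whomogZ i c p : whomog i p -> whomog i (c *: p).
Proof. by move=> hp m /msuppZ_le/hp. Qed.

Lemma whomog_sum i (I : Type) (r : seq I) (f : I -> mpoly n R) :
  (forall l, whomog i (f l)) -> whomog i (\sum_(l <- r) f l).
Proof.
move=> hf; elim: r => [|l r IH]; first by rewrite big_nil; exact: whomog0.
by rewrite big_cons; exact: whomogD.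
Qed.

Lemma whomogM i j p q : whomog i p -> whomog j q -> whomog (i + j) (p * q).
Proof.
move=> hp hq m /msuppM_le/allpairsP[[m1 m2] /= [/hp <- /hq <- ->]].
exact: mweightD.
Qed.

Lemma whomogX (m : multinom n) : whomog (mweight w m) (mpolyX R m).
Proof. by move=> m'; rewrite msuppX inE => /eqP ->. Qed.

Lemma weight_act1 v : weight_act w 1 v = v.
Proof. by apply/rowP => j; rewrite mxE expr1n mul1r. Qed.

Lemma weight_actA s t v : weight_act w s (weight_act w t v) = weight_act w (s * t) v.
Proof. by apply/rowP => j; rewrite !mxE exprMn mulrA. Qed.

Lemma weight_act0 v : weight_act w 0 v = 0.
Proof. by apply/rowP => j; rewrite !mxE expr0n eqn0Ngt w0 mul0r. Qed.

Lemma derive_weight_act (t : R) v u j :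
  is_derive v u (fun y => weight_act w t y 0 j) (t ^+ w j * u 0 j).
Proof.
rewrite (_ : (fun _ => _) = (t ^+ w j) \*: (fun y : 'rV[R]_n => y 0 j)).
  by have := derive_coord v u j => d; exact: is_deriveZ.
by apply: funext => y; rewrite mxE.
Qed.

Lemma derive_expr i (t : R) : is_derive t 1 (@GRing.exp R ^~ i) (i%:R * t ^+ i.-1).
Proof. by split; [exact: exprn_derivable|rewrite exp_derive /GRing.scale /= mulr1]. Qed.

Lemma derive_weight_curve (t : R) v j :
  is_derive t 1 (fun s => weight_act w s v 0 j) ((w j)%:R * t ^+ (w j).-1 * v 0 j).
Proof.
rewrite (_ : (fun _ => _) = (v 0 j) \*: (@GRing.exp R ^~ (w j))); last first.
  by apply: funext => s; rewrite mxE /GRing.scale /= mulrC.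
apply: is_derive_eq; first by have := derive_expr (w j) t; exact: is_deriveZ.
by rewrite /GRing.scale /= mulrC.
Qed.

Lemma weight_curve_continuous v : continuous (fun s : R => weight_act w s v).
Proof.
move=> s; apply: continuous_row => j.
have [d _] := derive_weight_curve s v j.
by apply: differentiable_continuous; apply/derivable1_diffP.
Qed.

(** Identities obtained by cancelling a power of t hold for t <> 0 only; continuity carries them to
    t = 0. *)
Lemma eq_at0 (f g : R -> R) : {for 0, continuous f} -> {for 0, continuous g} ->
  (forall t, t != 0 -> f t = g t) -> f 0 = g 0.
Proof.
move=> cf cg fg.
have E : g t @[t --> 0^'] = f t @[t --> 0^'].
  by apply/seteqP; split=> A; apply: filterS2 (nbhs_dnbhs_neq (0 : R)) => t t0 /=;
    rewrite fg.
have cf' : f t @[t --> 0^'] --> f 0.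
  by apply: cvg_trans cf; apply: cvg_app; exact: cvg_within.
have cg' : g t @[t --> 0^'] --> g 0.
  by apply: cvg_trans cg; apply: cvg_app; exact: cvg_within.
by rewrite -(cvg_lim _ cf')// -(cvg_lim _ cg')// E.
Qed.

Section Homog.
Variables (i : nat) (g : 'rV[R]_n -> R).
Hypothesis sg : smooth_on setT g.
Hypothesis hg : forall t v, g (weight_act w t v) = t ^+ i * g v.

(** Differentiate the homogeneity identity in v along e_j. *)
Lemma homog_pderive t v j :
  t ^+ w j * pderive j g (weight_act w t v) = t ^+ i * pderive j g v.
Proof.
have dw l := derive_weight_act t v (delta_mx 0 j) l.
have [_ dE] := smooth_on_is_derive (v := delta_mx 0 j) (a := weight_act w t)
  openT sg I (fun l => @ex_derive _ _ _ _ _ _ _ (dw l)).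
have : 'D_(delta_mx 0 j) (g \o weight_act w t) v = t ^+ i * pderive j g v.
  rewrite (_ : _ \o _ = (t ^+ i) \*: g); last by apply: funext => u /=; rewrite hg.
  by rewrite deriveZ//; have [] := smooth_on_C1 sg (I : setT v).
rewrite dE (bigD1 j)//= big1 => [|l lj]; last first.
  by rewrite (@derive_val _ _ _ _ _ _ _ (dw l)) !mxE eqxx (negPf lj) !mulr0.
by rewrite (@derive_val _ _ _ _ _ _ _ (dw j)) !mxE !eqxx mulr1 addr0 mulrC.
Qed.

(** Differentiate the homogeneity identity in t at t = 1. *)
Lemma homog_euler v : i%:R * g v = \sum_j (w j)%:R * v 0 j * pderive j g v.
Proof.
have dw l := derive_weight_curve 1 v l.
have [_ dE] := smooth_on_is_derive (v := (1 : R)) (a := weight_act w ^~ v)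
  openT sg I (fun l => @ex_derive _ _ _ _ _ _ _ (dw l)).
have : 'D_1 (g \o weight_act w ^~ v) (1 : R) = i%:R * g v.
  rewrite (_ : _ \o _ = (g v) \*: (@GRing.exp R ^~ i)); last first.
    by apply: funext => s /=; rewrite hg mulrC.
  have [d e] := derive_expr i 1; rewrite deriveZ// e /GRing.scale /=.
  by rewrite expr1n mulr1 mulrC.
rewrite dE => <-; apply: eq_bigr => j _.
rewrite (@derive_val _ _ _ _ _ _ _ (dw j)) expr1n weight_act1 mulr1.
by rewrite mulrC.
Qed.

(** The derivative would have negative weight: t^(w_j - i) times its value at h_t(v) does not depend
    on t for t <> 0, yet tends to 0 with t. *)
Lemma homog_pderive_small j : (i < w j)%N -> pderive j g = cst 0.
Proof.
move=> ij; apply: funext => v /=.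
have := @eq_at0 (fun t => t ^+ (w j - i) * pderive j g (weight_act w t v))
  (cst (pderive j g v)).
rewrite /= expr0n subn_eq0 leqNgt ij mul0r => <- //.
- apply: continuousM; first exact: exprn_continuous.
  apply: (@continuous_comp _ _ _ (weight_act w ^~ v) (pderive j g)).
    exact: weight_curve_continuous.
  by have [] := smooth_on_C1 (smooth_on_pderive j sg) (I : setT (weight_act w 0 v)).
- exact: cst_continuous.
- move=> t t0; apply: (mulfI (expf_neq0 i t0)).
  by rewrite mulrA -exprD subnKC ?(ltnW ij)// homog_pderive.
Qed.

Lemma homog_pderive_homog j : (w j <= i)%N ->
  forall t v, pderive j g (weight_act w t v) = t ^+ (i - w j) * pderive j g v.
Proof.
move=> ji; have E t v : t != 0 ->
    pderive j g (weight_act w t v) = t ^+ (i - w j) * pderive j g v.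
  move=> t0; apply: (mulfI (expf_neq0 (w j) t0)).
  by rewrite homog_pderive mulrA -exprD subnKC.
move=> t v; have [->|/E//] := eqVneq t 0.
apply: (@eq_at0 (fun t => pderive j g (weight_act w t v))
  (fun t => t ^+ (i - w j) * pderive j g v)).
- apply: (@continuous_comp _ _ _ (weight_act w ^~ v) (pderive j g)).
    exact: weight_curve_continuous.
  by have [] := smooth_on_C1 (smooth_on_pderive j sg) (I : setT (weight_act w 0 v)).
- by apply: continuousM; [exact: exprn_continuous|exact: cst_continuous].
- by move=> s; exact: E.
Qed.

End Homog.

                                                                                
                                                  
(** Strong induction on the weight. In weight 0, g v = g (h_0 v) = g 0. In positive weight each
    partial derivative is homogeneous of weight i - w_j < i or vanishes, hence is a polynomial, and
    Euler's identity expresses g through them. *)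
Lemma homog_poly i g : smooth_on setT g ->
  (forall t v, g (weight_act w t v) = t ^+ i * g v) ->
  exists2 p, whomog i p & forall v, g v = meval (fun j => v 0 j) p.
Proof.
elim/ltn_ind: i g => -[_|i IH] g sg hg.
  exists (mpolyC n (g 0)).
    move=> m; rewrite msuppC; case: eqP => // _; rewrite inE => /eqP ->.
    by rewrite /mweight big1 // => j _; rewrite mnm0E.
  by move=> v; rewrite mevalC -(weight_act0 v) hg expr0 mul1r.
(* If w_j > i + 1, the truncated difference i + 1 - w_j is 0 and X_j p would have the wrong weight
   w_j; the clause p = 0 removes that term. *)
have ex j : exists p, whomog (i.+1 - w j) p /\ ((i.+1 < w j)%N -> p = 0) /\
    forall v, pderive j g v = meval (fun j => v 0 j) p.
  have [ij|ji] := ltnP i.+1 (w j).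
    exists 0; split; first exact: whomog0.
    by split=> // v; rewrite (homog_pderive_small sg hg ij) meval0.
  have lt : (i.+1 - w j < i.+1)%N by rewrite ltn_subrL w0.
  have [p hp pE] := IH _ lt _ (smooth_on_pderive j sg) (homog_pderive_homog sg hg ji).
  by exists p; split=> //; split=> //; rewrite ltnNge ji.
pose p j := projT1 (cid (ex j)).
have pP j : _ := projT2 (cid (ex j)).
(* Euler's identity solved for g. *)
exists ((i.+1%:R : R)^-1 *: \sum_j (w j)%:R *: (mpolyX R (mnm1 j) * p j)).
  apply: whomogZ; apply: whomog_sum => j; apply: whomogZ.
  have [hp [p0 _]] := pP j; have [/p0 E|ji] := ltnP i.+1 (w j).
    by rewrite [p j]E mulr0; exact: whomog0.
  rewrite -(subnKC ji); apply: whomogM => //; rewrite -{1}(mweight1 j).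
  exact: whomogX.
move=> v; apply: (@mulfI _ (i.+1%:R : R)); first by rewrite pnatr_eq0.
rewrite (homog_euler sg hg) mevalZ mulrA divff ?pnatr_eq0// mul1r.
rewrite raddf_sum; apply: eq_bigr => j _ /=; have [_ [_ ->]] := pP j.
by rewrite mevalZ mevalM mevalXU mulrA.
Qed.

End HomogeneousFunctions.

                                  

(** * Manifolds and smooth maps: products, subspaces, local diffeomorphisms *)

Section Topology.

Lemma second_countable_intro (T : topologicalType) (I : countType) (b : I -> set T) :
  (forall i, open (b i)) ->
  (forall x A, nbhs x A -> exists2 i, b i x & b i `<=` A) -> @second_countable T.
Proof.
move=> ob bP; exists (range b).
  exact: sub_countable (card_image_le b setT) (countableP _).
split=> [_ [i _ <-]//|x A /bP[i bx bA]].
by exists (b i) => //; split=> //; exists i.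
Qed.

Lemma second_countable_seq (T : topologicalType) : @second_countable T ->
  exists b : nat -> set T, (forall i, open (b i)) /\
    forall x A, nbhs x A -> exists2 i, b i x & b i `<=` A.
Proof.
move=> [B /countable_injP[f fI] [oB bB]].
exists (fun i => \bigcup_(U in [set U | B U /\ f U = i]) U); split=> [i|x A].
  by apply: bigcup_open => U [/oB].
move=> /bB[U [BU Ux] UA]; exists (f U); first by exists U.
by move=> y [V [BV fV] Vy]; apply: UA; rewrite -(fI V U)// inE.
Qed.

Lemma open_setX (T T' : topologicalType) (A : set T) (B : set T') :
  open A -> open B -> open (A `*` B).
Proof.
move=> oA oB; rewrite openE => -[x y] [/= Ax By].
by exists (A, B) => //; split; exact: open_nbhs_nbhs.
Qed.

Lemma second_countable_prod (T T' : topologicalType) :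
  @second_countable T -> @second_countable T' -> @second_countable (T * T')%type.
Proof.
move=> /second_countable_seq[b [ob bP]] /second_countable_seq[b' [ob' bP']].
apply: (@second_countable_intro _ (nat * nat)%type (fun i => b i.1 `*` b' i.2)).
  by move=> i; apply: open_setX.
move=> x A [[P Q] /= [/bP[i bx bP1] /bP'[j bx' bQ]] PQA].
exists (i, j) => // y [/= /bP1 Py /bQ Qy]; exact: PQA.
Qed.

Lemma second_countable_homeo (T T' : topologicalType) (f : T -> T') (g : T' -> T) :
  continuous f -> continuous g -> cancel f g -> cancel g f ->
  @second_countable T' -> @second_countable T.
Proof.
move=> cf cg fK gK /second_countable_seq[b [ob bP]].
apply: (@second_countable_intro _ nat (fun i => f @^-1` b i)) => [i|x A xA].
  by apply: open_comp => // y _; exact: cf.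
have : nbhs (f x) (g @^-1` A) by apply: cg; rewrite fK.
by move=> /bP[i bx bA]; exists i => // y /bA; rewrite /= fK.
Qed.

Lemma cluster_map (T T' : topologicalType) (f : T -> T') p q :
  {for p, continuous f} -> {for q, continuous f} ->
  cluster (nbhs p) q -> cluster (nbhs (f p)) (f q).
Proof.
move=> cp cq pq A B /cp pA /cq qB.
by have [x [Ax Bx]] := pq _ _ pA qB; exists (f x).
Qed.

Lemma hausdorff_inj (T T' : topologicalType) (f : T -> T') :
  continuous f -> injective f -> hausdorff_space T' -> hausdorff_space T.
Proof. by move=> cf fI hT' p q /(cluster_map (cf p) (cf q)) /hT' /fI. Qed.

Lemma hausdorff_prod (T T' : topologicalType) :
  hausdorff_space T -> hausdorff_space T' -> hausdorff_space (T * T')%type.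
Proof.
move=> hT hT' [p p'] [q q'] pq.
have c1 (x : T * T') : {for x, continuous (@fst T T')} by exact: cvg_fst.
have c2 (x : T * T') : {for x, continuous (@snd T T')} by exact: cvg_snd.
congr (_, _).
  exact: hT (cluster_map (c1 (p, p')) (c1 (q, q')) pq).
exact: hT' (cluster_map (c2 (p, p')) (c2 (q, q')) pq).
Qed.

Lemma second_countable_row (R : realType) n : @second_countable 'rV[R]_n.
Proof.
pose b (i : 'rV[rat]_n * nat) := ball (map_mx ratr i.1 : 'rV[R]_n) (i.2.+1%:R)^-1.
apply: (@second_countable_intro _ _ b) => [i|x A /nbhs_ballP[e /= e0 eA]].
  by apply: ball_open; rewrite invr_gt0 ltr0n.
have [m mE] : exists m, (m.+1%:R)^-1 < e / 2 :> R.
  by have [m] := @ltr_add_invr R 0 (e / 2) ltac:(lra); rewrite add0r; exists m.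
have ex j : exists q : rat, `|x 0 j - ratr q| < (m.+1%:R)^-1.
  have m0 : 0 < (m.+1%:R)^-1 :> R by rewrite invr_gt0 ltr0n.
  have [|q] := @rat_in_itvoo R (x 0 j - (m.+1%:R)^-1) (x 0 j + (m.+1%:R)^-1);
    first by rewrite ltrBlDr -addrA ltrDl addr_gt0.
  rewrite in_itv /= => /andP[q1 q2]; exists q.
  by rewrite distrC ltr_norml ltrBlDl q2 andbT ltrBrDl.
pose q : 'rV[rat]_n := \row_j projT1 (cid (ex j)).
have qx : ball (map_mx ratr q : 'rV[R]_n) (m.+1%:R)^-1 x.
  split; first by rewrite invr_gt0 ltr0n.
  move=> i j; rewrite ord1 /q !mxE /ball /= distrC; case: cid => /= r.
  by rewrite distrC.
exists (q, m) => // y yq; apply: eA.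
apply: (@le_ball _ _ _ ((m.+1%:R)^-1 + (m.+1%:R)^-1)); first by rewrite (splitr e) lerD// ltW.
by apply: ball_triangle yq; exact: ball_sym.
Qed.

End Topology.

Section SmoothAt.
Variable R : realType.
Implicit Types X Y Z : smooth_space R.

(** A [smooth_space] carries no axiom saying that smoothness depends on the germ only, so this is a
    property to be established for each construction. *)
Definition local_sm X : Prop := forall (x : X) f g,
  (\forall y \near x, g y = f y) -> sm_at x f -> sm_at x g.

Lemma manifold_local X : is_manifold X -> local_sm X.
Proof. by move=> mX x f g; exact: sm_at_near. Qed.

Lemma euclid_local n : local_sm (euclid R n).
Proof. by move=> x f g; exact: euclid_sm_near. Qed.

Lemma sub_space_local X (S : set X) : local_sm (sub_space S).
Proof.
move=> x f g fg [G sG fG]; exists G => //.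
by apply: filterS2 fg fG => y -> ->.
Qed.

Lemma prod_space_local X Y : local_sm (prod_space X Y).
Proof.
move=> x f g fg [m [p [a [b [G [sa sb sG fG]]]]]].
by exists m, p, a, b, G; split=> //; apply: filterS2 fg fG => y -> ->.
Qed.

(** A pointwise form of [smooth_map], since charts and their inverses are meaningful on open subsets
    only. *)
Definition smooth_at X Y (f : X -> Y) (x : X) : Prop :=
  {for x, continuous f} /\ forall g : Y -> R, sm_at (f x) g -> sm_at x (g \o f).

Lemma smooth_mapP X Y (f : X -> Y) : smooth_map f <-> forall x, smooth_at f x.
Proof.
split=> [[cf sf] x|sf]; first by split; [exact: cf|exact: sf].
by split=> x; [have [] := sf x|have [_] := sf x].
Qed.

Lemma smooth_at_comp X Y Z (f : X -> Y) (g : Y -> Z) x :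
  smooth_at f x -> smooth_at g (f x) -> smooth_at (g \o f) x.
Proof.
move=> [cf sf] [cg sg]; split; first exact: continuous_comp.
by move=> h /sg/sf.
Qed.

Lemma smooth_at_id X (x : X) : smooth_at id x.
Proof. by split=> //; exact: cvg_id. Qed.

Lemma smooth_at_near X Y (f g : X -> Y) x : local_sm X ->
  (\forall y \near x, g y = f y) -> smooth_at f x -> smooth_at g x.
Proof.
move=> lX fg [cf sf]; have gfx := nbhs_singleton fg; split.
  rewrite /prop_for /continuous_at gfx; apply: cvg_trans cf.
  by apply: near_eq_cvg; apply: filterS fg => y ->.
move=> h; rewrite gfx => /sf; apply: lX.
by apply: filterS fg => y /= ->.
Qed.

Lemma local_diffeo_intro X Y (U : set X) (V : set Y) phi psi : local_sm X ->
  open U -> open V ->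
  (forall x, U x -> V (phi x) /\ psi (phi x) = x) ->
  (forall y, V y -> U (psi y) /\ phi (psi y) = y) ->
  (forall x, U x -> smooth_at phi x) -> (forall y, V y -> smooth_at psi y) ->
  local_diffeo U V phi psi.
Proof.
move=> lX oU oV UV VU sphi spsi; split=> //.
split=> [x /sphi[]//|y /spsi[]//|x Ux f].
have [Vx xE] := UV _ Ux; split.
  by have [_ s] := spsi _ Vx; rewrite -{1}xE => /s.
have [_ s] := sphi _ Ux => /s; apply: lX.
by apply: open_nearW oU Ux _ => y Uy /=; have [_ ->] := UV _ Uy.
Qed.

Lemma local_diffeo_smooth X Y (U : set X) (V : set Y) phi psi x : local_sm Y ->
  local_diffeo U V phi psi -> U x -> smooth_at phi x.
Proof.
move=> lY [oU oV UV VU [cphi cpsi sm]] Ux; split; first exact: cphi.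
move=> g sg; apply/(sm _ Ux); apply: lY sg.
have [Vx _] := UV _ Ux.
by apply: open_nearW oV Vx _ => y Vy /=; have [_ ->] := VU _ Vy.
Qed.

Lemma local_diffeo_smooth_inv X Y (U : set X) (V : set Y) phi psi y :
  local_diffeo U V phi psi -> V y -> smooth_at psi y.
Proof.
move=> [oU oV UV VU [cphi cpsi sm]] Vy; split; first exact: cpsi.
by move=> g; have [Uy yE] := VU _ Vy; rewrite (sm _ Uy) yE.
Qed.


Section OnManifold.
Variables (X : smooth_space R) (mX : is_manifold X).

Lemma sm_at_continuous (x : X) f : sm_at x f -> {for x, continuous f}.
Proof.
have [_ _ [n /(_ x)[U [V [phi [psi [Ux dphi]]]]]]] := mX.
have [oU oV UV VU [cphi cpsi sm]] := dphi.
move=> /(sm _ Ux)/euclid_sm_atP[W [_ Wx sW]].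
have [c _] := smooth_on_C1 sW Wx.
have [_ xE] := UV _ Ux.
have := continuous_comp (cphi _ Ux) c.
rewrite /prop_for /continuous_at /= xE; apply: cvg_trans.
apply: near_eq_cvg; apply: open_nearW oU Ux _ => y Uy /=.
by have [_ ->] := UV _ Uy.
Qed.

Lemma sm_at_comp n (x : X) (a : X -> 'rV[R]_n) G :
  (forall j, sm_at x (fun y => a y 0 j)) -> euclid_sm_at (a x) G ->
  sm_at x (G \o a).
Proof.
have [_ _ [m /(_ x)[U [V [phi [psi [Ux [oU oV UV VU [cphi cpsi sm]]]]]]]]] := mX.
move=> sa sG; apply/(sm _ Ux).
have [_ xE] := UV _ Ux.
apply: (@euclid_sm_comp _ _ _ (phi x) (a \o psi) G) => [j|]; last by rewrite /= xE.
exact: (sm _ Ux _).1 (sa j).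
Qed.

Lemma sm_at_inv (x : X) f : sm_at x f -> f x != 0 -> sm_at x (fun y => (f y)^-1).
Proof.
have [_ _ [m /(_ x)[U [V [phi [psi [Ux [oU oV UV VU [cphi cpsi sm]]]]]]]]] := mX.
have [_ xE] := UV _ Ux.
by rewrite !(sm _ Ux) => sf fx0; apply: euclid_sm_inv => //=; rewrite xE.
Qed.

Lemma sm_at_prod (x : X) (I : Type) (r : seq I) (f : I -> X -> R) :
  (forall i, sm_at x (f i)) -> sm_at x (fun y => \prod_(i <- r) f i y).
Proof.
move=> sf; elim: r => [|i r IH].
  by under eq_fun do rewrite big_nil; exact: sm_at_cst.
by under eq_fun do rewrite big_cons; exact: sm_atM.
Qed.

Lemma sm_at_exp (x : X) f k : sm_at x f -> sm_at x (fun y => f y ^+ k).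
Proof.
move=> sf; elim: k => [|k IH].
  by under eq_fun do rewrite expr0; exact: sm_at_cst.
by under eq_fun do rewrite exprS; exact: sm_atM.
Qed.

Lemma sm_at_det N (M : X -> 'M[R]_N) x :
  (forall i j, sm_at x (fun y => M y i j)) -> sm_at x (fun y => \det (M y)).
Proof.
move=> sM; rewrite /determinant; apply: (sm_at_sum mX) => s.
by apply: (sm_atM mX); [exact: sm_at_cst|apply: sm_at_prod => i].
Qed.

Lemma smooth_at_cst Y (y : Y) (x : X) : smooth_at (fun=> y) x.
Proof. by split=> [|g _]; [exact: cst_continuous|exact: sm_at_cst]. Qed.

Lemma smooth_at_row n (a : X -> euclid R n) x :
  (forall j, sm_at x (fun y => a y 0 j)) -> smooth_at a x.
Proof.
move=> sa; split; last by move=> g; exact: sm_at_comp.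
by apply: continuous_row => j; exact: sm_at_continuous.
Qed.

Lemma smooth_at_pair Y Z (f : X -> Y) (g : X -> Z) x :
  smooth_at f x -> smooth_at g x ->
  smooth_at (fun y => (f y, g y) : prod_space Y Z) x.
Proof.
move=> [cf sf] [cg sg]; have cfg : {for x, continuous (fun y => (f y, g y))}.
  exact: cvg_pair cf cg.
split=> // h [m [p [a [b [G [sa sb sG hG]]]]]].
apply: (sm_at_near mX (f := G \o (fun y => row_mx (a (f y)) (b (g y))))).
  exact: cfg hG.
apply: sm_at_comp => // j; case: (split_ordP j) => i ->.
  by under eq_fun do rewrite row_mxEl; exact: sf (sa i).
by under eq_fun do rewrite row_mxEr; exact: sg (sb i).
Qed.

End OnManifold.

Lemma smooth_at_fst X Y (z : prod_space X Y) : smooth_at (fst : prod_space X Y -> X) z.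
Proof.
split=> [|g sg]; first exact: cvg_fst.
exists 1%N, 0%N, (fun x => const_mx (g x)), (fun=> 0), (fun r => r 0 0); split=> //.
- by move=> i; under eq_fun do rewrite mxE.
- by case.
- exact: euclid_sm_coord.
- apply: (@nearW _ (nbhs z)) => u.
  by rewrite (_ : 0 = lshift 0 (0 : 'I_1)) ?row_mxEl ?mxE//; exact: val_inj.
Qed.

Lemma smooth_at_snd X Y (z : prod_space X Y) : smooth_at (snd : prod_space X Y -> Y) z.
Proof.
split=> [|g sg]; first exact: cvg_snd.
exists 0%N, 1%N, (fun=> 0), (fun x => const_mx (g x)), (fun r => r 0 0); split=> //.
- by case.
- by move=> i; under eq_fun do rewrite mxE.
- exact: euclid_sm_coord.
- apply: (@nearW _ (nbhs z)) => u.
  by rewrite (_ : 0 = rshift 0 (0 : 'I_1)) ?row_mxEr ?mxE//; exact: val_inj.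
Qed.

Lemma euclid_manifold n : is_manifold (euclid R n).
Proof.
split; [exact: norm_hausdorff|exact: second_countable_row|exists n => x].
exists setT, setT, id, id; split; first exact: I.
apply: local_diffeo_intro; [exact: euclid_local|exact: openT|exact: openT| | | |].
- by [].
- by [].
- by move=> y _; exact: smooth_at_id.
- by move=> y _; exact: smooth_at_id.
Qed.

Lemma prod_manifold X Y :
  is_manifold X -> is_manifold Y -> is_manifold (prod_space X Y).
Proof.
move=> mX mY; have [hX bX [m cX]] := mX; have [hY bY [p cY]] := mY.
split; [exact: hausdorff_prod|exact: second_countable_prod|exists (m + p)%N => z].
have [U [V [phi [psi [Ux dphi]]]]] := cX z.1.
have [U' [V' [phi' [psi' [Ux' dphi']]]]] := cY z.2.
have [oU oV UV VU _] := dphi; have [oU' oV' UV' VU' _] := dphi'.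
pose F (u : prod_space X Y) : euclid R (m + p) := row_mx (phi u.1) (phi' u.2).
pose l (r : euclid R (m + p)) : euclid R m := lsubmx r.
pose l' (r : euclid R (m + p)) : euclid R p := rsubmx r.
have sl r : smooth_at l r.
  apply: (smooth_at_row (euclid_manifold _)) => j.
  by under eq_fun do rewrite mxE; exact: euclid_sm_coord.
have sl' r : smooth_at l' r.
  apply: (smooth_at_row (euclid_manifold _)) => j.
  by under eq_fun do rewrite mxE; exact: euclid_sm_coord.
exists (U `*` U'), ((l @^-1` V) `&` (l' @^-1` V')), F,
  (fun r => (psi (l r), psi' (l' r))); split; first by split.
apply: local_diffeo_intro.
- exact: prod_space_local.
- exact: open_setX.
- by apply: openI; apply: open_comp => // r _; [have [] := sl r|have [] := sl' r].
- move=> [x y] [/= /UV[Vx xE] /UV'[Vy yE]].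
  by rewrite /l /l' row_mxKl row_mxKr; split=> //; congr pair.
- move=> r [/= /VU[Ur rE] /VU'[Ur' rE']]; split=> //.
  by rewrite /F /= rE rE' hsubmxK.
- move=> [x y] [/= Ux1 Uy1]; split.
    have c1 : {for (x, y), continuous (fun u : X * Y => phi u.1)}.
      apply: continuous_comp; first exact: cvg_fst.
      by have [c _] := local_diffeo_smooth (@euclid_local _) dphi Ux1.
    have c2 : {for (x, y), continuous (fun u : X * Y => phi' u.2)}.
      apply: continuous_comp; first exact: cvg_snd.
      by have [c _] := local_diffeo_smooth (@euclid_local _) dphi' Uy1.
    apply: continuous_row => j; case: (split_ordP j) => i ->.
      rewrite (_ : (fun _ => _) = (fun r : 'rV_m => r 0 i) \o (fun u : X * Y => phi u.1)).
        by apply: continuous_comp => //; exact: coord_continuous.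
      by apply: funext => u; rewrite /= row_mxEl.
    rewrite (_ : (fun _ => _) = (fun r : 'rV_p => r 0 i) \o (fun u : X * Y => phi' u.2)).
      by apply: continuous_comp => //; exact: coord_continuous.
    by apply: funext => u; rewrite /= row_mxEr.
  move=> g sg; exists m, p, phi, phi', g; split=> //.
  + move=> i; have [_ s] := local_diffeo_smooth (@euclid_local _) dphi Ux1.
    by apply: (s (fun r => r 0 i)); exact: euclid_sm_coord.
  + move=> i; have [_ s] := local_diffeo_smooth (@euclid_local _) dphi' Uy1.
    by apply: (s (fun r => r 0 i)); exact: euclid_sm_coord.
  + exact: (@nearW _ (nbhs (x, y))).
- move=> r [/= Vr Vr']; apply: (smooth_at_pair (euclid_manifold _)).
    exact: smooth_at_comp (sl r) (local_diffeo_smooth_inv dphi Vr).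
  exact: smooth_at_comp (sl' r) (local_diffeo_smooth_inv dphi' Vr').
Qed.

(** Charts are transported along the diffeomorphism; this later identifies the base of a glued
    bundle with the manifold it was built over. *)
Lemma manifold_diffeo X Y (f : X -> Y) (g : Y -> X) : local_sm X ->
  smooth_map f -> smooth_map g -> cancel f g -> cancel g f ->
  is_manifold Y -> is_manifold X.
Proof.
move=> lX sf sg fK gK mY; have [hY bY [n cY]] := mY; split.
- by apply: hausdorff_inj hY; [case: sf|exact: can_inj fK].
- by apply: second_countable_homeo bY => //; [case: sf|case: sg].
exists n => x; have [U [V [phi [psi [Ux dphi]]]]] := cY (f x).
have [oU oV UV VU _] := dphi.
exists (f @^-1` U), V, (phi \o f), (g \o psi); split; first exact: Ux.
move: sf sg => /smooth_mapP sf /smooth_mapP sg.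
apply: local_diffeo_intro; first exact: lX.
- by apply: open_comp => // y _; have [] := sf y.
- exact: oV.
- by move=> y Uy; have [Vy yE] := UV _ Uy; rewrite /= yE fK.
- by move=> y Vy; have [Uy yE] := VU _ Vy; rewrite /= gK.
- move=> y Uy; apply: smooth_at_comp; first exact: sf.
  exact: local_diffeo_smooth (@euclid_local _) dphi Uy.
- move=> y Vy; apply: smooth_at_comp; last exact: sg.
  exact: local_diffeo_smooth_inv dphi Vy.
Qed.

Lemma sub_space_val X (S : set X) (x : sub_space S) : smooth_at (val : sub_space S -> X) x.
Proof.
split; last by move=> g sg; exists g => //; exact: (@nearW _ (nbhs x)).
exact: (@initial_continuous (set_type S) X val).
Qed.

Lemma smooth_at_sub X Y (S : set Y) (f : X -> sub_space S) x : local_sm X ->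
  smooth_at (val \o f : X -> Y) x -> smooth_at f x.
Proof.
move=> lX [cf sf]; have cf' : {for x, continuous f}.
  move=> A [_ [[B oB <-] /= By BA]].
  have : nbhs x ((val \o f) @^-1` B) by apply: cf; exact: open_nbhs_nbhs.
  by apply: filterS => z Bz; exact: BA.
split=> // g [G sG gG]; apply: lX (sf _ sG).
by have nE : \forall y \near x, g (f y) = G (val (f y)) := cf' _ gG.
Qed.

End SmoothAt.

                                                            

(** * Weil algebras, their dual coalgebras, and curves *)

Lemma dual_ext (R : realType) (V : lmodType R) (c d : dual V) :
  (forall a, c a = d a) -> c = d.
Proof. by move=> cd; apply: val_inj; apply: funext. Qed.

Section WeilCurves.
Variables (R : realType) (k n : nat) (w : 'I_n -> nat).
Hypothesis wP : weights_upto k w.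
Implicit Types (p q : mpoly n R) (v : 'rV[R]_n) (m : multinom n).

Let w0 j : (0 < w j)%N. Proof. by case/andP: (wP j). Qed.

Lemma eps_powE i l : eps_coef (eps_pow R k i) l = ((i == l) && (l <= k)%N)%:R.
Proof. by rewrite eps_coef_in coefXn eq_sym ltnS; case: leqP => _; rewrite ?andbT ?andbF. Qed.

Lemma eps_powD i l : eps_pow R k (i + l) = eps_pow R k i * eps_pow R k l.
Proof. by rewrite /eps_pow exprD in_qpolyM. Qed.

Lemma eps_pow0 : eps_pow R k 0 = 1.
Proof. by apply: eps_eq => i; rewrite eps_powE eps_coef1 eq_sym; case: i. Qed.

Lemma eps_coef_sum (I : Type) (r : seq I) (f : I -> eps_alg R k) i :
  eps_coef (\sum_(l <- r) f l) i = \sum_(l <- r) eps_coef (f l) i.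
Proof.
elim: r => [|l r IH]; last by rewrite !big_cons eps_coefD IH.
by rewrite !big_nil /eps_coef coef0.
Qed.

Definition vmon v m : R := \prod_j v 0 j ^+ m j.

Lemma vmon1 v j : vmon v (mnm1 j) = v 0 j.
Proof.
rewrite /vmon (bigD1 j)//= mnm1E eqxx expr1 big1 ?mulr1// => l lj.
by rewrite mnm1E eq_sym (negPf lj).
Qed.

(** Evaluation of p along the curve eps -> h_eps(v), truncated after eps^k. *)
Definition wev v p : eps_alg R k :=
  mmap (in_alg (eps_alg R k)) (fun j => v 0 j *: eps_pow R k (w j)) p.

Lemma wevD v p q : wev v (p + q) = wev v p + wev v q.
Proof. by rewrite /wev mmapD. Qed.

Lemma wevM v p q : wev v (p * q) = wev v p * wev v q.
Proof. by have [M _] := mmap_is_multiplicative (fun j => v 0 j *: eps_pow R k (w j))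
  (in_alg (eps_alg R k)); exact: M. Qed.

Lemma wev1 v : wev v 1 = 1.
Proof. by have [_ M] := mmap_is_multiplicative (fun j => v 0 j *: eps_pow R k (w j))
  (in_alg (eps_alg R k)); exact: M. Qed.

Lemma wevZ v c p : wev v (c *: p) = c *: wev v p.
Proof. by rewrite /wev mmapZ mulr_algl. Qed.

Lemma wev_sum v (I : Type) (r : seq I) (P : pred I) (f : I -> mpoly n R) :
  wev v (\sum_(i <- r | P i) f i) = \sum_(i <- r | P i) wev v (f i).
Proof.
elim/big_rec2: _ => [|i y1 y2 _ <-]; last by rewrite wevD.
by rewrite /wev mmap0.
Qed.

Lemma wevX v m : wev v (mpolyX R m) = vmon v m *: eps_pow R k (mweight w m).
Proof.
rewrite /wev mmapX /mmap1 /vmon /mweight.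
elim/big_rec3: _ => [|j x y z _ ->]; first by rewrite eps_pow0 scale1r.
rewrite exprZn -scalerAl -scalerAr scalerA eps_powD; congr (_ *: (_ * _)).
elim: (m j) => [|l IH]; first by rewrite expr0 eps_pow0.
by rewrite exprS IH mulSn eps_powD.
Qed.

Lemma wev_coef v p i : (i <= k)%N ->
  eps_coef (wev v p) i = \sum_(m <- msupp p | mweight w m == i) mcoeff m p * vmon v m.
Proof.
move=> ik; rewrite {1}(mpolyE p) wev_sum eps_coef_sum [RHS]big_mkcond.
apply: eq_bigr => m _; rewrite wevZ wevX !eps_coefZ eps_powE ik andbT.
by case: eqP; rewrite ?mulr1 ?mulr0.
Qed.

Lemma wev_act t v p : wev (weight_act w t v) p = eps_act t (wev v p).
Proof.
apply: eps_eq => i; rewrite eps_coef_act.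
have [ik|ik] := leqP i k; last first.
  by rewrite [LHS](eps_coef_big _ ik) [X in _ * X](eps_coef_big _ ik) mulr0.
rewrite [LHS](wev_coef _ _ ik) [X in _ * X](wev_coef _ _ ik) mulr_sumr; apply: eq_bigr => m /eqP <-.
rewrite mulrCA; congr (_ * _); rewrite /vmon /mweight -prodrXr -big_split /=.
by apply: eq_bigr => j _; rewrite mxE exprMn -exprM mulnC.
Qed.

Lemma wev_homog v p i : whomog w i p -> wev v p = meval (fun j => v 0 j) p *: eps_pow R k i.
Proof.
move=> hp; rewrite {1}(mpolyE p) wev_sum mevalE scaler_suml.
rewrite !big_seq; apply: eq_bigr => m /hp mi.
by rewrite wevZ wevX mi scalerA.
Qed.

                                                                               
                                                                              
(** Interpolation on {0, ..., k}^n: the coefficient of a monomial m with exponents at most k is a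
    fixed linear combination of values at grid points. Its weights [grid_co m] are products of
    entries of the inverse Vandermonde matrix of the nodes 0, ..., k; in [vdm_inv a b], a is the
    exponent and b the node. *)
Definition grid := {ffun 'I_n -> 'I_k.+1}.
Definition grid_pt (q : grid) : 'rV[R]_n := \row_j (q j : nat)%:R.
Definition vdm_inv (a b : 'I_k.+1) : R :=
  invmx (Vandermonde k.+1 (\row_(j < k.+1) (j : nat)%:R)) b a.
Definition grid_co m (q : grid) : R := \prod_j vdm_inv (inord (m j)) (q j).

Lemma vdm_invP (a c : 'I_k.+1) :
  \sum_b vdm_inv a b * (b : nat)%:R ^+ c = (a == c)%:R.
Proof.
set V := Vandermonde k.+1 (\row_(j < k.+1) (j : nat)%:R : 'rV[R]_k.+1).
have Vu : V \in unitmx.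
  rewrite unitmxE det_Vandermonde unitfE; apply/prodf_neq0 => i _.
  apply/prodf_neq0 => j ij; rewrite !mxE subr_eq0 eqr_nat.
  by rewrite neq_ltn ij orbT.
have /matrixP/(_ c a) := mulmxV Vu; rewrite !mxE eq_sym => <-.
by apply: eq_bigr => b _; rewrite !mxE mulrC.
Qed.

Lemma grid_coP m m' : (forall j, m j <= k)%N -> (forall j, m' j <= k)%N ->
  \sum_q grid_co m q * vmon (grid_pt q) m' = (m == m')%:R.
Proof.
move=> mk mk'; rewrite /grid_co /vmon.
under eq_bigr => q _ do rewrite -big_split /=.
under eq_bigr => q _ do under eq_bigr => j _ do rewrite mxE.
rewrite -(bigA_distr_bigA (fun j b => vdm_inv (inord (m j)) b * b%:R ^+ m' j)) /=.
have E j : \sum_b vdm_inv (inord (m j)) b * (b : nat)%:R ^+ m' j = (m j == m' j)%:R.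
  rewrite -{1}(@inordK k (m' j)) ?ltnS// vdm_invP -val_eqE /= !inordK ?ltnS//.
under eq_bigr => j _ do rewrite E.
have [<-|mm'] := eqVneq m m'; first by rewrite big1 // => j _; rewrite eqxx.
have [j mj] : exists j, m j != m' j.
  apply/existsP; apply: contraNT mm' => /existsPn mm'.
  by apply/eqP/mnmP => j; apply/eqP; have := mm' j; rewrite negbK.
by rewrite (bigD1 j)//= (negPf mj) mul0r.
Qed.

Lemma mweight_ge m j : (m j <= mweight w m)%N.
Proof. by rewrite /mweight (bigD1 j)//= (leq_trans _ (leq_addr _ _))// leq_pmulr. Qed.

(** Weights of variables are positive, so all monomials of weight at most k have exponents at most k
    and are separated by the grid. *)
Lemma grid_wev m p : (mweight w m <= k)%N ->
  \sum_q grid_co m q * eps_coef (wev (grid_pt q) p) (mweight w m) = mcoeff m p.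
Proof.
move=> mk; under eq_bigr => q _ do rewrite wev_coef// mulr_sumr.
rewrite exchange_big /=.
have E m' : mweight w m' == mweight w m ->
    \sum_q grid_co m q * (mcoeff m' p * vmon (grid_pt q) m') = mcoeff m' p * (m == m')%:R.
  move=> /eqP mm; rewrite -grid_coP => [|j|j]; last 2 first.
  - exact: leq_trans (mweight_ge m j) mk.
  - by rewrite (leq_trans (mweight_ge m' j))// mm.
  by rewrite mulr_sumr; apply: eq_bigr => q _; rewrite mulrCA.
rewrite (eq_bigr _ (fun m' => @E m')).
have [ms|ms] := boolP (m \in msupp p); last first.
  rewrite big1_seq => [|m' /andP[_ m's]].
    by apply/esym/eqP; rewrite mcoeff_eq0.
  by case: eqP ms => [->|_]; rewrite ?m's ?mulr0.
rewrite big_mkcond (bigD1_seq m)//= ?msupp_uniq// !eqxx mulr1 big1 ?addr0// => m'.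
by rewrite eq_sym => /negPf ->; rewrite mulr0; case: ifP.
Qed.

(** A truncated evaluation does not see weights above k, and by interpolation the evaluations
    together see all the others. *)
Lemma wev_eq0 p : (forall v, wev v p = 0) <-> (forall m, m \in msupp p -> (k < mweight w m)%N).
Proof.
split=> [p0 m|pk v].
  apply: contraTT; rewrite -leqNgt => mk; rewrite -mcoeff_eq0 -grid_wev//.
  by rewrite big1// => q _; rewrite p0 /eps_coef coef0 mulr0.
apply: eps_eq => i; rewrite [RHS]coef0.
have [ik|ik] := leqP i k; last exact: eps_coef_big.
rewrite wev_coef// big1_seq// => m /andP[/eqP mi /pk].
by rewrite mi ltnNge ik.
Qed.

                                                                            
                                             
(** The condition on [pi] in [free_weil_alg], isolated so that a presentation can be fixed and its
    generators used as coordinates. *)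
Definition weil_pres (A : galg R) (pi : {lrmorphism mpoly n R -> A}) : Prop :=
  [/\ forall a, exists p, pi p = a,
      forall p, pi p = 0 <-> (forall m, m \in msupp p -> (k < mweight w m)%N) &
      forall i a, ga_deg i a <-> exists2 p, whomog w i p & pi p = a].

Lemma big_iota_ord (V : nmodType) (F : nat -> V) i :
  \sum_(j <- iota 0 i) F j = \sum_(j < i) F j.
Proof. by rewrite -(big_mkord xpredT F) /index_iota subn0. Qed.

                                                                                 
                                                                          
                                 
(** On the dual of an algebra A these are the graded algebra morphisms a -> sum of g_i(a) eps^i from
    A to R[eps]/(eps^(k+1)). The condition mentions only the coalgebra structure, so coalgebra
    morphisms preserve it. *)
Definition is_curve (C : gcoalg R) (g : nat -> C) : Prop :=
  [/\ forall i, gc_deg i (g i), gc_counit (g 0%N) = 1 &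
      forall i, (i <= k)%N -> gc_comul (g i) [seq (g j, g (i - j)%N) | j <- iota 0 i.+1]].

Lemma coalg_hom_curve (C D : gcoalg R) (f : C -> D) g :
  coalg_hom f -> is_curve g -> is_curve (f \o g).
Proof.
move=> [_ df uf cf] [dg ug cg]; split=> [i|/=|i /cg/cf]; first exact: df.
  by rewrite uf.
by rewrite -map_comp.
Qed.

(** Contains every monomial of weight at most k, since weight bounds degree; its monomials of larger
    weight are harmless because they vanish in A. *)
Definition mon_index : finType := bmultinom n k.+1.

Section Pres.
Variables (A : galg R) (pi : {lrmorphism mpoly n R -> A}).
Hypothesis piP : weil_pres pi.
Implicit Types (c d : dual A).

Definition plift (a : A) : mpoly n R := projT1 (cid (let: And3 s _ _ := piP in s a)).

Lemma pliftK a : pi (plift a) = a.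
Proof. by rewrite /plift; case: cid. Qed.

Lemma wev_ker v p q : pi p = pi q -> wev v p = wev v q.
Proof.
move=> pq; have [_ ker _] := piP.
have /wev_eq0/(_ v) : forall m, m \in msupp (p - q) -> (k < mweight w m)%N.
  by apply/ker; rewrite raddfB /= pq subrr.
by rewrite -[- q]scaleN1r wevD wevZ scaleN1r => /eqP; rewrite subr_eq0 => /eqP.
Qed.

Lemma pcrvP v i a (x y : A) :
  eps_coef (wev v (plift (a *: x + y))) i =
  a * eps_coef (wev v (plift x)) i + eps_coef (wev v (plift y)) i.
Proof.
rewrite (@wev_ker _ _ (a *: plift x + plift y)); last first.
  rewrite pliftK raddfD /= linearZ_LR.
  by congr (_ *: _ + _); apply/esym; exact: pliftK.
by rewrite wevD wevZ eps_coefD eps_coefZ.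
Qed.

                                                        
(** The curve of the point v. The choice of representative made by [plift] does not matter, because
    evaluation kills the kernel of [pi] ([wev_ker]). *)
Definition pcrv v i : gdual A := mk_dual (@pcrvP v i).

Lemma pcrvE v i p : (pcrv v i : dual A) (pi p) = eps_coef (wev v p) i.
Proof. exact: (congr1 (fun x => eps_coef x i) (wev_ker v (pliftK (pi p)))). Qed.

Lemma pcrv_curve v : is_curve (pcrv v).
Proof.
have [_ _ deg] := piP.
split=> [i j a ji /deg[p hp <-]||i ik a b].
- by rewrite pcrvE (wev_homog _ hp) eps_coefZ eps_powE (negPf ji) mulr0.
- rewrite -[LHS]/((pcrv v 0 : dual A) 1) -(rmorph1 pi) pcrvE wev1.
  exact: eps_coef1.
rewrite big_map -{2}[a]pliftK -{2}[b]pliftK -rmorphM pcrvE wevM.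
by rewrite eps_coefM// big_iota_ord.
Qed.

Lemma pcrv_big v i : (k < i)%N -> pcrv v i = 0.
Proof. by move=> ki; apply: dual_ext => a /=; rewrite eps_coef_big. Qed.

Lemma pcrv_gen v j : (pcrv v (w j) : dual A) (pi (mpolyX R (mnm1 j))) = v 0 j.
Proof.
rewrite pcrvE wevX eps_coefZ eps_powE mweight1 eqxx; case/andP: (wP j) => _ ->.
by rewrite mulr1 vmon1.
Qed.

Lemma pcrv_inj v v' : (forall i, pcrv v i = pcrv v' i) -> v = v'.
Proof. by move=> vv; apply/rowP => j; rewrite -!pcrv_gen vv. Qed.

Lemma pcrv_act t v i : pcrv (weight_act w t v) i = t ^+ i *: (pcrv v i : dual A).
Proof.
by apply: dual_ext => a; rewrite -[a]pliftK pcrvE wev_act eps_coef_act -pcrvE.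
Qed.

Lemma pres_deg_mon m : ga_deg (mweight w m) (pi (mpolyX R m)).
Proof. by have [_ _ deg] := piP; apply/deg; exists (mpolyX R m) => //; exact: whomogX. Qed.

Lemma pres_mon_big m : (k < mweight w m)%N -> pi (mpolyX R m) = 0.
Proof.
by move=> km; have [_ ker _] := piP; apply/ker => m'; rewrite msuppX inE => /eqP ->.
Qed.

Lemma dual_pi_sum c p : c (pi p) = \sum_(m <- msupp p) mcoeff m p * c (pi (mpolyX R m)).
Proof.
rewrite {1}(mpolyE p) linear_sum -dual_linear_sum; congr (c _).
by apply: eq_bigr => m _; rewrite linearZ.
Qed.

(** A graded morphism sends the generator y_j, of weight w_j, to a multiple v_j of eps^(w_j), and an
    algebra morphism is determined by its values on generators. *)
Lemma curve_pcrv (g : nat -> gdual A) : is_curve g -> exists v, forall i, g i = pcrv v i.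
Proof.
move=> [dg ug cg]; exists (\row_j g (w j) (pi (mpolyX R (mnm1 j)))) => i.
set v := \row_j _.
(* Monomials of weight at most k span A, and g_l vanishes on them by degree once l > k. *)
have big l : (k < l)%N -> g l = 0.
  move=> kl; apply: dual_ext => a; rewrite -[a]pliftK dual_pi_sum.
  rewrite big1// => m _; have [mk|mk] := leqP (mweight w m) k; last first.
    by rewrite pres_mon_big// dual0 mulr0.
  rewrite (dg l (mweight w m) _ _ (pres_deg_mon m)) ?mulr0//.
  by rewrite neq_ltn (leq_ltn_trans mk).
(* The curve reassembled into a map to R[eps]/(eps^(k+1)); the comultiplication rule makes it
   multiplicative. *)
pose G (a : A) : eps_alg R k := \sum_(l < k.+1) (g l : dual A) a *: eps_pow R k l.
have GE a l : (l <= k)%N -> eps_coef (G a) l = (g l : dual A) a.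
  move=> lk; rewrite eps_coef_sum (bigD1 (Ordinal (lk : l < k.+1)%N))//=.
  rewrite eps_coefZ eps_powE eqxx lk mulr1 big1 ?addr0// => l' ll'.
  rewrite eps_coefZ eps_powE; case: eqP => [E|_]; last by rewrite mulr0.
  by move: ll'; rewrite -val_eqE /= E eqxx.
have GM a b : G (a * b) = G a * G b.
  apply: eps_eq => l; have [lk|lk] := leqP l k; last first.
    by rewrite (eps_coef_big _ lk) (eps_coef_big _ lk).
  rewrite GE// eps_coefM// -(cg l lk a b) big_map big_iota_ord.
  apply: eq_bigr => j _; rewrite !GE// ?(leq_trans _ lk) ?leq_subr//.
  by rewrite -ltnS.
have G1 : G 1 = 1.
  apply: eps_eq => l; have [lk|lk] := leqP l k; last first.
    by rewrite (eps_coef_big _ lk) (eps_coef_big _ lk).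
  rewrite GE// eps_coef1; have [->|l0] := eqVneq l 0%N; first exact: ug.
  apply: (dg l 0%N); first by rewrite eq_sym.
  have := pres_deg_mon (mnm0); rewrite mpolyX0 rmorph1.
  by rewrite /mweight big1// => j _; rewrite mnm0E.
have GX j : G (pi (mpolyX R (mnm1 j))) = v 0 j *: eps_pow R k (w j).
  apply: eps_eq => l; have [lk|lk] := leqP l k; last first.
    by rewrite (eps_coef_big _ lk) (eps_coef_big _ lk).
  rewrite GE// eps_coefZ eps_powE lk andbT mxE.
  have [->|wl] := eqVneq (w j) l; first by rewrite mulr1.
  by rewrite mulr0; apply: (dg l (w j)) => //; rewrite -[w j](mweight1 w); exact: pres_deg_mon.
have Gmon m : G (pi (mpolyX R m)) = wev v (mpolyX R m).
  rewrite mpolyXE_id rmorph_prod /=.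
  rewrite (big_morph (wev v) (wevM v) (wev1 v)) (big_morph G GM G1).
  apply: eq_bigr => j _; rewrite rmorphXn.
  elim: (m j) => [|l IH]; first by rewrite !expr0 G1 wev1.
  rewrite (exprS (pi _)) (exprS (mpolyX R _)).
  by rewrite GM IH wevM GX wevX mweight1 vmon1.
apply: dual_ext => a; rewrite -[a]pliftK.
have [ik|ik] := leqP i k; last by rewrite big// pcrv_big.
rewrite !dual_pi_sum; apply: eq_bigr => m _; congr (_ * _).
by rewrite pcrvE -Gmon GE.
Qed.

                                                                         
(** For weight at most k, the functional dual to the monomial m, written by interpolation as a
    combination of members of curves at grid points. This form shows that curves span the coalgebra;
    for weight above k it is 0. *)
Definition pco m : dual A :=
  \sum_q grid_co m q *: (pcrv (grid_pt q) (mweight w m) : dual A).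

Lemma pcoE m p : (mweight w m <= k)%N -> pco m (pi p) = mcoeff m p.
Proof.
move=> mk; rewrite dual_sumE -[RHS](grid_wev p mk).
by apply: eq_bigr => q _; rewrite -pcrvE.
Qed.

Lemma dual_pco (f : multinom n -> R) p :
  (forall m, (k < mweight w m)%N -> f m = 0) ->
  (\sum_(m : mon_index) f m *: pco m) (pi p) = \sum_(m <- msupp p) mcoeff m p * f m.
Proof.
move=> f0; rewrite dual_sumE /=.
have E (m : mon_index) : (f m *: pco m : dual A) (pi p) = mcoeff m p * f m.
  rewrite [LHS]/=; have [mk|mk] := leqP (mweight w m) k; last by rewrite f0 ?mul0r ?mulr0.
  by rewrite pcoE// mulrC.
rewrite (eq_bigr _ (fun (m : mon_index) _ => E m)).
rewrite (eq_bigr (fun m : mon_index => \sum_(m' <- msupp p | m' == m :> multinom n)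
    mcoeff m' p * f m')) => [|m _]; last first.
  rewrite big_mkcond; have [ms|ms] := boolP ((m : multinom n) \in msupp p); last first.
    rewrite big1_seq => [|m' /= m's].
      by move: ms; rewrite -mcoeff_eq0 => /eqP ->; rewrite mul0r.
    by case: eqP => // m'm; rewrite m'm (negPf ms) in m's.
  rewrite (bigD1_seq (m : multinom n))//= ?msupp_uniq// eqxx big1 ?addr0// => m'.
  by move=> /negPf ->.
rewrite (exchange_big_dep xpredT)//=; apply: eq_bigr => m' _.
have [mk|mk] := leqP (mweight w m') k; last first.
  by rewrite big1 => [|m]; rewrite f0 ?mulr0.
(* A monomial of weight at most k has degree at most k, hence occurs in the index type, exactly
   once. *)
have m'I : (mdeg m' < k.+1)%N.
  rewrite ltnS (leq_trans _ mk) // mdegE leq_sum // => j _.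
  by rewrite leq_pmulr.
rewrite (bigD1 (BMultinom m'I))//= big1 ?addr0// => m /andP[/eqP m'm].
by case/negP; rewrite -val_eqE /= m'm.
Qed.

Lemma dual_expand c : c = \sum_(m : mon_index) c (pi (mpolyX R m)) *: pco m.
Proof.
apply: dual_ext => a; rewrite -[a]pliftK.
rewrite (@dual_pco (fun m => c (pi (mpolyX R m)))) => [|m mk]; first exact: dual_pi_sum.
by rewrite pres_mon_big// dual0.
Qed.

(** The coordinates of a curve in the family [pco] are monomials in v or 0; the smoothness of maps
    defined through curves rests on this. *)
Lemma pcrv_expand v i : (pcrv v i : dual A) =
  \sum_(m : mon_index) (vmon v m * ((mweight w m == i) && (i <= k)%N)%:R) *: pco m.
Proof.
rewrite {1}(dual_expand (pcrv v i)); apply: eq_bigr => m _; congr (_ *: _).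
by rewrite pcrvE wevX eps_coefZ eps_powE.
Qed.

End Pres.

Section Transfer.
Variables (A A' : galg R).
Variables (pi : {lrmorphism mpoly n R -> A}) (pi' : {lrmorphism mpoly n R -> A'}).
Hypotheses (piP : weil_pres pi) (piP' : weil_pres pi').

                                                                     
                                                                              
                        
(** Two algebras presented by the same weights have isomorphic duals: c is moved to the functional
    taking [pi p] to c (f p). The argument [f] is a bare function, so that families which are
    morphisms only over an open set can be plugged in; the result is linear in c in any case. *)
Definition ptr (f : mpoly n R -> A') (c : dual A') : dual A :=
  \sum_(m : mon_index) c (f (mpolyX R m)) *: pco piP m.

Lemma ptrE c p : ptr pi' c (pi p) = c (pi' p).
Proof.
rewrite /ptr (@dual_pco _ _ piP (fun m => c (pi' (mpolyX R m)))) => [|m mk].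
  by rewrite [RHS]dual_pi_sum.
by rewrite (pres_mon_big piP' mk) dual0.
Qed.

Lemma ptr_linear (f : mpoly n R -> A') a c d :
  ptr f (a *: c + d) = a *: ptr f c + ptr f d.
Proof.
rewrite /ptr scaler_sumr -big_split; apply: eq_bigr => m _ /=.
by rewrite scalerDl scalerA.
Qed.

Lemma ptr_hom : coalg_hom (ptr pi' : gdual A' -> gdual A).
Proof.
have [_ _ deg] := piP; have [_ _ deg'] := piP'.
split=> [a u v|i c ci j a ji /deg[p hp <-]|c|c s cs a b].
- exact: ptr_linear.
- by rewrite ptrE; apply: (ci j) => //; apply/deg'; exists p.
- by rewrite -[LHS]/(ptr pi' c 1) -(rmorph1 pi) ptrE rmorph1.
- rewrite big_map /= -(pliftK piP a) -(pliftK piP b) -rmorphM ptrE rmorphM -cs.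
  by apply: eq_bigr => p _; rewrite !ptrE.
Qed.

End Transfer.

Lemma ptrK (A A' : galg R) (pi : {lrmorphism mpoly n R -> A})
  (pi' : {lrmorphism mpoly n R -> A'}) (piP : weil_pres pi) (piP' : weil_pres pi') :
  cancel (ptr piP pi') (ptr piP' pi).
Proof.
by move=> c; apply: dual_ext => a; rewrite -(pliftK piP' a) !ptrE.
Qed.

Lemma ptr_iso (A A' : galg R) (pi : {lrmorphism mpoly n R -> A})
  (pi' : {lrmorphism mpoly n R -> A'}) (piP : weil_pres pi) (piP' : weil_pres pi') :
  coalg_iso (ptr piP pi' : gdual A' -> gdual A).
Proof.
exists (ptr piP' pi); split; [exact: ptrK|exact: ptrK|exact: ptr_hom|exact: ptr_hom].
Qed.

(** Both sides read off the eps^i coefficient of the evaluation at v, whichever algebra is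
    presented: the transfer acts as the identity on the parameters of curves. *)
Lemma ptr_pcrv (A A' : galg R) (pi : {lrmorphism mpoly n R -> A})
  (pi' : {lrmorphism mpoly n R -> A'}) (piP : weil_pres pi) (piP' : weil_pres pi') v i :
  ptr piP pi' (pcrv piP' v i) = pcrv piP v i.
Proof.
apply: dual_ext => a; rewrite -(pliftK piP a); apply: etrans (ptrE piP piP' _ _) _.
by apply: etrans (pcrvE piP' _ _ _) _; apply/esym; exact: pcrvE.
Qed.

Lemma ptr_pco (A A' : galg R) (pi : {lrmorphism mpoly n R -> A})
  (pi' : {lrmorphism mpoly n R -> A'}) (piP : weil_pres pi) (piP' : weil_pres pi') m :
  ptr piP pi' (pco piP' m) = pco piP m.
Proof.
rewrite /pco; elim/big_rec2: _ => [|q y1 y2 _ <-].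
  by rewrite /ptr big1// => m' _; rewrite scale0r.
by rewrite ptr_linear ptr_pcrv.
Qed.

End WeilCurves.

                                  

(** * Fibres of a graded bundle as truncated polynomial algebras *)

Section Fibres.
Variables (R : realType) (k : nat) (F : gbundle R k).
Implicit Types (x : base F) (y z : F).

Lemma gb_manifold : is_manifold F. Proof. by case: (gb_axioms F). Qed.

Lemma base_manifold : is_manifold (base F). Proof. by case: (gb_axioms F). Qed.

Lemma gactM s t y : gact t (gact s y) = gact (t * s) y.
Proof. by have [_ [_ aM _] _ _] := gb_axioms F. Qed.

Lemma gact_smooth t : smooth_map (@gact R F t).
Proof.
have [_ [_ _ /smooth_mapP sa] _ _] := gb_axioms F.
apply/smooth_mapP => y.
rewrite (_ : @gact R F t = (fun z : prod_space (euclid R 1) F => gact (z.1 0 0) z.2) \o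
    (fun z => (const_mx t, z) : prod_space (euclid R 1) F)); last first.
  by apply: funext => z /=; rewrite mxE.
apply: smooth_at_comp (sa _).
apply: (smooth_at_pair gb_manifold); last exact: smooth_at_id.
exact: (smooth_at_cst gb_manifold).
Qed.

Lemma proj_smooth : smooth_map (@proj R F).
Proof.
apply/smooth_mapP => y; apply: smooth_at_sub; first exact: manifold_local gb_manifold.
by have /smooth_mapP := gact_smooth 0; exact.
Qed.

Lemma proj_val x : proj (val x : F) = x.
Proof.
by apply: val_inj => /=; case: x => /= y /set_mem[z _ <-]; rewrite gactM mul0r.
Qed.

Lemma proj_act t y : proj (gact t y) = proj y.
Proof. by apply: val_inj => /=; rewrite gactM mul0r. Qed.

                                                                                      
(** A total map into the fibre over x that carries no proof argument; a point lying over another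
    base point is replaced by the base point [val x] itself. *)
Definition fpt x z : fiber x :=
  match pselect (proj z = x) with
  | left e => exist _ z (mem_set e)
  | right _ => exist _ (val x) (mem_set (proj_val x))
  end.

Lemma fptE x z : proj z = x -> val (fpt x z) = z.
Proof. by rewrite /fpt; case: pselect. Qed.

Lemma fiberP x (u : fiber x) : proj (val u) = x.
Proof. by case: u => z /= /set_mem. Qed.

Lemma hom_G_ext x (a b : hom_G x) : (forall u : fiber x, a u = b u) -> a = b.
Proof. by move=> ab; apply: val_inj; apply: funext. Qed.

Lemma hom_G_linE x c (a b : hom_G x) (u : fiber x) : (c *: a + b) u = c *: a u + b u.
Proof. by []. Qed.

Lemma hom_G_0E x (u : fiber x) : (0 : hom_G x) u = 0.
Proof. exact: scale0r. Qed.

Lemma section_fpt (a : forall x, hom_G x) z x : proj z = x ->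
  a (proj z) (in_fiber z) = a x (fpt x z).
Proof.
move=> e; case: _ / e; congr (a _ _); apply: val_inj.
by rewrite fptE.
Qed.

End Fibres.

Lemma sm_at_wev (R : realType) (X : smooth_space R) k n (w : 'I_n -> nat)
    (c : X -> 'rV[R]_n) p i x : is_manifold X ->
  (forall j, sm_at x (fun y => c y 0 j)) ->
  sm_at x (fun y => eps_coef (wev k w (c y) p) i).
Proof.
move=> mX sc; have [ik|ik] := leqP i k; last first.
  by under eq_fun do rewrite eps_coef_big//; exact: sm_at_cst.
under eq_fun do rewrite wev_coef// big_mkcond.
apply: (sm_at_sum mX) => m; case: eqP => _; last exact: sm_at_cst.
apply: (sm_atM mX (f := cst (mcoeff m p))); first exact: sm_at_cst.
by apply: (sm_at_prod mX) => j; exact: (sm_at_exp mX).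
Qed.

Definition gb_triv (R : realType) k (F : gbundle R k) n (w : 'I_n -> nat)
    (U : set (base F)) (phi : F -> prod_space (base F) (euclid R n)) psi : Prop :=
  [/\ @local_diffeo R F (prod_space (base F) (euclid R n))
        (@proj R F @^-1` U) (U `*` setT) phi psi,
      forall y, U (proj y) -> (phi y).1 = proj y &
      forall t y, U (proj y) ->
        phi (gact t y) = (proj y, weight_act w t (phi y).2)].

Section Triv.
Variables (R : realType) (k : nat) (F : gbundle R k).
Variables (n : nat) (w : 'I_n -> nat).
Hypothesis wP : weights_upto k w.
Variables (U : set (base F)) (phi : F -> prod_space (base F) (euclid R n)).
Variable psi : prod_space (base F) (euclid R n) -> F.
Hypothesis tr : gb_triv w U phi psi.
Implicit Types (x : base F) (y z : F) (v : 'rV[R]_n).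

Let mF := gb_manifold F.
Let mB := base_manifold F.
Let w0 j : (0 < w j)%N. Proof. by case/andP: (wP j). Qed.

Definition coord y : 'rV[R]_n := (phi y).2.

Lemma triv_open : open U.
Proof.
have [[oU _ _ _ _] _ _] := tr.
have -> : U = (val : base F -> F) @^-1` (@proj R F @^-1` U).
  by apply/seteqP; split=> x /=; rewrite proj_val.
by apply: open_comp oU => x _; have [] := sub_space_val x.
Qed.

Lemma psi_proj x v : U x -> proj (psi (x, v)) = x.
Proof.
move=> Ux; have [[_ _ _ VU _] phi1 _] := tr.
by have [Up E] := VU (x, v) (conj Ux I); rewrite -phi1// E.
Qed.

Lemma psi_coord x v : U x -> coord (psi (x, v)) = v.
Proof.
move=> Ux; have [[_ _ _ VU _] phi1 _] := tr.
by have [Up E] := VU (x, v) (conj Ux I); rewrite /coord E.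
Qed.

Lemma psiK y : U (proj y) -> psi (proj y, coord y) = y.
Proof.
move=> Uy; have [[_ _ UV _ _] phi1 _] := tr.
have [_ E] := UV y Uy; rewrite -[RHS]E; congr psi.
by rewrite -phi1// /coord -surjective_pairing.
Qed.

Lemma coord_act t y : U (proj y) -> coord (gact t y) = weight_act w t (coord y).
Proof. by move=> Uy; have [_ _ E] := tr; rewrite /coord E. Qed.

Lemma psi_act x t v : U x -> gact t (psi (x, v)) = psi (x, weight_act w t v).
Proof.
move=> Ux; have pE := psi_proj v Ux.
by rewrite -[LHS]psiK ?proj_act ?coord_act ?pE// psi_coord.
Qed.

Lemma coord_smooth y j : U (proj y) -> sm_at y (fun z => coord z 0 j).
Proof.
move=> Uy; have [d _ _] := tr.
have [_ s] := local_diffeo_smooth (@prod_space_local _ _ _) d Uy.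
have [_ s2] := smooth_at_snd (phi y).
by apply: (s (fun u => u.2 0 j)); apply: (s2 (fun r => r 0 j)); exact: euclid_sm_coord.
Qed.

Lemma psi_smooth x v : U x -> smooth_at psi (x, v).
Proof. by move=> Ux; have [d _ _] := tr; apply: local_diffeo_smooth_inv d _; split. Qed.

Lemma psi_smoothl x v : U x -> smooth_at (fun b => psi (b, v)) x.
Proof.
move=> Ux; apply: (smooth_at_comp (f := fun b => (b, v) : prod_space (base F) (euclid R n))).
  by apply: (smooth_at_pair mB); [exact: smooth_at_id|exact: (smooth_at_cst mB)].
exact: psi_smooth.
Qed.

Lemma psi_smoothr x v : U x -> @smooth_at R (euclid R n) F (fun u => psi (x, u)) v.
Proof.
move=> Ux; have mE := euclid_manifold R n.
apply: (smooth_at_comp (f := fun u : euclid R n => (x, u) : prod_space (base F) (euclid R n))).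
  by apply: (smooth_at_pair mE); [exact: (smooth_at_cst mE)|exact: smooth_at_id].
exact: psi_smooth.
Qed.

                                                
(** A polynomial in the fibre coordinates is an equivariant map by [wev_act]. The family is defined
    over the whole base, with [insubd] returning 0 where the formula fails to be equivariant, so
    that it can serve as a section; only its values over [U] are exposed. *)
Fact fib_poly_spec : {f : forall x, mpoly n R -> hom_G x |
  forall x, U x -> forall p (y : fiber x), f x p y = wev k w (coord (val y)) p}.
Proof.
exists (fun x p => insubd (0 : hom_G x) (fun y : fiber x => wev k w (coord (val y)) p)).
move=> x Ux p y; rewrite -[LHS]/(val (insubd _ _) y) val_insubd ifT//.
apply/asboolP; split=> [i u|t u u' E].
  exists (fun z => eps_coef (wev k w (coord z) p) i); last exact: (@nearW _ (nbhs u)).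
  apply: (@sm_at_wev _ F _ _ _ coord) => [|j]; first exact: mF.
  by apply: coord_smooth; rewrite fiberP.
by rewrite E coord_act ?wev_act// fiberP.
Qed.

Definition fib_poly := sval fib_poly_spec.

Section AtPoint.
Variables (x : base F) (Ux : U x).
Local Notation P := (fib_poly x).

Lemma fib_polyE p (y : fiber x) : P p y = wev k w (coord (val y)) p.
Proof. exact: (svalP fib_poly_spec). Qed.

Lemma fib_poly_linear : linear P.
Proof.
move=> a p q; apply: hom_G_ext => y.
rewrite hom_G_linE.
by rewrite !fib_polyE wevD wevZ.
Qed.

Lemma fib_poly_mult : monoid_morphism P.
Proof.
split=> [|p q]; apply: hom_G_ext => y.
  by rewrite fib_polyE wev1 hom_G_1E.
by rewrite hom_G_mulE (fib_polyE (_ * _)) (fib_polyE p) (fib_polyE q) wevM.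
Qed.

Definition fib_pres : {lrmorphism mpoly n R -> hom_G_galg x} :=
  HB.pack P (GRing.isLinear.Build R (mpoly n R) (hom_G x) _ P fib_poly_linear)
            (GRing.isMonoidMorphism.Build (mpoly n R) (hom_G x) P fib_poly_mult).

Lemma fib_presE p : fib_pres p = P p. Proof. by []. Qed.

Lemma fpt_val (y : fiber x) : fpt x (psi (x, coord (val y))) = y.
Proof.
apply: val_inj; rewrite fptE; last exact: psi_proj.
by rewrite -{1}(fiberP y) psiK// fiberP.
Qed.

(** In fibre coordinates the eps^i coefficient of an equivariant map is a smooth homogeneous
    function of weight i, so [homog_poly] applies. *)
Lemma fib_homog (a : hom_G x) i : exists2 p, whomog w i p &
  forall y : fiber x, eps_coef (a y) i = meval (fun j => coord (val y) 0 j) p.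
Proof.
have [sa ea] := hom_GP a.
pose g v := eps_coef (a (fpt x (psi (x, v)))) i.
have sg : smooth_on setT g.
  move=> v _; suff : @sm_at R (euclid R n) v g by exact: nbhs_singleton.
  have [_ s] : @smooth_at R (euclid R n) (fiber x) (fun u => fpt x (psi (x, u))) v.
    apply: smooth_at_sub; first exact: euclid_local.
    rewrite (_ : _ \o _ = fun u => psi (x, u)); first exact: psi_smoothr.
    by apply: funext => u /=; rewrite fptE// psi_proj.
  exact: (s (fun u : fiber x => eps_coef (a u) i) (sa i _)).
have hg t v : g (weight_act w t v) = t ^+ i * g v.
  rewrite /g -eps_coef_act; congr eps_coef; apply: ea.
  by rewrite !fptE ?psi_proj// psi_act.
have [p hp gE] := homog_poly w0 sg hg.
exists p => // y; rewrite -gE /g; congr (eps_coef (a _) i).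
by rewrite fpt_val.
Qed.

(** Surjectivity: add up the polynomials of [fib_homog] for the weights 0, ..., k. Kernel: every v
    is the coordinate of a point of the fibre, so [wev_eq0] applies. *)
Lemma fib_presP : weil_pres k w fib_pres.
Proof.
split=> [a|p|i a].
- have ex i := fib_homog a i.
  pose q i := s2val (cid2 (ex i)).
  exists (\sum_(i < k.+1) q i); apply: hom_G_ext => y.
  rewrite [LHS]fib_polyE wev_sum; apply: eps_eq => l.
  rewrite eps_coef_sum; have [lk|lk] := leqP l k; last first.
    rewrite [RHS](eps_coef_big _ lk) big1// => i _.
    by rewrite [LHS](eps_coef_big _ lk).
  rewrite (bigD1 (Ordinal (lk : l < k.+1)%N))//= big1 => [|i il]; rewrite /q.
    case: (cid2 (ex l)) => p hp gE /=.
    by rewrite (wev_homog _ _ hp) eps_coefZ eps_powE eqxx lk mulr1 addr0 -gE.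
  case: (cid2 (ex i)) => p hp gE /=; rewrite (wev_homog _ _ hp) eps_coefZ eps_powE.
  by move: il; rewrite -val_eqE /= => /negPf ->; rewrite mulr0.
- rewrite -(wev_eq0 wP); split=> [p0 v|p0]; last first.
    apply: hom_G_ext => y; rewrite [LHS]fib_polyE p0.
    by rewrite hom_G_0E.
  have := congr1 (fun a : hom_G x => a (fpt x (psi (x, v)))) p0.
  rewrite fib_presE fib_polyE fptE ?psi_proj// psi_coord// => ->.
  by rewrite hom_G_0E.
- split=> [ai|[p hp <-] y]; last first.
    by exists (meval (fun j => coord (val y) 0 j) p); rewrite fib_presE fib_polyE (wev_homog _ _ hp).
  have [p hp aE] := fib_homog a i; exists p => //.
  apply: hom_G_ext => y; rewrite [LHS]fib_polyE (wev_homog _ _ hp) -aE.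
  have [r ar] := ai y; rewrite -[RHS]/(a y) ar eps_coefZ eps_powE eqxx.
  (* For i > k the power eps^i is zero, and both sides vanish. *)
  have [ik|ik] := leqP i k; first by rewrite mulr1.
  apply: eps_eq => l; rewrite !eps_coefZ eps_powE; case: eqP => [<-|_]; rewrite ?mulr0//.
  by rewrite leqNgt ik !mulr0.
Qed.

End AtPoint.
End Triv.

                                    

(** * The dual coalgebra bundle and well-definedness of the functor *)

Lemma linear_map_sum (R : realType) (V W : lmodType R) (f : V -> W)
    (I : Type) (r : seq I) (P : pred I) (a : I -> R) (u : I -> V) :
  (forall c x y, f (c *: x + y) = c *: f x + f y) ->
  f (\sum_(i <- r | P i) a i *: u i) = \sum_(i <- r | P i) a i *: f (u i).
Proof.
move=> fl; have f0 : f 0 = 0.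
  by have := fl (-1) 0 0; rewrite scaler0 add0r scaleN1r addNr.
by elim/big_rec2: _ => // i y1 y2 _ <-; rewrite fl.
Qed.

Lemma linear_mapZ (R : realType) (V W : lmodType R) (f : V -> W) c x :
  (forall c x y, f (c *: x + y) = c *: f x + f y) -> f (c *: x) = c *: f x.
Proof.
move=> fl; have f0 : f 0 = 0.
  by have := fl (-1) 0 0; rewrite scaler0 add0r scaleN1r addNr.
by rewrite -[c *: x]addr0 fl f0 addr0.
Qed.

Lemma hom_G_sumE (R : realType) k (F : gbundle R k) (x : base F) (u : fiber x)
    (I : Type) (r : seq I) (a : I -> R) (f : I -> hom_G x) :
  (\sum_(i <- r) a i *: f i) u = \sum_(i <- r) a i *: f i u.
Proof. exact: (linear_map_sum (f := fun a : hom_G x => a u)). Qed.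

Section TrivAtlas.
Variables (R : realType) (k : nat) (F : gbundle R k).
Variables (n : nat) (w : 'I_n -> nat).
Hypothesis wP : weights_upto k w.
Variables (U : set (base F)) (phi : F -> prod_space (base F) (euclid R n)).
Variable psi : prod_space (base F) (euclid R n) -> F.
Hypothesis tr : gb_triv w U phi psi.
Implicit Types (x : base F) (y z : F) (v : 'rV[R]_n) (m : multinom n).

Let mF := gb_manifold F.
Let mB := base_manifold F.
Local Notation P := (fib_poly tr).
Local Notation presP Ux := (fib_presP wP tr Ux).

(** Every element of the fibre algebra is a polynomial in the coordinates, so evaluation at the
    point y is the curve whose parameter is the coordinate of y. *)
Lemma pcrv_coord x (Ux : U x) (y : fiber x) i (a : hom_G x) :
  (pcrv wP (presP Ux) (coord phi (val y)) i : dual (hom_G x)) a = eps_coef (a y) i.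
Proof.
rewrite -(pliftK (presP Ux) a); apply: etrans (pcrvE _ _ _ _ _) _.
by rewrite fib_presE fib_polyE.
Qed.

Lemma pcrv_fpt x (Ux : U x) v i (a : hom_G x) :
  (pcrv wP (presP Ux) v i : dual (hom_G x)) a = eps_coef (a (fpt x (psi (x, v)))) i.
Proof.
have := pcrv_coord Ux (fpt x (psi (x, v))) i a.
by rewrite (fptE (psi_proj tr v Ux)) (psi_coord tr v Ux).
Qed.

Lemma near_proj y (V : set (base F)) : open V -> V (proj y) -> \forall z \near y, V (proj z).
Proof.
move=> oV Vy; have [cp _] : smooth_at (@proj R F) y.
  by have /smooth_mapP := proj_smooth F; exact.
by apply: cp; exact: open_nbhs_nbhs.
Qed.

Lemma sm_at_proj y g : sm_at (proj y) g -> sm_at y (g \o @proj R F).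
Proof. by have [_ s] := proj_smooth F; exact: s. Qed.

Lemma section_eval_smooth (V : set (base F)) (a : forall x, hom_G x) x v i :
  smooth_section V a -> U x -> V x ->
  sm_at x (fun b => eps_coef (a b (fpt b (psi (b, v)))) i).
Proof.
move=> sa Ux Vx; have [_ s] := psi_smoothl tr v Ux.
have sE : sm_at x (fun b => eps_coef (a (proj (psi (b, v))) (in_fiber (psi (b, v)))) i).
  apply: (s (fun z => eps_coef (a (proj z) (in_fiber z)) i)).
  by apply: sa; rewrite (psi_proj tr).
apply: (sm_at_near mB) sE.
apply: open_nearW (triv_open tr) Ux _ => b Ub.
by rewrite (section_fpt a (psi_proj tr v Ub)).
Qed.

(** By interpolation [pco m] combines, with constant coefficients, evaluations at the points whose
    coordinates lie on the grid, and such points move smoothly with the base point. *)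
Lemma pco_section_smooth (V : set (base F)) (a : forall x, hom_G x) x m
    (c : forall x, dual (hom_G x)) :
  (forall b (Ub : U b), c b = pco wP (presP Ub) m) ->
  smooth_section V a -> U x -> V x -> sm_at x (fun b => c b (a b)).
Proof.
move=> cE sa Ux Vx.
apply: (sm_at_near mB (f := fun b => \sum_(q : grid k n) grid_co R m q *
    eps_coef (a b (fpt b (psi (b, grid_pt R q)))) (mweight w m))).
  apply: open_nearW (triv_open tr) Ux _ => b Ub; rewrite cE dual_sumE.
  by apply: eq_bigr => q _; rewrite -(pcrv_fpt Ub).
apply: (sm_at_sum mB) => q; apply: (sm_atM mB (f := cst (grid_co R m q))).
  exact: sm_at_cst.
exact: section_eval_smooth sa Ux Vx.
Qed.

Lemma fib_poly_section p : smooth_section U (fun x => P x p).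
Proof.
move=> z Uz i.
apply: (sm_at_near mF (f := fun z => eps_coef (wev k w (coord phi z) p) i)).
  by apply: filterS (near_proj (triv_open tr) Uz) => y Uy; rewrite fib_polyE.
by apply: (@sm_at_wev _ F _ _ _ (coord phi)) => // j; exact: (coord_smooth tr).
Qed.

Section Model.
Variables (A : galg R) (pi : {lrmorphism mpoly n R -> A}).
Hypothesis piP : weil_pres k w pi.

Definition triv_map x : gdual (hom_G_galg x) -> gdual A :=
  @ptr _ _ _ _ wP A (hom_G_galg x) pi piP (P x).

Lemma triv_map_iso x : U x -> coalg_iso (@triv_map x).
Proof. by move=> Ux; exact: (@ptr_iso _ _ _ _ wP A (hom_G_galg x) pi (fib_pres tr Ux) piP (presP Ux)). Qed.

Lemma triv_mapE x (c : dual (hom_G x)) p : U x ->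
  (triv_map c : dual A) (pi p) = c (P x p).
Proof. by move=> Ux; exact: (@ptrE _ _ _ _ wP A (hom_G_galg x) pi (fib_pres tr Ux) piP (presP Ux)). Qed.

(** A section that is constant in this chart has constant coefficients in the frame [pco], and each
    [pco m] pairs smoothly with smooth sections. *)
Lemma triv_atlas : @cb_atlas R (circ_ob F) (gdual A) U triv_map.
Proof.
split=> [||c s sE V a oV sa x Ux Vx]; [exact: triv_open tr|exact: triv_map_iso|].
(* The frame extended by 0 outside [U], to have a section defined everywhere. *)
pose co m x : dual (hom_G x) := if pselect (U x) is left Ux then pco wP (presP Ux) m else 0.
have coE m b (Ub : U b) : co m b = pco wP (presP Ub) m.
  by rewrite /co; case: pselect => // Ub'; congr (pco wP (presP _) m).
apply: (sm_at_near mB (f := fun b =>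
  \sum_(m : mon_index k n) (c : dual A) (pi (mpolyX R m)) * co m b (a b))).
  apply: open_nearW (triv_open tr) Ux _ => b Ub.
  rewrite (dual_expand wP (presP Ub) (s b)) dual_sumE.
  apply: eq_bigr => m _ /=; rewrite coE -(sE b Ub) triv_mapE//.
apply: (sm_at_sum mB) => m.
apply: (sm_atM mB (f := cst ((c : dual A) (pi (mpolyX R m))))); first exact: sm_at_cst.
exact: pco_section_smooth (coE m) sa Ux Vx.
Qed.

End Model.

                                                                                
                                                                               
                         
(** The atlas only asks that constant sections pair smoothly with smooth sections. This is a
    statement about the inverses of the charts; to control a chart itself, the matrix of a constant
    frame against the monomials is inverted near x by Cramer's rule. *)
Lemma atlas_repr (C : gcoalg R) (W : set (base F))
    (chi : forall x, gdual (hom_G_galg x) -> C) (l : dual C) x :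
  @cb_atlas R (circ_ob F) C W chi -> U x -> W x ->
  exists V (a : forall x, hom_G x), [/\ open V, V x, V `<=` W, smooth_section V a &
    forall b, V b -> forall c : dual (hom_G b), l (chi b c) = c (a b)].
Proof.
move=> [oW isoW consW] Ux Wx.
(* Restricting to weight at most k makes the [pco] a basis and the matrix below square and
   invertible at x. *)
pose J := [pred m : mon_index k n | (mweight w m <= k)%N].
pose N := #|J|; pose e (i : 'I_N) : multinom n := val (enum_val i : mon_index k n).
have ek i : (mweight w (e i) <= k)%N by have := enum_valP i.
have eI i j : (e i == e j) = (i == j).
  by rewrite /e (inj_eq val_inj) (inj_eq enum_val_inj).
have expand b (Ub : U b) (c : dual (hom_G b)) :
    c = \sum_i c (P b (mpolyX R (e i))) *: pco wP (presP Ub) (e i).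
  rewrite {1}(dual_expand wP (presP Ub) c) (bigID J) /= [X in _ + X]big1 ?addr0 => [|m].
    rewrite -(big_enum_val (A := J) (fun m : mon_index k n =>
      c (P b (mpolyX R m)) *: pco wP (presP Ub) m)) /=.
    by apply: eq_bigl.
  rewrite -ltnNge => /(pres_mon_big (presP Ub)) E.
  by rewrite [X in c X]E (dual0 c) scale0r.
pose cc p : C := chi x (pco wP (presP Ux) (e p)).
have exs p b : exists u : dual (hom_G b), W b -> chi b u = cc p.
  have [Wb|nWb] := pselect (W b); last by exists 0.
  by have [g [_ gK _ _]] := isoW b Wb; exists (g (cc p)).
pose s p b : dual (hom_G b) := projT1 (cid (exs p b)).
have sE p b : W b -> chi b (s p b) = cc p by rewrite /s; case: cid.
(* The constant sections through the basis [pco] at x, paired with the monomial sections: smooth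
   near x, and the identity matrix at x. *)
pose M b : 'M[R]_N := \matrix_(p, j) s p b (P b (mpolyX R (e j))).
have sM b p j : U b -> W b -> sm_at b (fun b => M b p j).
  move=> Ub Wb; under eq_fun do rewrite mxE.
  exact: (consW (cc p) (s p) (sE p)) (triv_open tr) (fib_poly_section _) b Wb Ub.
have M1 : M x = 1%:M.
  apply/matrixP => p j; rewrite !mxE.
  have -> : s p x = pco wP (presP Ux) (e p).
    have [g [gK _ _ _]] := isoW x Wx; apply: (can_inj gK); exact: sE.
  apply: etrans (pcoE wP (presP Ux) (mpolyX R (e j)) (ek p)) _.
  by rewrite mcoeffX eI eq_sym.
have sdet b : U b -> W b -> sm_at b (fun b => \det (M b)).
  by move=> Ub Wb; apply: (sm_at_det mB) => p j; exact: sM.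
have : \forall b \near x, U b /\ (W b /\ \det (M b) != 0).
  have nU : \forall b \near x, U b by apply: open_nbhs_nbhs; split=> //; exact: triv_open tr.
  have nW : \forall b \near x, W b by exact: open_nbhs_nbhs.
  have nd : \forall b \near x, \det (M b) != 0.
    have cd := sm_at_continuous mB (sdet x Ux Wx).
    apply: (cd [set r | r != 0]).
    apply: open_nbhs_nbhs; split; first exact: open_neq.
    by rewrite /= M1 det1 oner_neq0.
  by apply: filterS3 nU nW nd => b; do !split.
move=> /near_open[V [oV Vx VP]].
(* The value of l on the image of the j-th [pco]: row j of the inverse of M applied to the constants
   l (cc p). *)
pose mu (j : 'I_N) b : R := \sum_p ((\det (M b))^-1 * (\adj (M b)) j p) * l (cc p).
exists V, (fun b => \sum_j mu j b *: P b (mpolyX R (e j))); split=> //.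
- by move=> b /VP[_ []].
- move=> y Vy i; have [Uy [Wy dy]] := VP _ Vy.
  apply: (sm_at_near mF (f := fun z => \sum_j mu j (proj z) *
    eps_coef (P (proj z) (mpolyX R (e j)) (in_fiber z)) i)).
    apply: (@nearW _ (nbhs y)) => z.
    rewrite hom_G_sumE eps_coef_sum; apply: eq_bigr => j _; exact: eps_coefZ.
  apply: (sm_at_sum mF) => j; apply: (sm_atM mF); last exact: fib_poly_section.
  apply: (@sm_at_proj y (mu j)); apply: (sm_at_sum mB) => p.
  apply: (sm_atM mB); last exact: sm_at_cst.
  apply: (sm_atM mB); first by apply: (sm_at_inv mB) => //; exact: sdet.
  under eq_fun do rewrite mxE /cofactor.
  apply: (sm_atM mB); first exact: sm_at_cst.
  apply: (sm_at_det mB) => p' m'; under eq_fun do rewrite 2!mxE.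
  exact: sM.
move=> b /VP[Ub [Wb db]] c.
have chiL : forall r (u u' : dual (hom_G b)), chi b (r *: u + u') = r *: chi b u + chi b u'.
  by have [g [_ _ [h _ _ _] _]] := isoW b Wb.
have lchi (u : 'I_N -> dual (hom_G b)) (r : 'I_N -> R) :
    l (chi b (\sum_i r i *: u i)) = \sum_i r i * l (chi b (u i)).
  by rewrite (linear_map_sum _ _ _ _ chiL) dual_linear_sum.
rewrite [in LHS](expand b Ub c) lchi dual_linear_sum /=.
apply: eq_bigr => j _; rewrite mulrC; congr (_ * _).
have -> : pco wP (presP Ub) (e j) =
    \sum_p ((\det (M b))^-1 * (\adj (M b)) j p) *: s p b.
  rewrite [RHS](eq_bigr (fun p => \sum_q (((\det (M b))^-1 * (\adj (M b)) j p) * M b p q) *: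
      pco wP (presP Ub) (e q))); last first.
    move=> p _; rewrite {1}(expand b Ub (s p b)) scaler_sumr.
    by apply: eq_bigr => q _; rewrite scalerA; congr (_ * _ *: _); rewrite mxE.
  have K q : \sum_p (((\det (M b))^-1 * (\adj (M b)) j p) * M b p q) = (j == q)%:R.
    under eq_bigr => p _ do rewrite -mulrA.
    have /matrixP/(_ j q) := mul_adj_mx (M b).
    rewrite !mxE -mulr_sumr => ->.
    by rewrite -[X in _ * X]mulr_natr mulrA mulVf// mul1r.
  rewrite exchange_big /= (bigD1 j)//= [X in _ + X]big1 ?addr0 => [|q qj].
    by apply: etrans (scaler_suml _ _ _ _); rewrite K eqxx scale1r.
  by apply: etrans (esym (scaler_suml _ _ _ _)) _; rewrite K eq_sym (negPf qj) scale0r.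
by rewrite lchi; apply: eq_bigr => p _; rewrite sE.
Qed.

End TrivAtlas.

Section CircIsFunctor.
Variables (R : realType) (k : nat).

Lemma gb_trivP (F : gbundle R k) : exists n (w : 'I_n -> nat), weights_upto k w /\
  forall x : base F, exists U phi psi, U x /\ @gb_triv R k F n w U phi psi.
Proof.
have [_ _ _ [n [w [wP tr]]]] := gb_axioms F; exists n, w; split=> // x.
by have [U [phi [psi [Ux d p a]]]] := tr x; exists U, phi, psi.
Qed.

Lemma weil_pres_free n (w : 'I_n -> nat) (A : galg R)
    (pi : {lrmorphism mpoly n R -> A}) :
  weights_upto k w -> weil_pres k w pi -> free_weil_alg k A.
Proof. by move=> wP piP; exists n, w; split=> //; exists pi. Qed.

(** The algebra R itself, presented on no generators; it serves as typical fibre when the base is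
    empty. *)
Lemma free_weil_exists : exists A : galg R, free_weil_alg k A.
Proof.
pose A : galg R := @GAlg R R^o (fun i a => i = 0%N \/ a = 0).
pose ev (p : mpoly 0 R) : R^o := mcoeff mnm0 p.
have evL : linear ev by move=> a p q; rewrite /ev mcoeffD mcoeffZ.
have evM : monoid_morphism ev.
  by have [M one] := mcoeff0_is_multiplicative 0 R.
pose pi : {lrmorphism mpoly 0 R -> A} :=
  HB.pack ev (GRing.isLinear.Build R (mpoly 0 R) R^o _ ev evL)
            (GRing.isMonoidMorphism.Build (mpoly 0 R) R^o ev evM).
have w0 (m : multinom 0) : mweight (fun=> 1%N) m = 0%N by rewrite /mweight big_ord0.
have pC (p : mpoly 0 R) : p = mpolyC 0 (ev p).
  apply/mpolyP => m; have -> : m = mnm0 by apply/mnmP; case.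
  by rewrite mcoeffC eqxx mulr1.
have pi0 : pi 0 = 0 := raddf0 pi.
have msupp_nil (p : mpoly 0 R) : (forall m, m \in msupp p -> False) -> p = 0.
  by move=> pk; apply: msuppnil0; case: (msupp p) pk => // m s /(_ m); rewrite mem_head => /(_ isT).
exists A; apply: (@weil_pres_free 0 (fun=> 1%N) A pi); first by case.
split=> [a|p|i a].
- by exists (mpolyC 0 a); rewrite -[LHS]/(mcoeff _ _) mcoeffC eqxx mulr1.
- split=> [p0 m|pk]; last by rewrite (msupp_nil p) => // m /pk; rewrite w0.
  by rewrite (pC p) [ev p]p0 mpolyC0 msupp0.
split=> [[->|->]|[p hp <-]].
- by exists (mpolyC 0 a) => [m _|]; [exact: w0|rewrite -[LHS]/(mcoeff _ _) mcoeffC eqxx mulr1].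
- by exists 0 => // m; rewrite msupp0.
have [->|i0] := eqVneq i 0%N; [by left|right].
by rewrite (msupp_nil p) => // m /hp; rewrite w0 => i0'; rewrite -i0' eqxx in i0.
Qed.

Lemma circ_repr (F : gbundle R k) (C : gcoalg R) (W : set (base F))
    (chi : forall x, gdual (hom_G_galg x) -> C) (l : dual C) x :
  @cb_atlas R (circ_ob F) C W chi -> W x ->
  exists V (a : forall x, hom_G x), [/\ open V, V x, V `<=` W, smooth_section V a &
    forall b, V b -> forall c : dual (hom_G b), l (chi b c) = c (a b)].
Proof.
move=> at_ Wx; have [n [w [wP /(_ x)[U [phi [psi [Ux tr]]]]]]] := gb_trivP F.
exact: (atlas_repr wP tr l at_ Ux Wx).
Qed.

(** For transitions, [circ_repr] turns a functional in the second chart into the pairing with a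
    smooth section, and sections constant in the first chart pair smoothly by definition of the
    atlas. The typical algebra is the one at any chosen base point. *)
Lemma circ_obP (F : gbundle R k) : is_fgwcb k (circ_ob F).
Proof.
split; first exact: base_manifold.
- by move=> C U phi [].
- move=> C U phi C' U' phi' [_ _ cst] at' c l s sE x Ux /= Ux'.
  have [V [a [oV Vx VU sa aE]]] := circ_repr l at' Ux'.
  apply: (sm_at_near (base_manifold F) (f := fun y => s y (a y))).
    by apply: open_nearW oV Vx _ => y Vy; exact: aE.
  exact: cst sE V a oV sa x Ux Vx.
have [n [w [wP tr]]] := gb_trivP F.
have [[x0 _]|emp] := pselect (exists x0 : base F, True); last first.
  have [A Af] := free_weil_exists; exists A; split=> // x.
  by case: emp; exists x.
have [U0 [phi0 [psi0 [Ux0 tr0]]]] := tr x0.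
have piP := fib_presP wP tr0 Ux0.
exists (hom_G_galg x0); split; first exact: weil_pres_free wP piP.
move=> x; have [U [phi [psi [Ux trx]]]] := tr x.
by exists U, (triv_map wP trx piP); split=> //; exact: triv_atlas.
Qed.

Section Mor.
Variables (F E : gbundle R k) (f : gb_hom F E).

Lemma base_map_smooth : smooth_map (base_map f).
Proof.
apply/smooth_mapP => x; apply: smooth_at_sub; first exact: sub_space_local.
apply: (smooth_at_comp (f := val : base F -> F)); first exact: sub_space_val.
by have /smooth_mapP := gb_smooth f; exact.
Qed.

Lemma hom_G_pullM (b : base F -> base E) (bE : forall x, val (b x) = f (val x)) x
    (a a' : hom_G (b x)) :
  hom_G_pull bE (a * a') = hom_G_pull bE a * hom_G_pull bE a'.
Proof. exact: hom_G_ext. Qed.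

Lemma hom_G_pull1 (b : base F -> base E) (bE : forall x, val (b x) = f (val x)) x :
  hom_G_pull bE (1 : hom_G (b x)) = 1.
Proof.
by apply: hom_G_ext => u; rewrite hom_G_1E; exact: (hom_G_1E (fiber_map bE u)).
Qed.

Lemma dual_pull_hom (b : base F -> base E) (bE : forall x, val (b x) = f (val x)) x :
  coalg_hom (@dual_pull R k F E f b bE x : gdual (hom_G_galg x) -> gdual (hom_G_galg (b x))).
Proof.
split=> [a u v|i c ci j a ji aj|c|c s cs a a'].
- exact: dual_ext.
- by apply: (ci j) => // y; exact: aj.
- by rewrite -[LHS]/(c (hom_G_pull bE 1)) hom_G_pull1.
- rewrite big_map -[RHS]/(c (hom_G_pull bE (a * a'))) hom_G_pullM -cs.
  by apply: eq_bigr.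
Qed.

(** As for transitions, with the representing section on the target pulled back along f; the dual
    map makes the two pairings equal. *)
Lemma circ_morP : is_cb_hom (circ_mor f).
Proof.
have sb := base_map_smooth.
have [cb sb'] := sb.
split=> [||C U phi C' U' phi' [oU _ cst] at' c l s sE x Ux Ux']; [by []|by move=> x; exact: dual_pull_hom|].
have [V [a [oV Vx VU sa aE]]] := circ_repr l at' Ux'.
pose bE (y : base F) : val (base_map f y) = f (val y) := erefl.
pose a' (y : base F) : hom_G y := hom_G_pull bE (a (base_map f y)).
have oV' : open (base_map f @^-1` V) by apply: open_comp oV => y _; exact: cb.
have sa' : smooth_section (base_map f @^-1` V) a'.
  move=> z Vz i.
  have pE (u : F) : proj (f u) = base_map f (proj u).
    by apply: val_inj; rewrite /= gb_equiv.
  have [_ sf] := gb_smooth f.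
  apply: (sm_at_near (gb_manifold F) (f := (fun u => eps_coef (a (proj u) (in_fiber u)) i) \o f)).
    apply: (@nearW _ (nbhs z)) => u /=.
    rewrite (section_fpt a (pE u)); congr (eps_coef (a _ _) i).
    by apply: val_inj; rewrite fptE.
  by apply: sf; apply: sa; rewrite pE.
apply: (sm_at_near (base_manifold F) (f := fun y => s y (a' y))).
  apply: open_nearW oV' Vx _ => y Vy.
  exact: (aE _ Vy (dual_pull (b := base_map f) bE (s y))).
exact: cst sE _ a' oV' sa' x Ux Vx.
Qed.

End Mor.
End CircIsFunctor.

                                      

(** * Points as curves: the functor is full and faithful *)

Section FibreCurves.
Variables (R : realType) (k : nat).

Section OneBundle.
Variable F : gbundle R k.
Implicit Types (x : base F).

Lemma fevP x (y : fiber x) i r (a b : hom_G x) :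
  eps_coef ((r *: a + b) y) i = r * eps_coef (a y) i + eps_coef (b y) i.
Proof. by rewrite hom_G_linE eps_coefD eps_coefZ. Qed.

Definition fev x (y : fiber x) i : gdual (hom_G_galg x) := mk_dual (fevP y i).

Lemma fev_curve x (y : fiber x) : is_curve k (fev y).
Proof.
split=> [i j a ji /(_ y)[r ar]||i ik a b].
- by rewrite -[LHS]/(eps_coef (a y) i) ar eps_coefZ eps_powE (negPf ji) mulr0.
- by rewrite -[LHS]/(eps_coef ((1 : hom_G x) y) 0) hom_G_1E eps_coef1.
rewrite big_map big_iota_ord -[RHS]/(eps_coef ((a * b : hom_G x) y) i).
by rewrite hom_G_mulE eps_coefM.
Qed.

Lemma fev_inj x (y y' : fiber x) : (forall i, fev y i = fev y' i) -> y = y'.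
Proof.
move=> yy; have [n [w [wP /(_ x)[U [phi [psi [Ux tr]]]]]]] := gb_trivP F.
have E (u : fiber x) i : fev u i = pcrv wP (fib_presP wP tr Ux) (coord phi (val u)) i.
  by apply: dual_ext => a; apply/esym; exact: pcrv_coord.
have /pcrv_inj cE : forall i, pcrv wP (fib_presP wP tr Ux) (coord phi (val y)) i =
    pcrv wP (fib_presP wP tr Ux) (coord phi (val y')) i by move=> i; rewrite -!E.
by rewrite -(fpt_val tr Ux y) -(fpt_val tr Ux y') cE.
Qed.

(** The coordinate form is [curve_pcrv]. With [fev_inj], the points of a fibre are exactly the
    curves of its coalgebra. *)
Lemma curve_fev x (g : nat -> gdual (hom_G_galg x)) : is_curve k g ->
  exists y : fiber x, forall i, g i = fev y i.
Proof.
have [n [w [wP /(_ x)[U [phi [psi [Ux tr]]]]]]] := gb_trivP F.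
move=> /(curve_pcrv wP (fib_presP wP tr Ux))[v gE].
exists (fpt x (psi (x, v))) => i; rewrite gE; apply: dual_ext => a.
exact: pcrv_fpt.
Qed.

(** Finite dimension: the family [pco] spans the dual, so L is recovered from its values there and
    the corresponding monomials. *)
Lemma double_dual x (L : dual (dual (hom_G x))) :
  exists a : hom_G x, forall c, L c = c a.
Proof.
have [n [w [wP /(_ x)[U [phi [psi [Ux tr]]]]]]] := gb_trivP F.
exists (\sum_(m : mon_index k n) L (pco wP (fib_presP wP tr Ux) m) *: fib_poly tr x (mpolyX R m)).
move=> c; rewrite {1}(dual_expand wP (fib_presP wP tr Ux) c) !dual_linear_sum.
by apply: eq_bigr => m _; rewrite mulrC.
Qed.

Lemma fib_act_proof t x (y : fiber x) : proj (gact t (val y)) = x.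
Proof. by rewrite proj_act fiberP. Qed.

Definition fib_act t x (y : fiber x) : fiber x := exist _ (gact t (val y)) (mem_set (fib_act_proof t y)).

Lemma fev_act t x (y : fiber x) i : fev (fib_act t y) i = t ^+ i *: (fev y i : dual (hom_G x)).
Proof.
apply: dual_ext => a; have [_ ea] := hom_GP a.
by rewrite [LHS]/= (ea t y) // eps_coef_act.
Qed.

(** The inverse of y -> [fev y]; a sequence that is not a curve is sent to the base point. *)
Definition curve_pt x (g : nat -> gdual (hom_G_galg x)) : fiber x :=
  if pselect (exists y : fiber x, forall i, g i = fev y i) is left e
  then projT1 (cid e) else fpt x (val x).

Lemma fev_curve_pt x (g : nat -> gdual (hom_G_galg x)) i :
  is_curve k g -> fev (curve_pt g) i = g i.
Proof.
move=> /curve_fev gc; rewrite /curve_pt; case: pselect => // e.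
by case: cid => y /= ->.
Qed.

Lemma curve_pt_fev x (y : fiber x) : curve_pt (fev y) = y.
Proof. by apply: fev_inj => i; rewrite fev_curve_pt//; exact: fev_curve. Qed.

End OneBundle.

Definition point_map (F E : gbundle R k) (Phi : cb_map (circ_ob F) (circ_ob E))
    (x : base F) (y : fiber x) : fiber (Phi x : base E) :=
  @curve_pt E (Phi x) (fun i => @cm_fib _ _ _ Phi x (fev y i)).

(** The dual of pulling back along f sends evaluation at z to evaluation at f z, so f is the map
    that its image under the functor induces on curves. *)
Lemma circ_faithful (F E : gbundle R k) (f g : gb_hom F E) :
  circ_mor f = circ_mor g -> f = g.
Proof.
have pE (h : gb_hom F E) z : h z = val (point_map (circ_mor h) (in_fiber z)).
  rewrite /point_map (_ : (fun i => _) = fev (fiber_map (b := base_map h) (fun=> erefl) (in_fiber z))).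
    by rewrite curve_pt_fev.
  by apply: funext => i; apply: dual_ext.
by move=> fg; apply: gb_hom_eq; apply: funext => z; rewrite !pE fg.
Qed.

Section Full.
Variables (F E : gbundle R k) (Phi : cb_map (circ_ob F) (circ_ob E)).
Hypothesis PhiP : is_cb_hom Phi.
Local Notation fx := (point_map Phi).

Lemma fev_point_map (x : base F) (y : fiber x) i :
  fev (fx y) i = @cm_fib _ _ _ Phi x (fev y i).
Proof.
have [_ /(_ x) hPhi _] := PhiP.
by rewrite fev_curve_pt//; exact: coalg_hom_curve hPhi (fev_curve y).
Qed.

Definition total_map (z : F) : E := val (fx (in_fiber z)).

Lemma total_map_val (x : base F) (y : fiber x) : total_map (val y) = val (fx y).
Proof.
have gen z (e : proj z = x) (u : fiber x) : val u = z -> total_map z = val (fx u).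
  case: _ / e u => u uz; rewrite /total_map; congr (val (fx _)).
  by apply: val_inj; rewrite uz.
exact: gen (fiberP y) _ erefl.
Qed.

Lemma proj_total_map z : proj (total_map z) = Phi (proj z).
Proof. by rewrite /total_map fiberP. Qed.

(** The action multiplies the i-th member of a curve by t^i, which the linear fibre maps of [Phi]
    preserve; [fev_inj] concludes. *)
Lemma total_map_act t z : total_map (gact t z) = gact t (total_map z).
Proof.
have [_ /(_ (proj z))[hL _ _ _] _] := PhiP.
rewrite -[gact t z]/(val (fib_act t (in_fiber z))) total_map_val.
suff -> : fx (fib_act t (in_fiber z)) = fib_act t (fx (in_fiber z)) by [].
apply: fev_inj => i; rewrite fev_point_map fev_act.
rewrite (linear_mapZ _ _ hL) -fev_point_map; apply/esym; exact: fev_act.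
Qed.

(** In coordinates the map is a finite sum of monomials in the fibre coordinates of z, with matrix
    coefficients of [Phi] as coefficients; the latter are smooth on the base. *)
Lemma total_map_smooth : smooth_map total_map.
Proof.
have [sPhi hPhi cPhi] := PhiP; have /smooth_mapP sPhi' := sPhi.
have mF := gb_manifold F; have mB := base_manifold F.
apply/smooth_mapP => z.
have [n [w [wP /(_ (proj z))[U [phi [psi [Ux tr]]]]]]] := gb_trivP F.
have [n' [w' [wP' /(_ (Phi (proj z)))[U' [phi' [psi' [Ux' tr']]]]]]] := gb_trivP E.
have nU : \forall y \near z, U (proj y) /\ U' (Phi (proj y)).
  have oW : open (U `&` Phi @^-1` U').
    apply: openI (triv_open tr) _; apply: open_comp (triv_open tr') => b _.
    by have [] := sPhi' b.
  by have := @near_proj _ _ F z _ oW; apply.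
pose c y := coord phi' (total_map y).
apply: (@smooth_at_near R F E (fun y => psi' (Phi (proj y), c y))).
- exact: manifold_local.
- apply: filterS nU => y [_ Uy']; rewrite -proj_total_map /c (psiK tr')//.
  by rewrite proj_total_map.
apply: (smooth_at_comp (f := fun y => (Phi (proj y), c y) : prod_space (base E) (euclid R n'))
  (g := psi')); last exact: (psi_smooth tr').
apply: (smooth_at_pair mF).
  apply: (smooth_at_comp (f := @proj R F)); last exact: sPhi'.
  by have /smooth_mapP := proj_smooth F; exact.
apply: (smooth_at_row mF) => j.
pose pA := fib_presP wP tr Ux; pose pA' := fib_presP wP' tr' Ux'.
pose Xj := mpolyX R (mnm1 j).
pose co (m : mon_index k n) (b : base F) : dual (hom_G b) :=
  if pselect (U b) is left Ub then pco wP (fib_presP wP tr Ub) m else 0.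
(* The coefficient of [Phi] between the frame element [pco m] and the j-th generator of the target
   algebra. *)
pose h m (b : base F) : R :=
  (@cm_fib _ _ _ Phi b (co m b) : dual (hom_G (Phi b : base E))) (fib_poly tr' (Phi b) Xj).
have coE m b (Ub : U b) : co m b = pco wP (fib_presP wP tr Ub) m.
  by rewrite /co; case: pselect => // Ub'; congr (pco wP (fib_presP wP tr _) m).
have coA m b : U b -> triv_map wP tr pA (co m b) = pco wP pA m.
  by move=> Ub; rewrite coE; exact: (ptr_pco wP pA (fib_presP wP tr Ub)).
have sh m : sm_at (proj z) (h m).
  have evP r (u u' : dual (hom_G (Phi (proj z) : base E))) :
      (r *: u + u') (fib_pres tr' Ux' Xj) =
      r * u (fib_pres tr' Ux' Xj) + u' (fib_pres tr' Ux' Xj) by [].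
  have := cPhi _ _ _ _ _ _ (triv_atlas wP tr pA) (triv_atlas wP' tr' pA')
    (pco wP pA m) (mk_dual evP) (co m) (coA m) (proj z) Ux Ux'.
  apply: (sm_at_near mB).
  have oW : open (U `&` Phi @^-1` U').
    apply: openI (triv_open tr) _; apply: open_comp (triv_open tr') => b _.
    by have [] := sPhi' b.
  apply: open_nearW oW (conj Ux Ux') _ => b [Ub Ub'].
  by apply/esym; exact: triv_mapE.
apply: (sm_at_near mF (f := fun y => \sum_(m : mon_index k n)
   (vmon (coord phi y) m * ((mweight w m == w' j) && (w' j <= k)%N)%:R) * h m (proj y))).
  apply: filterS nU => y [Uy Uy'].
  have E1 : c y 0 j = fev (fx (in_fiber y)) (w' j) (fib_poly tr' (Phi (proj y)) Xj).
    rewrite /= fib_polyE// wevX mweight1 vmon1 eps_coefZ eps_powE eqxx.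
    by case/andP: (wP' j) => _ ->; rewrite mulr1.
  rewrite E1 fev_point_map.
  have -> : fev (in_fiber y) (w' j) = \sum_(m : mon_index k n)
      (vmon (coord phi y) m * ((mweight w m == w' j) && (w' j <= k)%N)%:R) *:
      (co m (proj y) : gdual (hom_G_galg (proj y))).
    under eq_bigr => m _ do rewrite (coE m _ Uy).
    apply: etrans (pcrv_expand wP (fib_presP wP tr Uy) _ _).
    by apply: dual_ext => a; apply/esym; exact: (pcrv_coord wP tr Uy (in_fiber y)).
  have [hL _ _ _] := hPhi (proj y).
  by rewrite (linear_map_sum _ _ _ _ hL) dual_sumE.
apply: (sm_at_sum mF) => m; apply: (sm_atM mF); last exact: (@sm_at_proj _ _ F z (h m)).
apply: (sm_atM mF); last exact: sm_at_cst.
apply: (sm_at_prod mF) => l; apply: (sm_at_exp mF); exact: (coord_smooth tr).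
Qed.

Definition full_hom : gb_hom F E := GbHom total_map_smooth total_map_act.

(** Base maps agree because base points are the images of h_0. Fibre maps agree because their
    transposes do, and elements of the fibre algebra are separated by evaluations. *)
Lemma full_homE : circ_mor full_hom = Phi.
Proof.
have bE (x : base F) : val (Phi x : base E) = full_hom (val x).
  have E1 : (val x : F) = gact 0 (val x) by rewrite -{1}(proj_val x).
  rewrite /= E1 total_map_act -[RHS]/(val (proj (total_map (val x)))) proj_total_map.
  by rewrite proj_val.
rewrite /circ_mor (circ_map_irr _ bE).
have : forall (x : base F) (c : dual (hom_G x)), dual_pull bE c = @cm_fib _ _ _ Phi x c.
  move=> x c; apply: dual_ext => a.
  have [_ /(_ x)[hL _ _ _] _] := PhiP.
  have LP r (u u' : dual (hom_G x)) :
      (@cm_fib _ _ _ Phi x (r *: u + u') : dual (hom_G (Phi x : base E))) a =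
      r * (@cm_fib _ _ _ Phi x u : dual _) a + (@cm_fib _ _ _ Phi x u' : dual _) a.
    by rewrite hL.
  (* By reflexivity c -> Phi c a is the pairing with some a'; evaluation at each point shows that a'
     is the pullback of a. *)
  have [a' aE] := double_dual (mk_dual LP).
  rewrite -[RHS]/(mk_dual LP c) aE -[LHS]/(c (hom_G_pull bE a)); congr (c _).
  apply: hom_G_ext => u; apply: eps_eq => i.
  rewrite -[RHS]/((fev u i : dual _) a') -aE.
  rewrite -[RHS]/((@cm_fib _ _ _ Phi x (fev u i) : dual (hom_G (Phi x : base E))) a).
  rewrite -fev_point_map -[LHS]/(eps_coef (a (fiber_map bE u)) i).
  rewrite -[RHS]/(eps_coef (a (fx u)) i); congr (eps_coef (a _) i).
  by apply: val_inj; rewrite /= total_map_val.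
move: bE; rewrite /circ_map; case: (Phi) => b fib /= bE fE.
congr CBMap; apply: functional_extensionality_dep => x; apply: funext => c.
exact: fE.
Qed.

End Full.
End FibreCurves.

                                 

(** * Gluing a graded bundle from a cocycle *)

Lemma manifold_of_charts (R : realType) (X Y : smooth_space R) : local_sm X ->
  hausdorff_space X -> @second_countable X -> is_manifold Y ->
  (forall x : X, exists (U : set X) (V : set Y) phi psi,
     U x /\ local_diffeo U V phi psi) -> is_manifold X.
Proof.
move=> lX hX bX mY cX; have [_ _ [n cY]] := mY.
split=> //; exists n => x.
have [U [V [phi [psi [Ux d]]]]] := cX x; have [oU oV UV VU [cphi cpsi _]] := d.
have [U' [V' [phi' [psi' [Ux' d']]]]] := cY (phi x).
have [oU' oV' UV' VU' [cphi' cpsi' _]] := d'.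
exists (U `&` phi @^-1` U'), (V' `&` psi' @^-1` V), (phi' \o phi), (psi \o psi').
split; first by split.
have on (S T : topologicalType) (A : set S) (B : set T) (f : S -> T) :
    open A -> open B -> (forall s, A s -> {for s, continuous f}) -> open (A `&` f @^-1` B).
  move=> oA oB cf; rewrite openE => s [As Bs]; apply: filterI; first exact: open_nbhs_nbhs.
  by apply: cf => //; exact: open_nbhs_nbhs.
apply: local_diffeo_intro; [exact: lX|exact: on|exact: on| | | |].
- move=> y [Uy Uy']; have [Vy yE] := UV _ Uy; have [Vy' yE'] := UV' _ Uy'.
  by rewrite /= /preimage /= yE' yE.
- move=> y [Vy Vy']; have [Uy yE] := VU' _ Vy; have [Uy' yE'] := VU _ Vy'.
  by rewrite /= /preimage /= yE' yE.
- move=> y [Uy Uy']; apply: smooth_at_comp.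
    exact: local_diffeo_smooth (manifold_local mY) d Uy.
  exact: local_diffeo_smooth (@euclid_local _ _) d' Uy'.
- move=> y [Vy Vy']; apply: smooth_at_comp.
    exact: local_diffeo_smooth_inv d' Vy.
  exact: local_diffeo_smooth_inv d Vy'.
Qed.

                                                                             
                                                                            
                            
(** Gluing without a quotient: the total space is the set of pairs (b, v), and [co_h x b] passes
    from the reference coordinate over b to the coordinate of the chart at x. The reference
    coordinates may jump from fibre to fibre, so smoothness in b is asked of the transitions between
    charts. *)
Record cocycle (R : realType) := Cocycle {
  co_base : smooth_space R;
  co_manifold : is_manifold co_base;
  co_n : nat;
  co_w : 'I_co_n -> nat;
  co_w0 : forall j, (0 < co_w j)%N;
  co_dom : co_base -> set co_base;
  co_open : forall x, open (co_dom x);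
  co_domx : forall x, co_dom x x;
  co_h : co_base -> co_base -> 'rV[R]_co_n -> 'rV[R]_co_n;
  co_h' : co_base -> co_base -> 'rV[R]_co_n -> 'rV[R]_co_n;
  co_hK : forall x b, co_dom x b -> cancel (co_h x b) (co_h' x b);
  co_h'K : forall x b, co_dom x b -> cancel (co_h' x b) (co_h x b);
  co_act : forall x b t v, co_dom x b ->
    co_h x b (weight_act co_w t v) = weight_act co_w t (co_h x b v);
  co_smooth : forall x y b v j, co_dom x b -> co_dom y b ->
    @sm_at R (prod_space co_base (euclid R co_n)) (b, v)
      (fun u => co_h x u.1 (co_h' y u.1 u.2) 0 j) }.

Section Glue.
Variables (R : realType) (D : cocycle R).
Local Notation B := (co_base D).
Local Notation n := (co_n D).
Local Notation w := (@co_w R D).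
Local Notation dom := (@co_dom R D).
Local Notation h := (@co_h R D).
Local Notation h' := (@co_h' R D).
Local Notation Y := (prod_space B (euclid R n)).

Definition glue_pts : Type := (B * 'rV[R]_n)%type.

Definition gchart (x : B) (z : glue_pts) : Y := (z.1, h x z.1 z.2).
Definition gchart_inv (x : B) (u : Y) : glue_pts := (u.1, h' x u.1 u.2).
Definition gdom (x : B) : set Y := dom x `*` setT.

                                                
(** The topology induced by the charts, not the product topology of the pairs. *)
Definition glue_open (P : set glue_pts) : Prop :=
  forall x, open (gdom x `&` gchart_inv x @^-1` P).

Lemma gdom_open x : open (gdom x).
Proof. by apply: open_setX; [exact: co_open|exact: openT]. Qed.

Lemma glue_openT : glue_open setT.
Proof. by move=> x; rewrite preimage_setT setIT; exact: gdom_open. Qed.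

Lemma glue_openI : setI_closed glue_open.
Proof. by move=> P Q oP oQ x; rewrite preimage_setI setIIr; exact: openI. Qed.

Lemma glue_open_bigU (I : Type) (f : I -> set glue_pts) :
  (forall i, glue_open (f i)) -> glue_open (\bigcup_i f i).
Proof.
move=> of_ x; rewrite preimage_bigcup setI_bigcupr.
by apply: bigcup_open => i _; exact: of_.
Qed.

HB.instance Definition _ := Choice.copy glue_pts (B * 'rV[R]_n)%type.
HB.instance Definition _ :=
  isOpenTopological.Build glue_pts glue_openT glue_openI glue_open_bigU.

Definition glue : smooth_space R :=
  @SmoothSpace R glue_pts (fun z f => sm_at (gchart z.1 z) (f \o gchart_inv z.1)).

Let mB := co_manifold D.
Let mY : is_manifold Y := prod_manifold mB (euclid_manifold R n).
Implicit Types (x y : B) (z : glue) (u : Y).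

Lemma gchartK x z : dom x z.1 -> gchart_inv x (gchart x z) = z.
Proof. by case: z => b v /= xb; rewrite /gchart_inv /gchart /= co_hK. Qed.

Lemma gchart_invK x u : gdom x u -> gchart x (gchart_inv x u) = u.
Proof. by case: u => b v [/= xb _]; rewrite /gchart_inv /gchart /= co_h'K. Qed.

Lemma transition_smooth x y u : gdom x u -> gdom y u ->
  smooth_at (gchart x \o gchart_inv y : Y -> Y) u.
Proof.
case: u => b v [/= xb _] [/= yb _]; apply: (smooth_at_pair mY); first exact: smooth_at_fst.
by apply: (smooth_at_row mY) => j; exact: co_smooth.
Qed.

Lemma glue_openE (P : set glue) : open P <-> forall x, open (gdom x `&` gchart_inv x @^-1` P).
Proof. by []. Qed.

Lemma gchart_inv_continuous x u : gdom x u -> {for u, continuous (gchart_inv x : Y -> glue)}.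
Proof.
move=> xu Q; rewrite nbhsE => -[P [/glue_openE/(_ x) oP uP] PQ].
have : nbhs u (gdom x `&` gchart_inv x @^-1` P) by exact: open_nbhs_nbhs.
by apply: filterS => u' [_ /PQ].
Qed.

Lemma gchart_open x (A : set Y) : open A -> open ([set z : glue | dom x z.1 /\ A (gchart x z)]).
Proof.
move=> oA; apply/glue_openE => y; rewrite openE => u [yu [xu Au]].
have xu' : gdom x u by split.
have [c _] := transition_smooth xu' yu.
have n1 : nbhs u (gdom y `&` gdom x) by apply: open_nbhs_nbhs; split=> //; apply: openI; exact: gdom_open.
have n2 : nbhs u ((gchart x \o gchart_inv y) @^-1` A) by apply: c; exact: open_nbhs_nbhs.
by apply: filterS2 n1 n2 => u' [yu' [xu'' _]] Au'; split.
Qed.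

Lemma gchart_continuous x z : dom x z.1 -> {for z, continuous (gchart x : glue -> Y)}.
Proof.
move=> xz A; rewrite nbhsE => -[A' [oA' zA'] A'A].
have : nbhs z [set z : glue | dom x z.1 /\ A' (gchart x z)].
  by apply: open_nbhs_nbhs; split; [exact: gchart_open|split].
by apply: filterS => z' [_ /A'A].
Qed.

(** The structure of [glue] tests smoothness at z in the chart of its own base point; smooth
    transitions make every other chart around z equally good. *)
Lemma glue_smE x z f : dom x z.1 ->
  sm_at z f <-> @sm_at R Y (gchart x z) (f \o gchart_inv x).
Proof.
move=> xz.
have key y y' : dom y z.1 -> dom y' z.1 ->
    @sm_at R Y (gchart y z) (f \o gchart_inv y) ->
    @sm_at R Y (gchart y' z) (f \o gchart_inv y').
  move=> yz y'z s.
  have yd : gdom y (gchart y' z) by split.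
  have y'd : gdom y' (gchart y' z) by split.
  have [_ st] := transition_smooth yd y'd.
  have E : (gchart y \o gchart_inv y') (gchart y' z) = gchart y z.
    by rewrite /comp (gchartK y'z).
  have : @sm_at R Y (gchart y' z) ((f \o gchart_inv y) \o (gchart y \o gchart_inv y')).
    by apply: st; rewrite E.
  apply: (sm_at_near mY).
  have yy : (gdom y `&` gdom y') (gchart y' z) by split.
  have oyy := openI (@gdom_open y) (@gdom_open y').
  suff H u : (gdom y `&` gdom y') u ->
      (f \o gchart_inv y') u = ((f \o gchart_inv y) \o (gchart y \o gchart_inv y')) u.
    exact: (open_nearW oyy yy H).
  by move=> [[yu _] y'u]; rewrite /comp (gchartK (x := y) (z := gchart_inv y' u)).
by split; apply: key => //; exact: co_domx.
Qed.

Lemma glue_local : local_sm glue.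
Proof.
move=> z f g fg; apply: (sm_at_near mY).
have zz : gdom z.1 (gchart z.1 z) by split; [exact: co_domx|].
have c : gchart_inv z.1 @ gchart z.1 z --> gchart_inv z.1 (gchart z.1 z).
  exact: gchart_inv_continuous zz.
by rewrite gchartK in c; [exact: (c _ fg)|exact: co_domx].
Qed.

Lemma gchart_smooth x z : dom x z.1 -> smooth_at (gchart x : glue -> Y) z.
Proof.
move=> xz; split; first exact: gchart_continuous.
move=> g sg; apply/(glue_smE _ xz); apply: (sm_at_near mY) sg.
have xz' : gdom x (gchart x z) by split.
by apply: open_nearW (@gdom_open x) xz' _ => u xu /=; rewrite gchart_invK.
Qed.

Lemma gchart_inv_smooth x u : gdom x u -> smooth_at (gchart_inv x : Y -> glue) u.
Proof.
move=> xu; split; first exact: gchart_inv_continuous.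
have xu1 : dom x (gchart_inv x u).1 by case: xu.
by move=> g; rewrite (glue_smE _ xu1) gchart_invK.
Qed.

Lemma gchart_diffeo x :
  @local_diffeo R glue Y [set z | dom x z.1] (gdom x) (gchart x) (gchart_inv x).
Proof.
apply: local_diffeo_intro; first exact: glue_local.
- have := gchart_open (x := x) (@openT Y); congr open.
  by apply/seteqP; split=> z //= -[].
- exact: gdom_open.
- by move=> z xz; split; [split|rewrite gchartK].
- by move=> u xu; split; [case: xu|exact: gchart_invK].
- exact: gchart_smooth.
- exact: gchart_inv_smooth.
Qed.

Lemma glue_fst_smooth : smooth_map (fst : glue -> B).
Proof.
apply/smooth_mapP => z.
have := smooth_at_comp (gchart_smooth (co_domx (z.1 : B))) (smooth_at_fst (gchart z.1 z)).
exact.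
Qed.

(** Points over distinct base points are separated in the base; points over the same one lie in a
    common chart. *)
Lemma glue_hausdorff : hausdorff_space glue.
Proof.
move=> z z' zz'.
have [hB _ _] := mB; have [hY _ _] := mY; have [c1 _] := glue_fst_smooth.
have E : z.1 = z'.1 := hB _ _ (cluster_map (c1 z) (c1 z') zz').
have d : dom z.1 z.1 by exact: co_domx.
have d' : dom z.1 z'.1 by rewrite -E.
have := hY _ _ (cluster_map (gchart_continuous d) (gchart_continuous d') zz').
by move=> /(congr1 (gchart_inv z.1)); rewrite !gchartK.
Qed.

(** Charts are indexed by all points of the base, but countably many suffice: one for each basic
    open set of the base that fits into some chart domain. *)
Lemma glue_second_countable : @second_countable glue.
Proof.
have [_ bB _] := mB; have [_ bY _] := mY.
move: bB bY => /second_countable_seq[b [ob bP]] /second_countable_seq[q [oq qP]].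
(* The chart attached to the i-th basic open set, or [None] if no chart domain contains that set. *)
have ex i : exists x : option B, forall y, b i `<=` dom y -> exists2 x', x = Some x' & b i `<=` dom x'.
  have [[x bx]|nx] := pselect (exists x, b i `<=` dom x).
    by exists (Some x) => y _; exists x.
  by exists None => y by_; case: nx; exists y.
pose X i := projT1 (cid (ex i)).
have XP i := projT2 (cid (ex i)).
pose W (ij : nat * nat) : set glue :=
  if X ij.1 is Some x then [set z : glue | dom x z.1 /\ (q ij.2 `&` (b ij.1 `*` setT)) (gchart x z)]
  else set0.
apply: (@second_countable_intro _ _ W) => [[i j]|z A zA].
  rewrite /W /=; case: (X i) => [x|]; last exact: open0.
  apply: (gchart_open (x := x) (A := q j `&` (b i `*` setT))).
  by apply: openI => //; apply: open_setX => //; exact: openT.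
have [i bi bd] : exists2 i, b i z.1 & b i `<=` dom z.1.
  by apply: bP; apply: open_nbhs_nbhs; split; [exact: co_open|exact: co_domx].
have [x Xx bx] : exists2 x', X i = Some x' & b i `<=` dom x' := XP i z.1 bd.
have xz : dom x z.1 by exact: bx.
have xz' : gdom x (gchart x z) by split.
have : nbhs (gchart x z) (gchart_inv x @^-1` A).
  by apply: gchart_inv_continuous => //; rewrite gchartK.
move=> /qP[j qz qA]; exists (i, j); rewrite /W [X _]Xx.
  by split=> //; split=> //; split.
move=> z' [xz1 [qz' _]]; rewrite -(gchartK xz1); exact: qA.
Qed.

Lemma glue_manifold : is_manifold glue.
Proof.
apply: (manifold_of_charts glue_local glue_hausdorff glue_second_countable mY) => z.
exists [set z' : glue | dom z.1 z'.1], (gdom z.1), (gchart z.1), (gchart_inv z.1).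
by split; [exact: co_domx|exact: gchart_diffeo].
Qed.

End Glue.

Section GlueBundle.
Variables (R : realType) (D : cocycle R).
Local Notation B := (co_base D).
Local Notation n := (co_n D).
Local Notation w := (@co_w R D).
Local Notation dom := (@co_dom R D).
Local Notation Y := (prod_space B (euclid R n)).
Let mB : is_manifold B := co_manifold D.
Let mE : is_manifold (euclid R n) := euclid_manifold R n.
Let mY : is_manifold Y := prod_manifold mB mE.
Let mG : is_manifold (glue D) := glue_manifold D.
Implicit Types (x b : B) (z : glue D).

Definition glue_act (t : R) (z : glue D) : glue D := (z.1, weight_act w t z.2).

Definition glue_gspace : gspace R := @GSpace R (glue D) glue_act.

Lemma gchart_act x t z : dom x z.1 ->
  gchart x (glue_act t z) = (z.1, weight_act w t (gchart x z).2).
Proof. by move=> xz; rewrite /gchart /= co_act. Qed.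

Lemma glue_act_eq x t z : dom x z.1 ->
  glue_act t z = gchart_inv x (z.1, weight_act w t (gchart x z).2).
Proof. by move=> xz; rewrite -gchart_act// gchartK. Qed.

Lemma glue_act1 z : glue_act 1 z = z.
Proof. by case: z => b v; rewrite /glue_act weight_act1. Qed.

Lemma glue_actM s t z : glue_act t (glue_act s z) = glue_act (t * s) z.
Proof. by rewrite /glue_act /= weight_actA. Qed.

Lemma near_dom x z : dom x z.1 -> \forall z' \near z, dom x z'.1.
Proof.
move=> xz; have [c _] := glue_fst_smooth D.
by apply: (c z); apply: open_nbhs_nbhs; split=> //; exact: co_open.
Qed.

Lemma gchart_coord_smooth x z j : dom x z.1 -> sm_at z (fun z' => (gchart x z').2 0 j).
Proof.
move=> xz; have [_ s] := smooth_at_comp (gchart_smooth xz) (smooth_at_snd _).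
by apply: (s (fun r : euclid R n => r 0 j)); exact: euclid_sm_coord.
Qed.

Lemma glue_act_smooth :
  @smooth_map R (prod_space (euclid R 1) (glue D)) (glue D)
    (fun u => glue_act (u.1 0 0) u.2).
Proof.
have mP : is_manifold (prod_space (euclid R 1) (glue D)).
  by apply: prod_manifold mG; exact: euclid_manifold.
apply/smooth_mapP => -[t z]; pose x : B := z.1.
have xz : dom x z.1 := co_domx _.
have s2 := smooth_at_snd ((t, z) : prod_space (euclid R 1) (glue D)).
have [c2 sm2] := s2.
have [_ sm1] := smooth_at_fst ((t, z) : prod_space (euclid R 1) (glue D)).
apply: (@smooth_at_near R (prod_space (euclid R 1) (glue D)) (glue D) (fun u : prod_space (euclid R 1) (glue D) =>
    gchart_inv x ((u.2).1, weight_act w (u.1 0 0) (gchart x u.2).2))).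
- exact: prod_space_local.
- have nx : \forall u \near (t, z), dom x u.2.1 by exact: (c2 _ (near_dom xz)).
  by apply: filterS nx => u xu; exact: glue_act_eq.
apply: (smooth_at_comp (f := fun u : prod_space (euclid R 1) (glue D) =>
    ((u.2).1, weight_act w (u.1 0 0) (gchart x u.2).2) : Y)); last first.
  by apply: gchart_inv_smooth; split.
apply: (smooth_at_pair mP).
  have /smooth_mapP sf := glue_fst_smooth D.
  exact: smooth_at_comp s2 (sf _).
apply: (smooth_at_row mP) => j; under eq_fun do rewrite mxE.
apply: (sm_atM mP).
  apply: (sm_at_exp mP); apply: (sm1 (fun r => r 0 0)); exact: euclid_sm_coord.
by apply: (sm2 (fun z' => (gchart x z').2 0 j)); exact: gchart_coord_smooth.
Qed.

Definition glue_base_of (c : base glue_gspace) : B := (val c : glue D).1.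

Lemma glue_zeroP b : ((b, 0) : glue D) \in range (@gact R glue_gspace 0).
Proof.
by apply: mem_set; exists (b, 0) => //; rewrite /= /glue_act /= (weight_act0 (@co_w0 R D)).
Qed.

Definition glue_zero (b : B) : base glue_gspace := exist _ ((b, 0) : glue D) (glue_zeroP b).

Lemma glue_base_ofK : cancel glue_base_of glue_zero.
Proof.
move=> c; apply: val_inj; rewrite /= /glue_base_of; case: c => z /= /set_mem[z' _ <-].
by rewrite /= /glue_act /= (weight_act0 (@co_w0 R D)).
Qed.

Lemma glue_zero_fst (z : glue_gspace) : glue_zero z.1 = proj z.
Proof. by rewrite -[RHS]glue_base_ofK. Qed.

Lemma glue_base_of_smooth : smooth_map glue_base_of.
Proof.
apply/smooth_mapP => c; apply: (smooth_at_comp (f := val : base glue_gspace -> glue D)).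
  exact: sub_space_val.
by have /smooth_mapP := glue_fst_smooth D; exact.
Qed.

(** Equivariance at t = 0 forces each [co_h x b] to fix 0, so the zero section has constant
    coordinate 0 in every chart. *)
Lemma glue_zero_smooth : smooth_map glue_zero.
Proof.
apply/smooth_mapP => b; apply: smooth_at_sub; first exact: manifold_local.
have bb : dom b b := co_domx _.
apply: (@smooth_at_near R B (glue D) (fun b' => gchart_inv b ((b', 0) : Y))).
- exact: manifold_local.
- apply: open_nearW (@co_open R D b) bb _ => b' bb'.
  have E : gchart b ((b', 0) : glue D) = ((b', 0) : Y).
    rewrite /gchart /= -{1}(weight_act0 (@co_w0 R D) 0) co_act//.
    by rewrite (weight_act0 (@co_w0 R D)).
  by apply: etrans (esym (@gchartK R D b (b', 0) bb')) _; rewrite E.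
apply: (smooth_at_comp (f := fun b' => (b', 0) : Y)); last by apply: gchart_inv_smooth; split.
by apply: (smooth_at_pair mB); [exact: smooth_at_id|exact: (smooth_at_cst mB)].
Qed.

Lemma glue_base_manifold : is_manifold (base glue_gspace).
Proof.
apply: (manifold_diffeo _ glue_base_of_smooth glue_zero_smooth) => //.
- exact: sub_space_local.
- exact: glue_base_ofK.
Qed.

Definition glue_phi x (z : glue_gspace) : prod_space (base glue_gspace) (euclid R n) :=
  (proj z, (gchart x (z : glue D)).2).

Definition glue_psi x (u : prod_space (base glue_gspace) (euclid R n)) : glue_gspace :=
  gchart_inv x ((glue_base_of u.1, u.2) : Y).

Lemma glue_triv x :
  [/\ @local_diffeo R glue_gspace (prod_space (base glue_gspace) (euclid R n))
        (@proj R glue_gspace @^-1` (glue_base_of @^-1` dom x))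
        ((glue_base_of @^-1` dom x) `*` setT) (glue_phi x) (glue_psi x),
      forall y, (glue_base_of @^-1` dom x) (proj y) -> (glue_phi x y).1 = proj y &
      forall t y, (glue_base_of @^-1` dom x) (proj y) ->
        glue_phi x (gact t y) = (proj y, weight_act w t (glue_phi x y).2)].
Proof.
have mGB := glue_base_manifold.
pose GY := prod_space (base glue_gspace) (euclid R n).
have mGY : is_manifold GY := prod_manifold mGB mE.
have /smooth_mapP s0 := glue_zero_smooth; have /smooth_mapP s1 := glue_base_of_smooth.
have /smooth_mapP sf := glue_fst_smooth D.
split=> //.
- apply: local_diffeo_intro.
  + exact: glue_local.
  + apply: (@open_comp _ _ (fst : glue D -> B)); last exact: co_open.
    by move=> z _; have [] := sf z.
  + apply: open_setX; last exact: openT.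
    by apply: open_comp => [c' _|]; [have [] := s1 c'|exact: co_open].
  + move=> z xz; split; first by split.
    exact: (@gchartK R D x z xz).
  + move=> [c' v] [/= xc _]; split=> //.
    congr (_, _); first by rewrite -glue_zero_fst; exact: glue_base_ofK.
    exact: (congr1 snd (@gchart_invK R D x (glue_base_of c', v) (conj xc I))).
  + move=> z xz; apply: (smooth_at_pair mG); last first.
      apply: (@smooth_at_comp R (glue D) Y (euclid R n) (gchart x) snd z).
        exact: gchart_smooth.
      exact: smooth_at_snd.
    apply: (@smooth_at_near R (glue D) (base glue_gspace) (glue_zero \o fst)).
    * exact: glue_local.
    * by apply: (@nearW _ (nbhs z)) => y; rewrite /= -glue_zero_fst.
    by apply: (@smooth_at_comp R (glue D) B _ fst glue_zero z); [exact: sf|exact: s0].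
  + move=> [c' v] [/= xc _].
    apply: (smooth_at_comp (f := fun u : GY => (glue_base_of u.1, u.2) : Y)); last first.
      by apply: gchart_inv_smooth; split.
    apply: (smooth_at_pair mGY); last exact: smooth_at_snd.
    apply: (smooth_at_comp (f := fst : GY -> base glue_gspace)); last exact: s1.
    exact: smooth_at_fst.
- move=> t z xz; congr (_, _).
    by rewrite -!glue_zero_fst.
  by rewrite [gact t z]/= gchart_act.
Qed.

Lemma glue_gbundleP k : weights_upto k w -> is_gbundle k glue_gspace.
Proof.
move=> wk; split; [exact: mG| |exact: glue_base_manifold|].
  split; [exact: glue_act1|exact: glue_actM|exact: glue_act_smooth].
exists n, w; split=> // c; pose x := glue_base_of c.
exists (glue_base_of @^-1` dom x), (glue_phi x), (glue_psi x).
have [d p a] := glue_triv x; split; [exact: co_domx|exact: d|exact: p|exact: a].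
Qed.

Definition glue_gbundle k (wk : weights_upto k w) : gbundle R k :=
  GBundle (glue_gbundleP wk).

End GlueBundle.

                                              

(** * Essential surjectivity and the equivalence *)

(** The types of the fibre maps depend on the base maps, so fibre maps are compared after transport
    along equalities of image points. *)
Lemma cb_map_ext (R : realType) (B B' : cbundle R) (Phi Psi : cb_map B B') :
  (forall x : B, exists e : Phi x = Psi x,
     forall c, eq_rect _ (fun y : B' => cb_fib y) (cm_fib Phi c) _ e = cm_fib Psi c) ->
  Phi = Psi.
Proof.
case: Phi Psi => [b f] [b' f'] /= E.
have bE : b = b' by apply: funext => x; have [] := E x.
case: _ / bE f' E => f' E; congr CBMap.
apply: functional_extensionality_dep => x; apply: funext => c.
by have [e <-] := E x; rewrite (Prop_irrelevance e erefl).
Qed.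

                                                                          
                                                               
(** Expanding in constant sections of the given charts writes a matrix coefficient in arbitrary
    charts as a finite sum of products of smooth transition coefficients with coefficients in the
    given charts; one pair of charts per point is therefore enough. *)
Lemma cb_map_smooth_local (R : realType) k (B B' : fgwcb R k) (Phi : cb_map B B') :
  smooth_map Phi ->
  (forall (x : B) a (u v : cb_fib x), cm_fib Phi (a *: u + v) = a *: cm_fib Phi u + cm_fib Phi v) ->
  (forall x : B, exists A A' U phi U' phi',
     [/\ free_weil_alg k A, free_weil_alg k A',
         @cb_atlas R B (gdual A) U phi /\ U x,
         @cb_atlas R B' (gdual A') U' phi' /\ U' (Phi x) &
         forall (c : gdual A) (l : dual (gdual A')) (s : forall y : B, cb_fib y),
           (forall y, U y -> phi y (s y) = c) ->
           sm_at x (fun y => l (phi' (Phi y) (cm_fib Phi (s y))))]) ->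
  cb_map_smooth Phi.
Proof.
move=> sPhi lPhi loc C W chi C' W' chi' ac ac' c l s sc x Wx Wx'.
have [mB isoB idB _] := cb_axioms B; have [_ isoB' idB' _] := cb_axioms B'.
have [A [A' [U [phi [U' [phi' [fA fA' [aU Ux] [aU' Ux'] sm]]]]]]] := loc x.
have [I [e [e' eE]]] := free_weil_frame fA.
have [J [d [d' dE]]] := free_weil_frame fA'.
have [oU isoU] := isoB _ _ _ aU; have [oU' isoU'] := isoB' _ _ _ aU'.
have [oW' isoW'] := isoB' _ _ _ ac'.
have cst_sec (D : gcoalg R) (Bd : cbundle R) (V : set Bd) (f : forall x : Bd, cb_fib x -> D) u :
    (forall x, V x -> coalg_iso (f x)) -> exists t : forall x : Bd, cb_fib x,
    forall x, V x -> f x (t x) = u.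
  move=> iso; have ex y : exists v : cb_fib y, V y -> f y v = u.
    have [Vy|nVy] := pselect (V y); last by exists 0.
    by have [g [_ gK _ _]] := iso y Vy; exists (g u).
  by exists (fun y => projT1 (cid (ex y))) => y Vy; case: cid => v /=; apply.
have [t tE] : exists t : I -> forall y : B, cb_fib y, forall i y, U y -> phi y (t i y) = e i.
  exists (fun i => projT1 (cid (cst_sec _ B U phi (e i) isoU))) => i y.
  by case: cid => ? /=; apply.
have [t' tE'] : exists t : J -> forall y : B', cb_fib y, forall j y, U' y -> phi' y (t j y) = d j.
  exists (fun j => projT1 (cid (cst_sec _ B' U' phi' (d j) isoU'))) => j y.
  by case: cid => ? /=; apply.
have [cPhi smPhi] := sPhi.
apply: (sm_at_near mB (f := fun y => \sum_i (e' i (phi y (s y)) *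
    \sum_j (d' j (phi' (Phi y) (cm_fib Phi (t i y))) * l (chi' (Phi y) (t' j (Phi y))))))).
  have nU : \forall y \near x, U y by exact: open_nbhs_nbhs.
  have nU' : \forall y \near x, U' (Phi y) by apply: cPhi; exact: open_nbhs_nbhs.
  have nW' : \forall y \near x, W' (Phi y) by apply: cPhi; exact: open_nbhs_nbhs.
  apply: filterS3 nU nU' nW' => y Uy Uy' Wy'.
  have [g [gK _ [phiL _ _ _] _]] := isoU _ Uy.
  have [g' [gK' _ [phiL' _ _ _] _]] := isoU' _ Uy'.
  have [_ [_ _ [chiL' _ _ _] _]] := isoW' _ Wy'.
  have E1 : s y = \sum_i e' i (phi y (s y)) *: t i y.
    apply: (can_inj gK); rewrite (linear_map_sum _ _ _ _ phiL) {1}[LHS]eE.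
    by apply: eq_bigr => i _; rewrite tE.
  have E2 v : v = \sum_j d' j (phi' (Phi y) v) *: t' j (Phi y).
    apply: (can_inj gK'); rewrite (linear_map_sum _ _ _ _ phiL') {1}[LHS]dE.
    by apply: eq_bigr => j _; rewrite tE'.
  rewrite [in LHS]E1 (linear_map_sum _ _ _ _ (lPhi y)) (linear_map_sum _ _ _ _ chiL').
  rewrite dual_linear_sum; apply: eq_bigr => i _; congr (_ * _).
  rewrite [in LHS](E2 (cm_fib Phi (t i y))) (linear_map_sum _ _ _ _ chiL').
  by rewrite dual_linear_sum.
apply: (sm_at_sum mB) => i; apply: (sm_atM mB); first exact: (idB _ _ _ _ _ _ ac aU c (e' i) s sc x Wx Ux).
apply: (sm_at_sum mB) => j; apply: (sm_atM mB); first exact: (sm (e i) (d' j) (t i) (tE i)).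
exact: smPhi (idB' _ _ _ _ _ _ aU' ac' (d j) l (t' j) (tE' j) (Phi x) Ux' Wx').
Qed.

Lemma coalg_hom_comp (R : realType) (C C' C'' : gcoalg R) (f : C -> C') (g : C' -> C'') :
  coalg_hom f -> coalg_hom g -> coalg_hom (g \o f).
Proof.
move=> [fl fd fu fm] [gl gd gu gm]; split=> [a u v|i c /fd/gd|c|c s /fm/gm] //=.
- by rewrite fl gl.
- by rewrite gu fu.
- by rewrite -map_comp.
Qed.

(** The [pco] span the dual and are combinations of evaluations at points, so linear statements need
    checking on evaluations only. *)
Lemma fev_ind (R : realType) k (F : gbundle R k) (x : base F) (P : dual (hom_G x) -> Prop) :
  P 0 -> (forall a u v, P u -> P v -> P (a *: u + v)) ->
  (forall (y : fiber x) i, P (fev y i)) -> forall u, P u.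
Proof.
move=> P0 PL Pf u; have [n [w [wP /(_ x)[U [phi [psi [Ux tr]]]]]]] := gb_trivP F.
have Psum (I : Type) (r : seq I) (a : I -> R) f : (forall i, P (f i)) -> P (\sum_(i <- r) a i *: f i).
  move=> fP; elim: r => [|i r IH]; first by rewrite big_nil.
  by rewrite big_cons; exact: PL.
rewrite (dual_expand wP (fib_presP wP tr Ux) u); apply: (Psum) => m.
apply: (Psum) => q; have := Pf (fpt x (psi (x, grid_pt R q))) (mweight w m).
by congr P; apply: dual_ext => a; apply/esym; exact: pcrv_fpt.
Qed.

Lemma triv_map_fev (R : realType) k (F : gbundle R k) n (w : 'I_n -> nat)
    (wP : weights_upto k w) U phi psi (tr : @gb_triv R k F n w U phi psi)
    (A : galg R) (pi : {lrmorphism mpoly n R -> A}) (piP : weil_pres k w pi)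
    (x : base F) (y : fiber x) i : U x ->
  triv_map wP tr piP (fev y i) = pcrv wP piP (coord phi (val y)) i.
Proof.
move=> Ux; have -> : fev y i = pcrv wP (fib_presP wP tr Ux) (coord phi (val y)) i.
  by apply: dual_ext => a; apply/esym; exact: (pcrv_coord wP tr Ux y).
exact: (@ptr_pcrv _ _ _ _ wP A (hom_G_galg x) pi (fib_pres tr Ux) piP).
Qed.

Section EssSurj.
Variables (R : realType) (k : nat) (Bd : fgwcb R k).
Variables (A : galg R) (n : nat) (w : 'I_n -> nat).
Hypothesis wP : weights_upto k w.
Variable pi : {lrmorphism mpoly n R -> A}.
Hypothesis piP : weil_pres k w pi.
Variables (U : Bd -> set Bd) (phi : forall x b : Bd, cb_fib b -> gdual A).
Hypothesis Ux : forall x, U x x.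
Hypothesis aU : forall x, @cb_atlas R Bd (gdual A) (U x) (phi x).
Implicit Types (x b : Bd) (v : 'rV[R]_n) (T : gdual A -> gdual A).

Local Notation crv := (pcrv wP piP).

                                                                           
(** The action of a coalgebra endomorphism on the space R^n of curves: the parameter of the image of
    the curve of v ([cmapP]). *)
Definition cmap T v : 'rV[R]_n :=
  \row_j (T (crv v (w j)) : dual A) (pi (mpolyX R (mnm1 j))).

Lemma cmapP T v i : coalg_hom T -> crv (cmap T v) i = T (crv v i).
Proof.
move=> hT; have [v' vE] := curve_pcrv wP piP (coalg_hom_curve hT (pcrv_curve wP piP v)).
have -> : cmap T v = v'.
  by apply/rowP => j; rewrite mxE -(pcrv_gen wP piP v') -vE.
by rewrite -vE.
Qed.

Lemma chart_inv_ex x b : exists g : gdual A -> cb_fib b, U x b ->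
  [/\ cancel (@phi x b) g, cancel g (@phi x b), coalg_hom (@phi x b) & coalg_hom g].
Proof.
have [xb|nxb] := pselect (U x b); last by exists (fun=> 0).
have [_ isoB _ _] := cb_axioms Bd.
have [_ /(_ b xb)[g gP]] := isoB _ _ _ (aU x).
by exists g.
Qed.

Definition chart_inv x b : gdual A -> cb_fib b := projT1 (cid (chart_inv_ex x b)).

Lemma chart_invP x b : U x b ->
  [/\ cancel (@phi x b) (chart_inv x b), cancel (chart_inv x b) (@phi x b),
      coalg_hom (@phi x b) & coalg_hom (chart_inv x b)].
Proof. exact: (projT2 (cid (chart_inv_ex x b))). Qed.

Lemma transition_hom x y b : U x b -> U y b -> coalg_hom (@phi x b \o chart_inv y b).
Proof.
move=> xb yb; have [_ _ h _] := chart_invP xb; have [_ _ _ h'] := chart_invP yb.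
exact: coalg_hom_comp.
Qed.

(** The reference coordinate over b is that of the chart at b itself, so these are the coalgebra
    transitions between the charts at b and at x, acting on curves. *)
Definition fib_h x b := cmap (@phi x b \o chart_inv b b).
Definition fib_h' x b := cmap (@phi b b \o chart_inv x b).

Lemma fib_hK x b : U x b -> cancel (fib_h x b) (fib_h' x b).
Proof.
move=> xb v; apply: (pcrv_inj (wP := wP) (piP := piP)) => i; rewrite !cmapP; try exact: transition_hom.
have [K K' _ _] := chart_invP xb; have [L L' _ _] := chart_invP (Ux b).
by rewrite /= K L'.
Qed.

Lemma fib_h'K x b : U x b -> cancel (fib_h' x b) (fib_h x b).
Proof.
move=> xb v; apply: (pcrv_inj (wP := wP) (piP := piP)) => i; rewrite !cmapP; try exact: transition_hom.
have [K K' _ _] := chart_invP xb; have [L L' _ _] := chart_invP (Ux b).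
by rewrite /= L K'.
Qed.

Lemma fib_h_act x b t v : U x b ->
  fib_h x b (weight_act w t v) = weight_act w t (fib_h x b v).
Proof.
move=> xb; have hT := transition_hom xb (Ux b).
apply: (pcrv_inj (wP := wP) (piP := piP)) => i.
rewrite (cmapP _ _ hT) pcrv_act [RHS](pcrv_act wP piP) (cmapP _ _ hT).
by have [hL _ _ _] := hT; rewrite (linear_mapZ _ _ hL).
Qed.

Lemma fib_h_trans x y b v : U x b -> U y b ->
  fib_h x b (fib_h' y b v) = cmap (@phi x b \o chart_inv y b) v.
Proof.
move=> xb yb; apply: (pcrv_inj (wP := wP) (piP := piP)) => i.
rewrite !cmapP; try exact: transition_hom.
have [L L' _ _] := chart_invP (Ux b).
by rewrite /= L.
Qed.

Lemma fib_h_id b v : fib_h b b v = v.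
Proof.
apply: (pcrv_inj (wP := wP) (piP := piP)) => i; rewrite cmapP; last exact: transition_hom.
by have [_ L' _ _] := chart_invP (Ux b); rewrite /= L'.
Qed.

(** The reference chart cancels in the composite, leaving the transition from y to x: a polynomial
    in v whose coefficients are matrix coefficients of the smooth cocycle. *)
Lemma fib_h_smooth x y b v j : U x b -> U y b ->
  @sm_at R (prod_space Bd (euclid R n)) (b, v)
    (fun u => fib_h x u.1 (fib_h' y u.1 u.2) 0 j).
Proof.
move=> xb yb; have [mB isoB idB _] := cb_axioms Bd.
have mE := euclid_manifold R n; have mY := prod_manifold mB mE.
have [oUx _] := isoB _ _ _ (aU x); have [oUy _] := isoB _ _ _ (aU y).
pose Xj := pi (mpolyX R (mnm1 j)).
pose co (m : mon_index k n) b := (@phi x b (chart_inv y b (pco wP piP m)) : dual A) Xj.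
apply: (sm_at_near mY (f := fun u : prod_space Bd (euclid R n) => \sum_(m : mon_index k n)
   (vmon u.2 m * ((mweight w m == w j) && (w j <= k)%N)%:R) * co m u.1)).
  have oW : open ((U x `&` U y) `*` (setT : set (euclid R n))).
    by apply: open_setX; [exact: openI|exact: openT].
  apply: (open_nearW oW) => [|[b' v'] [[/= xb' yb'] _]]; first by split.
  rewrite fib_h_trans// mxE (pcrv_expand wP piP).
  have [hL _ _ _] := transition_hom xb' yb'.
  by rewrite (linear_map_sum _ _ _ _ hL) dual_sumE.
have [_ s1] := smooth_at_fst ((b, v) : prod_space Bd (euclid R n)).
have [_ s2] := smooth_at_snd ((b, v) : prod_space Bd (euclid R n)).
apply: (sm_at_sum mY) => m; apply: (sm_atM mY).
  apply: (sm_atM mY); last exact: sm_at_cst.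
  apply: (sm_at_prod mY) => l; apply: (sm_at_exp mY).
  by apply: (s2 (fun r => r 0 l)); exact: euclid_sm_coord.
apply: (s1 (co m)).
have evP r (c c' : dual A) : (r *: c + c') Xj = r * c Xj + c' Xj by [].
apply: (idB _ _ _ _ _ _ (aU y) (aU x) (pco wP piP m) (mk_dual evP)
  (fun b => chart_inv y b (pco wP piP m)) _ b yb xb).
by move=> b' yb'; have [_ K _ _] := chart_invP yb'; rewrite K.
Qed.

Lemma atlas_open x : open (U x).
Proof. by have [_ isoB _ _] := cb_axioms Bd; have [] := isoB _ _ _ (aU x). Qed.

Lemma fgwcb_manifold : is_manifold Bd. Proof. by case: (cb_axioms Bd). Qed.

Lemma weights_gt0 j : (0 < w j)%N. Proof. by case/andP: (wP j). Qed.

Definition fib_cocycle : cocycle R :=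
  @Cocycle R Bd fgwcb_manifold n w weights_gt0 U atlas_open Ux fib_h fib_h'
    fib_hK fib_h'K fib_h_act fib_h_smooth.

Definition total : gbundle R k := @glue_gbundle R fib_cocycle k wP.

Definition total_triv x :
  @gb_triv R k total n w (@glue_base_of R fib_cocycle @^-1` U x) _ _ :=
  glue_triv (D := fib_cocycle) x.

Local Notation pr := (@glue_base_of R fib_cocycle : base total -> Bd).
Local Notation zr := (@glue_zero R fib_cocycle : Bd -> base total).
Local Notation tm x := (triv_map wP (total_triv x) piP).

Definition counit_fib (c : base total) (u : gdual (hom_G_galg c)) : cb_fib (pr c) :=
  chart_inv (pr c) (pr c) (tm (pr c) u).

Definition counit_map : cb_map (circ_ob total) Bd := @CBMap R (circ_ob total) Bd pr counit_fib.

                                                                               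
                            
(** The counit is defined through the chart at [pr c], which changes from point to point; yet any
    chart x reads it as the trivialization of the glued bundle. On evaluations at points this is the
    definition of [fib_h], and evaluations span. Smoothness of the counit and of its inverse
    follows. *)
Lemma phi_counit x (c : base total) (u : gdual (hom_G_galg c)) : U x (pr c) ->
  @phi x (pr c) (counit_fib u) = tm x u.
Proof.
move=> xc; have hT := transition_hom xc (Ux (pr c)); have [hL _ _ _] := hT.
rewrite -[LHS]/((@phi x (pr c) \o chart_inv (pr c) (pr c)) (tm (pr c) u)).
have tL a (u1 u2 : gdual (hom_G_galg c)) x' : tm x' (a *: u1 + u2) = a *: tm x' u1 + tm x' u2.
  exact: ptr_linear.
elim/(@fev_ind R k total c) : u => [|a u v IHu IHv|y i].
- have t0 x' : tm x' (0 : gdual (hom_G_galg c)) = 0.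
    by rewrite -[X in tm x' X](scale0r 0) (linear_mapZ _ _ (fun a u u' => tL a u u' x')) scale0r.
  have := linear_mapZ 0 0 hL; rewrite scale0r [RHS]scale0r => T0.
  by rewrite !t0 T0.
- by rewrite !tL hL IHu IHv.
rewrite triv_map_fev; last exact: Ux.
rewrite [RHS]triv_map_fev// -(cmapP _ _ hT); congr (crv _ i).
(* The point y is a pair (b, v) with b = [pr c]; its coordinate is v in the chart at b and
   [fib_h x b v] in the chart at x. *)
have e : (val y : glue fib_cocycle).1 = pr c by exact: (congr1 pr (fiberP y)).
rewrite -[RHS]/(fib_h x (val y : glue fib_cocycle).1 (val y : glue fib_cocycle).2).
rewrite -[X in cmap _ X]/(fib_h (pr c) (val y : glue fib_cocycle).1 (val y : glue fib_cocycle).2).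
by rewrite e fib_h_id.
Qed.

Lemma counit_inv_ex b : exists g : gdual A -> gdual (hom_G_galg (zr b)),
  [/\ cancel (@triv_map _ _ _ _ _ wP _ _ _ (total_triv b) A pi piP (zr b)) g,
      cancel g (@triv_map _ _ _ _ _ wP _ _ _ (total_triv b) A pi piP (zr b)) & coalg_hom g].
Proof.
have [g [K K' _ h]] := triv_map_iso wP (total_triv b) piP (x := zr b) (Ux b).
by exists g.
Qed.

Definition counit_inv_fib b (u : cb_fib b) : gdual (hom_G_galg (zr b)) :=
  projT1 (cid (counit_inv_ex b)) (@phi b b u).

Lemma counit_invK b (u : cb_fib b) : @counit_fib (zr b) (counit_inv_fib u) = u.
Proof.
rewrite /counit_inv_fib; case: cid => g [K K' h] /=.
have [L L' _ _] := chart_invP (Ux b).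
by rewrite -[LHS]/(chart_inv b b (tm b (g (@phi b b u)))) K' L.
Qed.

Lemma counit_fibK b (u : gdual (hom_G_galg (zr b))) :
  counit_inv_fib (@counit_fib (zr b) u : cb_fib b) = u.
Proof.
rewrite /counit_inv_fib; case: cid => g [K K' h] /=.
have [L L' _ _] := chart_invP (Ux b).
by rewrite -[X in g (@phi _ _ X)]/(chart_inv b b (tm b u)) L' K.
Qed.

Definition counit_inv_map : cb_map Bd (circ_ob total) :=
  @CBMap R Bd (circ_ob total) zr counit_inv_fib.

Definition circ_total : fgwcb R k := FGWCB (circ_obP total).

Lemma counitP : @is_cb_hom R circ_total Bd counit_map.
Proof.
have hom (c : base total) : coalg_hom (@counit_fib c).
  have [g [_ _ h _]] := triv_map_iso wP (total_triv (pr c)) piP (x := c) (Ux (pr c)).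
  have [_ _ _ h'] := chart_invP (Ux (pr c)).
  exact: coalg_hom_comp h h'.
split; [exact: glue_base_of_smooth|exact: hom|].
apply: (@cb_map_smooth_local R k circ_total Bd counit_map) => [|c a u v|c].
- exact: glue_base_of_smooth.
- by have [hL _ _ _] := hom c; exact: hL.
exists A, A, (pr @^-1` U (pr c)), (triv_map wP (total_triv (pr c)) piP), (U (pr c)), (@phi (pr c)).
have fA := weil_pres_free wP piP.
split=> //.
  by split; [exact: triv_atlas|exact: (Ux (pr c))].
move=> l0 l s sE; have mB := base_manifold total.
apply: (sm_at_near mB (f := cst (l l0))); last exact: sm_at_cst.
apply: open_nearW (triv_open (total_triv (pr c))) (Ux (pr c)) _ => c' Uc'.
by rewrite /= phi_counit// sE.
Qed.

Lemma counit_invP : @is_cb_hom R Bd circ_total counit_inv_map.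
Proof.
have hom b : coalg_hom (@counit_inv_fib b).
  rewrite /counit_inv_fib; case: cid => g [_ _ h] /=.
  have [_ _ h' _] := chart_invP (Ux b).
  exact: coalg_hom_comp h' h.
have zs := glue_zero_smooth fib_cocycle.
split; [exact: zs|exact: hom|].
apply: (@cb_map_smooth_local R k Bd circ_total counit_inv_map) => [|b a u v|b].
- exact: zs.
- by have [hL _ _ _] := hom b; exact: hL.
exists A, A, (U b), (@phi b), (pr @^-1` U b), (triv_map wP (total_triv b) piP).
have fA := weil_pres_free wP piP.
split=> //.
  by split; [exact: triv_atlas|exact: (Ux b)].
move=> l0 l s sE; have mB := fgwcb_manifold.
apply: (sm_at_near mB (f := cst (l l0))); last exact: sm_at_cst.
apply: open_nearW (atlas_open b) (Ux b) _ => b' Ub'.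
by rewrite /= -(phi_counit (c := zr b')) // counit_invK sE.
Qed.

Lemma counit_comp_inv : cb_compmap counit_map counit_inv_map = cb_idmap Bd.
Proof.
by apply: cb_map_ext => b; exists erefl => u; rewrite /= counit_invK.
Qed.

Lemma counit_inv_comp : cb_compmap counit_inv_map counit_map = cb_idmap (circ_ob total).
Proof.
apply: cb_map_ext => c.
(* Only for c in the image of [zr] is the transport trivial; every c is of that form, and the
   statement is moved along this equality. *)
pose P (c : base total) := exists e : zr (pr c) = c, forall u : gdual (hom_G_galg c),
  eq_rect _ (fun y : base total => gdual (hom_G_galg y)) (counit_inv_fib (counit_fib u)) _ e = u.
have H b : P (zr b) by exists erefl => u /=; rewrite counit_fibK.
exact: (eq_ind _ P (H (pr c)) c (@glue_base_ofK R fib_cocycle c)).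
Qed.

End EssSurj.

(** Choose for every object d an object [G0 d] with an isomorphism [eps d] from its image to d. A
    morphism g goes to the preimage under F of its conjugate by these isomorphisms; faithfulness
    gives the functor laws and naturality. *)
Lemma ff_ess_surj_equivalence (C D : category) (F : functor C D) :
  (forall (a b : C) (f g : c_hom a b), f_mor F f = f_mor F g -> f = g) ->
  (forall (a b : C) (g : c_hom (F a) (F b)), exists f, f_mor F f = g) ->
  (forall d : D, exists (a : C) (g : c_hom (F a) d), is_iso g) ->
  is_equivalence F.
Proof.
move=> faith full ess.
pose pre a b g := projT1 (cid (full a b g)).
have preE a b g : f_mor F (pre a b g) = g by rewrite /pre; case: cid.
have ess' d : {a : C & {g : c_hom (F a) d & {g' : c_hom d (F a) |
    c_comp g' g = c_id (F a) /\ c_comp g g' = c_id d}}}.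
  have [a /cid[g /cid[g' gP]]] := cid (ess d).
  by exists a, g, g'.
pose G0 d := projT1 (ess' d).
pose eps d : c_hom (F (G0 d)) d := projT1 (projT2 (ess' d)).
pose inv d : c_hom d (F (G0 d)) := sval (projT2 (projT2 (ess' d))).
have invK d : c_comp (inv d) (eps d) = c_id _ by have [] := svalP (projT2 (projT2 (ess' d))).
have epsK d : c_comp (eps d) (inv d) = c_id _ by have [] := svalP (projT2 (projT2 (ess' d))).
pose G1 d d' (g : c_hom d d') := pre _ _ (c_comp (inv d') (c_comp g (eps d))).
have G1E d d' (g : c_hom d d') : f_mor F (G1 d d' g) = c_comp (inv d') (c_comp g (eps d)).
  exact: preE.
have G_id d : G1 _ _ (c_id d) = c_id (G0 d).
  by apply: faith; rewrite G1E f_id c_idl invK.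
have G_comp d d' d'' (g : c_hom d' d'') (f : c_hom d d') :
    G1 _ _ (c_comp g f) = c_comp (G1 _ _ g) (G1 _ _ f).
  apply: faith; rewrite f_comp !G1E -!c_assoc; congr (c_comp (inv d'') (c_comp g _)).
  by rewrite (c_assoc (eps d')) epsK c_idl.
pose G := @Functor D C G0 G1 G_id G_comp.
exists G; split.
  exists (fun a => pre (G0 (F a)) a (eps (F a))); split=> [a|a b f].
    exists (pre a (G0 (F a)) (inv (F a))); split; apply: faith; rewrite f_comp f_id !preE.
      exact: invK.
    exact: epsK.
  by apply: faith; rewrite !f_comp !preE /= !c_assoc epsK c_idl.
exists eps; split=> [d|d d' g]; first by exists (inv d); split; [exact: invK|exact: epsK].
by rewrite /= G1E !c_assoc epsK c_idl.
Qed.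

(** Choosing one trivialization around each point gives the charts of the gluing, indexed by the
    points themselves. *)
Lemma circ_ess_surj (R : realType) k (Bd : fgwcb R k) :
  exists (F : gbundle R k) (Phi : cb_map (circ_ob F) Bd) (Psi : cb_map Bd (circ_ob F)),
  [/\ @is_cb_hom R (FGWCB (circ_obP F)) Bd Phi, @is_cb_hom R Bd (FGWCB (circ_obP F)) Psi,
      cb_compmap Psi Phi = cb_idmap (circ_ob F) & cb_compmap Phi Psi = cb_idmap Bd].
Proof.
have [_ _ _ [A [[n [w [wP [pi piP]]]] cover]]] := cb_axioms Bd.
pose U (x : Bd) : set Bd := projT1 (cid (cover x)).
have ex x : exists phi : forall b : Bd, cb_fib b -> gdual A, U x x /\ @cb_atlas R Bd (gdual A) (U x) phi.
  exact: (projT2 (cid (cover x))).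
pose phi x := projT1 (cid (ex x)).
have Ux x : U x x by have [] := projT2 (cid (ex x)).
have aU x : @cb_atlas R Bd (gdual A) (U x) (phi x) by have [] := projT2 (cid (ex x)).
exists (total wP piP Ux aU), (counit_map wP piP Ux aU), (counit_inv_map wP piP Ux aU); split.
- exact: counitP.
- exact: counit_invP.
- exact: counit_inv_comp.
- exact: counit_comp_inv.
Qed.


Theorem theorem4p17 (R : realType) (k : nat) :
  exists (obP : forall F : gbundle R k, is_fgwcb k (circ_ob F))
         (morP : forall (F E : gbundle R k) (f : gb_hom F E),
            is_cb_hom (circ_mor f)),
    is_equivalence (circ_functor obP morP).
Proof.
exists (@circ_obP R k), (@circ_morP R k); apply: ff_ess_surj_equivalence.
- by move=> F E f g /(congr1 (@ch_map _ _ _ _)); exact: circ_faithful.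
- move=> F E Phi; exists (full_hom (ch_axioms Phi)).
  by apply: cb_hom_eq; exact: full_homE.
move=> Bd; have [F [Phi [Psi [PhiP PsiP PsiPhi PhiPsi]]]] := circ_ess_surj Bd.
exists F, (CBHom PhiP), (CBHom PsiP).
by split; apply: cb_hom_eq; [exact: PsiPhi|exact: PhiPsi].
Qed.
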